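(* Let $\alpha\in(1,2]$. Let $d\mu(x)=e^{-V(x)}dx$ be a probability measure on $\mathbb R^d$ with potential $$V(x)=N\left(\frac{|x|^\alpha}\alpha+V_1(x)\right),\qquad x\in\mathbb R^d,$$ where $N>0$ is a constant. If $V_1$ is continuously differentiable and if there exist $C>0$ and $\delta<\frac\alpha{2+\alpha}$ such that $$|\nabla V_1(x)|\le\delta|x|^{\alpha-1}+C,\qquad x\in\mathbb R^d,$$ then $\mu$ satisfies the modified log-Sobolev inequality with $c=c_\alpha$, as well as an $F_{2/\alpha^*}$-Sobolev inequality; that is, there is a constant $C'$ such that for all smooth $f$, $$\mathrm{Ent}_\mu(f^2)\le C'\int f^2c_\alpha^*\left(\frac{|\nabla f|}f\right)d\mu\quad\text{and}\quad\int f^2F_{2/\alpha^*}\left(\frac{f^2}{\int f^2d\mu}\right)d\mu\le C'\int|\nabla f|^2d\mu.$$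
   Context: $\frac1\alpha+\frac1{\alpha^*}=1$. $\mathrm{Ent}_\mu(f^2)=\int f^2\log\left(f^2/\int f^2d\mu\right)d\mu$. $F_\tau(t)=\log^\tau(1+t)-\log^\tau(2)$ for $t\ge0$. $c_\alpha(t)=t^2/2$ if $|t|\le1$ and $c_\alpha(t)=\frac{|t|^\alpha}\alpha+\frac{\alpha-2}{2\alpha}$ if $|t|\ge1$; $c_\alpha^*=c_{\alpha^*}$ is its convex conjugate. *)

(* Defs.v *)
From HB Require Import structures.
From mathcomp Require Import all_boot all_order all_algebra.
From mathcomp Require Import all_classical all_reals all_analysis.
From mathcomp Require Import ring lra.

Set Implicit Arguments.
Unset Strict Implicit.
Unset Printing Implicit Defensive.

Import Order.TTheory GRing.Theory Num.Theory.
Import numFieldNormedType.Exports.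

Local Open Scope classical_set_scope.
Local Open Scope ring_scope.

(* 'rV[T]_n carries the product sigma-algebra, as n.-tuple T does in the
   library; for T = R it is the Borel sigma-algebra of R^n. *)
Definition measure_rV_display : measure_display -> measure_display.
Proof. exact. Qed.

Section measurable_rV.
Context {d : measure_display} {T : measurableType d}.
Variable n : nat.

Let coors : 'I_n -> 'rV[T]_n -> T := fun i x => x ord0 i.

Let rV_set0 : g_sigma_preimage coors set0.
Proof. exact: sigma_algebra0. Qed.

Let rV_setC A : g_sigma_preimage coors A -> g_sigma_preimage coors (~` A).
Proof. exact: sigma_algebraC. Qed.

Let rV_bigcup (F : (set 'rV[T]_n)^nat) :
  (forall i, g_sigma_preimage coors (F i)) ->
  g_sigma_preimage coors (\bigcup_i (F i)).
Proof. exact: sigma_algebra_bigcup. Qed.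

HB.instance Definition _ := @isMeasurable.Build (measure_rV_display d)
  'rV[T]_n (g_sigma_preimage coors) rV_set0 rV_setC rV_bigcup.

End measurable_rV.

Section lebesgue_measure_rV.
Context {R : realType}.
Local Open Scope ereal_scope.

Definition rV_cons (n : nat) (p : measurableTypeR R * 'rV[R]_n) : 'rV[R]_n.+1 :=
  row_mx (const_mx p.1 : 'rV[R]_1) p.2.

Lemma measurable_rV_coord n (i : 'I_n) :
  measurable_fun [set: 'rV[R]_n] (fun x => x ord0 i).
Proof.
move=> _ Y mY; rewrite setTI; apply: sub_sigma_algebra => /=.
rewrite -bigcup_seq/=; exists i => /=; first by rewrite mem_index_enum.
by exists Y => //; rewrite setTI.
Qed.

Lemma measurable_fun_rV d (T : measurableType d) n (f : T -> 'rV[R]_n) :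
  (forall i, measurable_fun [set: T] (fun x => f x ord0 i)) ->
  measurable_fun [set: T] f.
Proof.
move=> mf _ A mA; rewrite setTI.
have : (g_sigma_preimage (fun i => (fun x : 'rV[R]_n => x ord0 i) \o f))
    `<=` measurable.
  apply: smallest_sub; first exact: sigma_algebra_measurable.
  rewrite -bigcup_seq => B [i _] [C mC <-].
  exact: mf.
rewrite g_sigma_preimage_comp; apply.
by exists A => //; rewrite setTI.
Qed.

Lemma rV_cons_ord0 n p : @rV_cons n p ord0 ord0 = p.1.
Proof.
have -> : (ord0 : 'I_n.+1) = lshift n (ord0 : 'I_1) by exact/val_inj.
rewrite /rV_cons.
by rewrite (row_mxEl (const_mx p.1 : 'rV[R]_1) p.2 ord0 ord0) mxE.
Qed.

Lemma rV_cons_lift n p (i : 'I_n) :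
  @rV_cons n p ord0 (lift ord0 i) = p.2 ord0 i.
Proof.
have -> : lift ord0 i = rshift 1 i by exact/val_inj.
exact: (row_mxEr (const_mx p.1 : 'rV[R]_1) p.2 ord0 i).
Qed.

Lemma measurable_rV_cons n : measurable_fun setT (@rV_cons n).
Proof.
apply: measurable_fun_rV => i.
have [j ->|->] := unliftP ord0 i.
  under eq_fun do rewrite rV_cons_lift.
  exact: (measurableT_comp (measurable_rV_coord j) measurable_snd).
under eq_fun do rewrite rV_cons_ord0.
exact: measurable_fst.
Qed.

(* lebesgue_rV_box below gives the measure of a product of measurable sets. *)
Fixpoint lebesgue_rV (n : nat) : set 'rV[R]_n -> \bar R :=
  if n is n'.+1 then
    pushforward (@lebesgue_measure R \x @lebesgue_rV n') (@rV_cons n')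
  else \d_(0%R : 'rV[R]_0).

Let rV_uncons n (x : 'rV[R]_n.+1) : measurableTypeR R * 'rV[R]_n :=
  (x ord0 ord0, \row_j x ord0 (lift ord0 j)).

Let measurable_rV_uncons n : measurable_fun setT (@rV_uncons n).
Proof.
apply: measurable_fun_pair; first exact: measurable_rV_coord.
apply: measurable_fun_rV => j /=.
under eq_fun do rewrite mxE.
exact: measurable_rV_coord.
Qed.

Let rV_consK n : cancel (@rV_cons n) (@rV_uncons n).
Proof.
move=> p; rewrite /rV_uncons rV_cons_ord0 [RHS]surjective_pairing.
by congr pair; apply/rowP => j; rewrite mxE rV_cons_lift.
Qed.

Let lebesgue_rV_spec n :
  exists m : {sigma_finite_measure set 'rV[R]_n -> \bar R},
    @lebesgue_rV n = m :> (set _ -> \bar R).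
Proof.
elim: n => [|n [m /= ->]]; first by exists (@dirac _ _ (0%R : 'rV[R]_0) R).
pose P := pushforward (@lebesgue_measure R \x m) (@rV_cons n).
have mcons := @measurable_rV_cons n.
have P0 : P set0 = 0 by exact: measure0.
have P_ge0 A : 0 <= P A by exact: measure_ge0.
have P_add : semi_sigma_additive P by exact: measure_semi_sigma_additive.
have P_sigma : sigma_finite setT P.
  have /sigma_finiteP[F [FT ndF Foo]] := sigma_finiteT (@lebesgue_measure R).
  have /sigma_finiteP[G [GT ndG Goo]] := sigma_finiteT m.
  exists (fun k => @rV_uncons n @^-1` (F k `*` G k)).
    apply/esym/seteqP; split => // x _; rewrite /bigcup/=.
    have [i _ Fi] : (\bigcup_k F k) (rV_uncons x).1 by rewrite -FT.
    have [j _ Gj] : (\bigcup_k G k) (rV_uncons x).2 by rewrite -GT.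
    exists (maxn i j) => //; split.
      by move: Fi; apply/subsetPset/ndF/leq_maxl.
    by move: Gj; apply/subsetPset/ndG/leq_maxr.
  move=> k; have [mF Fk] := Foo k; have [mG Gk] := Goo k; split.
    rewrite -[X in measurable X]setTI; apply: measurable_rV_uncons => //.
    exact: measurableX.
  rewrite /P /pushforward -comp_preimage (_ : _ \o _ = id); last first.
    by apply/funext => p /=; rewrite rV_consK.
  by rewrite preimage_id product_measure1E// lte_mul_pinfty// ge0_fin_numE.
rewrite -/P; clearbody P.
pose iM := isMeasure.Build _ _ _ P P0 P_ge0 P_add.
pose mP : {measure set _ -> \bar R} := HB.pack P iM.
pose iS := Measure_isSigmaFinite.Build _ _ _ mP P_sigma.
pose sP : {sigma_finite_measure set _ -> \bar R} := HB.pack P iM iS.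
by exists sP.
Qed.

Let lebesgue_rV0 n : @lebesgue_rV n set0 = 0.
Proof. by have [m ->] := lebesgue_rV_spec n; exact: measure0. Qed.

Let lebesgue_rV_ge0 n A : 0 <= @lebesgue_rV n A.
Proof. by have [m ->] := lebesgue_rV_spec n; exact: measure_ge0. Qed.

Let lebesgue_rV_sigma_additive n : semi_sigma_additive (@lebesgue_rV n).
Proof.
by have [m ->] := lebesgue_rV_spec n; exact: measure_semi_sigma_additive.
Qed.

HB.instance Definition _ n := isMeasure.Build _ _ _ (@lebesgue_rV n)
  (lebesgue_rV0 n) (@lebesgue_rV_ge0 n) (@lebesgue_rV_sigma_additive n).

Let lebesgue_rV_sigma_finite n : sigma_finite setT (@lebesgue_rV n).
Proof. by have [m ->] := lebesgue_rV_spec n; exact: sigma_finiteT. Qed.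

HB.instance Definition _ n := Measure_isSigmaFinite.Build _ _ _
  (@lebesgue_rV n) (@lebesgue_rV_sigma_finite n).

Lemma lebesgue_rV_box n (A : 'I_n -> set R) : (forall i, measurable (A i)) ->
  lebesgue_rV [set x : 'rV[R]_n | forall i, A i (x ord0 i)] =
  \prod_(i < n) (@lebesgue_measure R) (A i).
Proof.
elim: n A => [|n IH] A mA.
  by rewrite big_ord0 /= diracE mem_set//= => -[].
rewrite big_ord_recl -IH; last by move=> i; exact: mA.
rewrite -product_measure1E//=.
  rewrite /pushforward; congr (_ _); apply/seteqP; split => p /=.
    move=> Ap; split => [|i /=]; first by rewrite -rV_cons_ord0; exact: Ap.
    by rewrite -rV_cons_lift; exact: Ap.
  move=> [A0 Al] i; have [j ->|->] := unliftP ord0 i.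
    by rewrite rV_cons_lift; exact: Al.
  by rewrite rV_cons_ord0.
  exact: mA.
rewrite (_ : mkset _ = \bigcap_(i in [set: 'I_n])
    ((fun x : 'rV[R]_n => x ord0 i) @^-1` A (lift ord0 i))).
  apply: fin_bigcap_measurable => // i _.
  by rewrite -[X in measurable X]setTI; exact: measurable_rV_coord.
by apply/seteqP; split => x /= Ax i => [_|]; [exact: Ax|exact: (Ax i)].
Qed.

End lebesgue_measure_rV.

Section calculus_rV.
Context {R : realType} {d : nat}.
Implicit Types (f : 'rV[R]_d -> R) (x : 'rV[R]_d).

(* The norm `|x| of 'rV[R]_d is the sup norm. *)
Definition enorm x : R := Num.sqrt (\sum_(i < d) x ord0 i ^+ 2).

Definition partial (i : 'I_d) f x : R := 'D_(delta_mx ord0 i) f x.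

Definition gradient f x : 'rV[R]_d := \row_(i < d) partial i f x.

(* f is of class C^k *)
Fixpoint Cn (k : nat) f : Prop :=
  if k is k'.+1 then
    (forall x, differentiable f x) /\ forall i, Cn k' (partial i f)
  else continuous f.

Definition smooth f : Prop := forall k, Cn k f.

End calculus_rV.

Section costs.
Context {R : realType}.

Definition cost (a t : R) : R :=
  if `|t| <= 1 then t ^+ 2 / 2 else `|t| `^ a / a + (a - 2) / (2 * a).

(* [sup] is 0 on unbounded sets; for c = cost a with a > 1 the set is bounded
   and the conjugate is computed in convex_conjugate_cost below. *)
Definition convex_conjugate (c : R -> R) (s : R) : R :=
  sup [set s * t - c t | t in [set: R]].

Definition F_tau (tau t : R) : R := ln (1 + t) `^ tau - ln 2 `^ tau.

Let cost_young (a b x y : R) : 1 < a -> a^-1 + b^-1 = 1 ->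
  0 <= x -> 0 <= y -> x * y <= cost a x + cost b y.
Proof.
move=> a1 ab.
have a0 : 0 < a by lra.
have b0 : 0 < b by rewrite -invr_gt0; have := invf_lt1 a0; rewrite a1 => ?; lra.
have young x' y' : 0 <= x' -> 0 <= y' ->
    x' * y' <= x' `^ a / a + y' `^ b / b.
  by move=> x0 y0; exact: conjugate_powR.
have ha : (a - 2) / (2 * a) = 1 / 2 - a^-1 by field; lra.
have hb : (b - 2) / (2 * b) = 1 / 2 - b^-1 by field; lra.
move=> x0 y0; rewrite /cost !ger0_norm// ha hb.
case: ifPn => [x1|]; [|rewrite -ltNge => x1];
  case: ifPn => [y1|]; [|rewrite -ltNge => y1| |rewrite -ltNge => y1].
- by have := sqr_ge0 (x - y); nra.
- by have := young 1 y ler01 y0; rewrite powR1; nra.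
- by have := young x 1 x0 ler01; rewrite powR1; nra.
- by have := young x y x0 y0; lra.
Qed.

Lemma convex_conjugate_cost (a b : R) : 1 < a -> a^-1 + b^-1 = 1 ->
  convex_conjugate (cost a) = cost b.
Proof.
move=> a1 ab; apply/funext => s; rewrite /convex_conjugate.
have a0 : 0 < a by lra.
have b0 : 0 < b by rewrite -invr_gt0; have := invf_lt1 a0; rewrite a1 => ?; lra.
have cabs c t : cost c `|t| = cost c t.
  by rewrite /cost normr_id real_normK// num_real.
have ub : ubound [set s * t - cost a t | t in [set: R]] (cost b s).
  move=> _ [t _ <-]; rewrite lerBlDr addrC -(cabs a) -(cabs b).
  apply: (le_trans (ler_norm _)); rewrite normrM mulrC.
  exact: cost_young.
apply/eqP; rewrite eq_le; apply/andP; split.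
  by apply: ge_sup => //; exists (s * 0 - cost a 0), 0.
apply: ub_le_sup; first by exists (cost b s).
have [s1|s1] := leP `|s| 1.
  by exists s => //; rewrite /cost s1; field.
exists (Num.sg s * `|s| `^ (b - 1)) => //.
have s0 : 0 < `|s| by lra.
have sgs : `|Num.sg s| = 1 by rewrite normr_sg -normr_gt0 s0.
have b1 : 1 < b.
  by rewrite -[1]invr1 -[b]invrK ltf_pV2 ?posrE ?invr_gt0//; 
     have := invr_gt0 a; rewrite a0 => ?; lra.
have ba : b = a / (a - 1).
  by apply: invr_inj; rewrite invf_div mulrBl mul1r divff ?gt_eqF//; lra.
have nt : `|Num.sg s * `|s| `^ (b - 1)| = `|s| `^ (b - 1).
  by rewrite normrM sgs mul1r ger0_norm ?powR_ge0.
have t1 : 1 < `|s| `^ (b - 1).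
  apply: (@le_lt_trans _ _ (1 `^ (b - 1))); first by rewrite powR1.
  by rewrite gt0_ltr_powR// ?nnegrE ?ler01//; lra.
rewrite /cost nt !leNgt s1 t1 /= mulrA -(mulrC (Num.sg s)) -normrEsg.
have -> : `|s| * `|s| `^ (b - 1) = `|s| `^ b.
  by rewrite -[X in X * _]powRr1 ?normr_ge0// -powRD ?gt_eqF// addrC subrK ?implybT.
have -> : (`|s| `^ (b - 1)) `^ a = `|s| `^ b.
  by rewrite -powRrM; congr (_ `^ _); rewrite ba; field; lra.
have -> : a^-1 = 1 - b^-1 by lra.
have -> : (a - 2) / (2 * a) = 1 / 2 - a^-1 by field; lra.
have -> : (b - 2) / (2 * b) = 1 / 2 - b^-1 by field; lra.
nra.
Qed.

End costs.

Section functional_inequalities.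
Context {R : realType} {d : nat}.
Implicit Types (mu : probability 'rV[R]_d R) (f g : 'rV[R]_d -> R).

Definition entropy mu g : \bar R :=
  (\int[mu]_x (g x * ln (g x / \int[mu]_y g y))%R%:E)%E.

(* The functional inequalities are inequalities in \bar R between integrals over
   all smooth f for which the total mass of f^2 is finite, so that
   f^2 / \int f^2 makes sense; the other integrals may be +oo. *)
Definition square_integrable mu f : Prop :=
  mu.-integrable setT (fun x => (f x ^+ 2)%:E).

(* Where f vanishes, the quotient |grad f| / f is 0 and so is the integrand;
   this only matters where moreover grad f != 0, a Lebesgue-null set. *)
Definition modified_log_sobolev mu (c : R -> R) (K : R) : Prop :=
  forall f, smooth f -> square_integrable mu f ->
  (entropy mu (fun x => (f x ^+ 2)%R) <=
   K%:E * \int[mu]_x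
     (f x ^+ 2 * convex_conjugate c (enorm (gradient f x) / f x))%R%:E)%E.

Definition F_sobolev mu (F : R -> R) (K : R) : Prop :=
  forall f, smooth f -> square_integrable mu f ->
  (\int[mu]_x (f x ^+ 2 * F (f x ^+ 2 / \int[mu]_y (f y ^+ 2)))%R%:E <=
   K%:E * \int[mu]_x (enorm (gradient f x) ^+ 2)%R%:E)%E.

End functional_inequalities.

(* Main.v *)
Require Import Defs.
From mathcomp Require Import all_boot all_order all_algebra.
From mathcomp Require Import all_classical all_reals all_analysis.
From mathcomp Require Import measurable_realfun ring lra.
Import Order.TTheory GRing.Theory Num.Theory.
Import numFieldNormedType.Exports.
Set Implicit Arguments.
Unset Strict Implicit.
Unset Printing Implicit Defensive.
Local Open Scope classical_set_scope.
Local Open Scope ring_scope.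

(* Only delta < 1 matters. Replacing |x|^alpha by (1 + |x|^2)^(alpha/2) changes
   the density by a bounded factor and gives a C^1 potential W.
   (1) For u >= 0 with mass m, int u log_+ u <= m log_+ m + sum_i int |d_i u|:
   along a line u is at most int |d_i u|, and one inducts on the dimension.
   With u = w e^-W this controls int w log_+ (w e^-W) by int (|grad w| + w |grad W|).
   (2) Integrating the divergence of r^g x w e^-W, where r = (1 + |x|^2)^(1/2)
   and g <= 0, and using x . grad W >= a r^alpha - b, controls the moments
   int w r^(alpha + g). For w = (f - c)^2, together with the Poincare inequality
   on cubes, this also gives a Poincare inequality.
   (3) For int f^2 = 1 and t = f^2, both integrands are at most
   kap (t - 1) + C (|f| - 1)^2 plus a tail living on {t > 9}. The first term has
   integral 0 and the second is handled by the Poincare inequality. The tail is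
   estimated by (1) and (2) applied to a smooth truncation w of f^2, whose mass
   is again bounded by int (|f| - 1)^2; hence no defect term remains. *)

(** * Measurability and C^1 calculus on row vectors *)

(** Two moments of the truncation [w] decide everything, and their exponents come from Young's
    inequality. The gradient term of the divergence estimate is of order [r^(g + 1) |f| |grad f|].
    With g = alpha - 2, the quadratic Young inequality splits it into [f^2 r^(2 alpha - 2)] and
    [|grad f|^2]; with g = 0, the exponents [alpha] and [alphas] split it into [f^2 r^alpha] and
    [f^2 |grad f / f|^alphas]. The first moment thus costs only the Dirichlet energy, the second the
    dual cost. Passing from [log (w e^-W)] back to [log f^2] costs [W], of order [r^alpha]: the
    logarithmic inequality uses the second moment, whereas in the F-Sobolev inequality the power tau
    = 2 / alphas turns [r^alpha] into [r^(2 alpha - 2)], and the first moment suffices.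
    Differentiating the truncation loses a power of its cut-off, which is why its order of vanishing
    is taken at least [alphas]. Constants must not depend on f, so the bounds are stated for the
    family of all normalized functions at once. *)

Section measurability.
Context {R : realType} {n : nat}.

Lemma measurable_ball_rV (x : 'rV[R]_n) (e : R) : measurable (ball x e).
Proof.
(* For [n = 0] the intersection is everything whatever the radius, so nonpositive radii, where the
   ball is empty, are split off. *)
rewrite (_ : ball x e = if 0 < e then \bigcap_(i in [set: 'I_n])
    ((fun y : 'rV[R]_n => y ord0 i) @^-1` ball (x ord0 i) e) else set0).
  case: ifPn => // _; apply: fin_bigcap_measurable => // i _.
  rewrite -[X in measurable X]setTI; apply: measurable_rV_coord => //.
  exact: measurable_ball.
case: ifPn => e0; apply/seteqP; split => y //=.
- by move=> [_ h] i _; exact: h.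
- by move=> h; split => // i j; rewrite ord1; exact: h.
- by move=> [] /(negP e0).
Qed.

(** The sigma-algebra is generated by coordinates, so an open set is written as a countable union of
    balls with rational centres and radii [1/(k+1)]; those not contained in [A] are replaced by the
    empty set. *)
Lemma open_measurable_rV (A : set 'rV[R]_n) : open A -> measurable A.
Proof.
move=> oA.
pose c (q : 'rV[rat]_n) : 'rV[R]_n := \row_i ratr (q ord0 i).
pose F (p : 'rV[rat]_n * nat) : set 'rV[R]_n :=
  if `[< ball (c p.1) p.2.+1%:R^-1 `<=` A >]
  then ball (c p.1) p.2.+1%:R^-1 else set0.
pose G k := if unpickle k is Some p then F p else set0.
suff -> : A = \bigcup_k G k.
  apply: bigcup_measurable => k _; rewrite /G; case: unpickle => // p.
  by rewrite /F; case: ifPn => // _; exact: measurable_ball_rV.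
apply/seteqP; split => [x Ax|x [k _]]; last first.
  rewrite /G; case: unpickle => // p; rewrite /F; case: ifPn => // /asboolP.
  exact.
have /nbhs_ballP [e /= e0 xeA] : nbhs x A by exact: open_nbhs_nbhs.
have [k ke] : exists k, k.+1%:R^-1 + k.+1%:R^-1 < e.
  have e20 : 0 < e / 2 by rewrite divr_gt0.
  have [k _ /(_ k (leqnn k)) /= ke] := near_infty_natSinv_lt (PosNum e20).
  by exists k; rewrite [ltRHS]splitr ltrD.
have k0 : 0 < k.+1%:R^-1 :> R by rewrite invr_gt0.
have [q qP] : exists q : 'rV[rat]_n, ball (c q) k.+1%:R^-1 x.
  have /choice[q qP] (i : 'I_n) : exists q : rat,
      ball (ratr q : R) k.+1%:R^-1 (x ord0 i).
    have /rat_in_itvoo[q] : x ord0 i < x ord0 i + k.+1%:R^-1 by rewrite ltrDl.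
    rewrite in_itv/= => /andP[xq qx]; exists q.
    by rewrite /ball/= ger0_norm ?subr_ge0 1?ltW// ltrBlDl.
  exists (\row_i q i); split => // i j; rewrite ord1 mxE mxE.
  exact: qP.
exists (pickle (q, k)) => //.
rewrite /G pickleK /F /= ifT//; apply/asboolP => y qy; apply: xeA.
apply: (le_ball (ltW ke)); apply: ball_triangle qy.
exact: ball_sym.
Qed.

Lemma continuous_measurable_rV (f : 'rV[R]_n -> R) :
  continuous f -> measurable_fun setT f.
Proof.
move=> /continuousP cf; apply: (measurability _ (RGenOpens.measurableE R)).
move=> _ [_ [a [b ->] <-]]; rewrite setTI; apply: open_measurable_rV.
exact/cf/interval_open.
Qed.

End measurability.

(** A directional derivative depends only on the restriction to the line, so it passes between
    functions on different spaces that agree along corresponding lines. Slices and the chain rule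
    rest on it. *)
Lemma is_derive_along {R : numFieldType} {V V' W : normedModType R}
    (f : V -> W) (g : V' -> W) a v b u df :
  (forall h : R, f (h *: v + a) = g (h *: u + b)) ->
  is_derive a v f df -> is_derive b u g df.
Proof.
move=> fg [fav <-].
have E : (fun h : R => h^-1 *: ((f \o shift a) (h *: v) - f a)) =
         (fun h : R => h^-1 *: ((g \o shift b) (h *: u) - g b)).
  apply/funext => h /=; rewrite fg.
  by have := fg 0; rewrite !scale0r !add0r => ->.
by split; rewrite /derivable /derive -E.
Qed.

(** Nothing is assumed on [f] beyond the direction [v]: restricting to the line reduces the claim to
    the chain rule on the real line. *)
Lemma is_derive_comp_real {R : realType} {V : normedModType R}
    (f : V -> R) (phi : R -> R) a v df dphi :
  is_derive a v f df -> is_derive (f a) 1 phi dphi ->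
  is_derive a v (phi \o f) (dphi * df).
Proof.
move=> fa pa.
have h1 : is_derive (0 : R) 1 (fun h : R => f (h *: v + a)) df.
  apply: is_derive_along fa => h.
  by rewrite addr0 [_%:A]mulr1.
have h2 : is_derive (0 : R) 1 (phi \o (fun h : R => f (h *: v + a))) (dphi * df).
  by apply: is_derive1_comp; rewrite scale0r add0r.
apply: is_derive_along h2 => h /=.
by rewrite addr0 [_%:A]mulr1.
Qed.

Section has_gradient.
Context {R : realType} {n : nat}.
Implicit Types (f : 'rV[R]_n -> R) (g : 'I_n -> 'rV[R]_n -> R).

(** C^1 with the partial derivatives carried as data: gradients are computed symbolically, and
    derivatives along the axes suffice because integration by parts is done one coordinate at a
    time. *)
Definition has_gradient f g : Prop :=
  [/\ continuous f,
      forall i x, is_derive x (delta_mx ord0 i : 'rV[R]_n) f (g i x) &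
      forall i, continuous (g i)].

Lemma has_gradient_Cn f : Cn 1 f -> has_gradient f (fun i => partial i f).
Proof.
move=> [df cdf]; split=> [x|i x|//]; first exact: differentiable_continuous.
exact/derivableP/diff_derivable.
Qed.

Lemma has_gradient_cst (c : R) : has_gradient (fun=> c) (fun _ _ => 0).
Proof.
split; [exact: cst_continuous|move=> i x; exact: is_derive_cst|].
by move=> i; exact: cst_continuous.
Qed.

Lemma has_gradient_ext f g g' :
  (forall i x, g i x = g' i x) -> has_gradient f g -> has_gradient f g'.
Proof.
move=> gg' fg; suff <- : g = g' by [].
by apply/funext => i; apply/funext => x.
Qed.

Lemma has_gradientD f1 g1 f2 g2 : has_gradient f1 g1 -> has_gradient f2 g2 ->
  has_gradient (fun x => f1 x + f2 x) (fun i x => g1 i x + g2 i x).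
Proof.
move=> [c1 d1 e1] [c2 d2 e2]; split => [x|i x|i x].
- by apply: continuousD; [exact: c1|exact: c2].
- exact: is_deriveD.
- by apply: continuousD; [exact: e1|exact: e2].
Qed.

Lemma has_gradientM f1 g1 f2 g2 : has_gradient f1 g1 -> has_gradient f2 g2 ->
  has_gradient (fun x => f1 x * f2 x) (fun i x => f1 x * g2 i x + f2 x * g1 i x).
Proof.
move=> [c1 d1 e1] [c2 d2 e2]; split => [x|i x|i x].
- by apply: continuousM; [exact: c1|exact: c2].
- exact: is_deriveM.
- by apply: (continuousD (continuousM _ _) (continuousM _ _));
    [exact: c1|exact: e2|exact: c2|exact: e1].
Qed.

Lemma has_gradient_comp f g (phi dphi : R -> R) :
  has_gradient f g -> (forall x, is_derive (f x) 1 phi (dphi (f x))) ->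
  (forall x, {for f x, continuous dphi}) ->
  has_gradient (fun x => phi (f x)) (fun i x => dphi (f x) * g i x).
Proof.
move=> [c d e] dp cp; split => [x|i x|i x].
- apply: (@continuous_comp _ _ _ f phi); first exact: c.
  exact/differentiable_continuous/derivable1_diffP.
- exact: is_derive_comp_real.
- apply: continuousM; last exact: e.
  by apply: (@continuous_comp _ _ _ f dphi); [exact: c|exact: cp].
Qed.

Lemma has_gradient_coord (i : 'I_n) :
  has_gradient (fun x => x ord0 i) (fun j _ => (i == j)%:R).
Proof.
split => [x|j x|j x]; [exact: coord_continuous| |exact: cst_continuous].
have df : differentiable (fun x : 'rV[R]_n => x ord0 i) x.
  exact: differentiable_coord.
apply: DeriveDef; first exact: diff_derivable.
rewrite /derive.
apply/cvg_lim => //; apply: cvg_near_cst; near=> h.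
rewrite /= !mxE eqxx/= addrK [_ *: _]mulKf//.
by near: h; exact: nbhs_dnbhs_neq.
Unshelve. all: by end_near. Qed.

Lemma has_gradient_sum (I : finType) (F : I -> 'rV[R]_n -> R) G :
  (forall k, has_gradient (F k) (G k)) ->
  has_gradient (fun x => \sum_k F k x) (fun i x => \sum_k G k i x).
Proof.
move=> FG; elim: (index_enum I) => [|k s IH].
  under eq_fun do rewrite big_nil.
  apply: has_gradient_ext (has_gradient_cst 0) => i x; by rewrite big_nil.
under eq_fun do rewrite big_cons.
apply: has_gradient_ext (has_gradientD (FG k) IH) => i x; by rewrite big_cons.
Qed.

End has_gradient.

Section rV_cons_sections.
Context {R : realType} {n : nat}.
Implicit Types (f : 'rV[R]_n.+1 -> R).

Lemma eq_rV_cons (x y : 'rV[R]_n.+1) : x ord0 ord0 = y ord0 ord0 ->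
  (forall j, x ord0 (lift ord0 j) = y ord0 (lift ord0 j)) -> x = y.
Proof.
move=> h0 hS; apply/rowP => i.
by have [j ->|->] := unliftP ord0 i; [exact: hS|exact: h0].
Qed.

Lemma rV_cons_lineE (t h : R) (y : 'rV[R]_n) :
  rV_cons (h + t, y) = h *: delta_mx ord0 ord0 + rV_cons (t, y).
Proof.
apply: eq_rV_cons => [|j]; rewrite [RHS]mxE [X in _ = X + _]mxE [delta_mx _ _ _ _]mxE eqxx.
  by rewrite !rV_cons_ord0 /= mulr1.
by rewrite !rV_cons_lift /= mulr0 add0r.
Qed.

Lemma rV_cons_liftE (t h : R) (y : 'rV[R]_n) (j : 'I_n) :
  rV_cons (t, h *: delta_mx ord0 j + y) =
  h *: delta_mx ord0 (lift ord0 j) + rV_cons (t, y).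
Proof.
apply: eq_rV_cons => [|k]; rewrite [RHS]mxE [X in _ = X + _]mxE [delta_mx _ _ _ _]mxE eqxx.
  by rewrite !rV_cons_ord0 /= mulr0 add0r.
by rewrite !rV_cons_lift /= !mxE eqxx /= (inj_eq (@lift_inj _ _)).
Qed.

Lemma continuous_rV_cons2 (t : R) :
  continuous (fun y : 'rV[R]_n => rV_cons (t, y)).
Proof.
move=> y A /nbhs_ballP[e /= e0 eA].
change (nbhs y [set z | A (rV_cons (t, z))]).
apply: filterS (nbhsx_ballx y e e0) => z [_ yz]; apply: eA.
split => // i j; rewrite (_ : i = ord0); last exact: ord1.
have [k ->|->] := unliftP ord0 j.
  by rewrite !rV_cons_lift /=; exact: yz.
by rewrite !rV_cons_ord0 /=; exact: ballxx.
Qed.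

Lemma continuous_rV_cons1 (y : 'rV[R]_n) :
  continuous (fun t : R => rV_cons (t, y)).
Proof.
move=> t A /nbhs_ballP[e /= e0 eA].
change (nbhs t [set z | A (rV_cons (z, y))]).
apply: filterS (nbhsx_ballx t e e0) => z tz; apply: eA.
split => // i j; rewrite (_ : i = ord0); last exact: ord1.
have [k ->|->] := unliftP ord0 j.
  by rewrite !rV_cons_lift /=; exact: ballxx.
by rewrite !rV_cons_ord0.
Qed.

Lemma has_gradient_rV_cons2 f g (t : R) : has_gradient f g ->
  has_gradient (fun y : 'rV[R]_n => f (rV_cons (t, y)))
    (fun i y => g (lift ord0 i) (rV_cons (t, y))).
Proof.
move=> [cf df cg]; split => [y|i y|i y].
- by apply: continuous_comp; [exact: continuous_rV_cons2|exact: cf].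
- apply: is_derive_along (df _ _) => h.
  by rewrite rV_cons_liftE.
- by apply: continuous_comp; [exact: continuous_rV_cons2|exact: cg].
Qed.

Lemma has_gradient_rV_cons1 f g (y : 'rV[R]_n) (t : R) : has_gradient f g ->
  is_derive t 1 (fun t => f (rV_cons (t, y))) (g ord0 (rV_cons (t, y))).
Proof.
move=> [cf df cg]; apply: is_derive_along (df _ _) => h.
by rewrite [_%:A]mulr1 rV_cons_lineE.
Qed.

Lemma continuous_rV_cons1_comp f (y : 'rV[R]_n) : continuous f ->
  continuous (fun t => f (rV_cons (t, y))).
Proof.
by move=> cf t; apply: continuous_comp; [exact: continuous_rV_cons1|exact: cf].
Qed.

End rV_cons_sections.

Section one_dimensional.
Context {R : realType}.
Local Notation leb := (@lebesgue_measure R).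
Implicit Types (u v : R -> R).

Lemma integral_derivative u v (a b : R) : a <= b ->
  (forall x, is_derive x (1 : R) u (v x)) -> continuous v ->
  (\int[leb]_(x in `[a, b]) (v x)%:E = (u b - u a)%:E)%E.
Proof.
move=> ab du cv; move: ab; rewrite le_eqVlt => /orP[/eqP <-|ab].
  by rewrite set_itv1 integral_set1 subrr.
have cu : continuous u.
  by move=> x; exact/differentiable_continuous/derivable1_diffP.
rewrite (@continuous_FTC2 _ v u) //.
- exact: continuous_subspaceT.
- split => [x _| |]; first by [].
  + exact/cvg_at_right_filter/cu.
  + exact/cvg_at_left_filter/cu.
- by move=> x _; rewrite derive1E; have [_ ->] := du x.
Qed.

Lemma le_integral_norm_derivative u v (a b x y : R) :
  (forall x, is_derive x (1 : R) u (v x)) -> continuous v ->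
  x \in `[a, b] -> y \in `[a, b] ->
  (`|u x - u y|%:E <= \int[leb]_(x in `[a, b]) `|v x|%:E)%E.
Proof.
move=> du cv; wlog yx : x y / y <= x.
  move=> W xab yab; have /orP[xy|yx] := le_total x y; last exact: W.
  by rewrite distrC; exact: W.
rewrite !in_itv/= => /andP[ax xb] /andP[ay yb].
rewrite -abse_EFin -(integral_derivative yx du cv).
apply: (le_trans (le_abse_integral _ _ _)) => //.
  apply/measurable_EFinP; apply: measurable_funTS.
  exact: continuous_measurable_fun.
apply: ge0_subset_integral => //.
  apply/measurable_EFinP; apply: measurable_funTS; apply: measurableT_comp => //.
  exact: continuous_measurable_fun.
by move=> z /=; rewrite !in_itv/= => /andP[? ?]; apply/andP; split; lra.
Qed.

End one_dimensional.

(** * Fubini and the entropy bound *)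

Section iterated_integrals.
Context {R : realType} {n : nat}.
Local Notation leb := (@lebesgue_measure R).
Local Notation lebn m := (@lebesgue_rV R m).
Implicit Types (f : 'rV[R]_n.+1 -> \bar R).
Local Open Scope ereal_scope.

Lemma ge0_integral_rV f : measurable_fun setT f -> (forall x, 0 <= f x) ->
  \int[lebn n.+1]_x f x = \int[leb]_t \int[lebn n]_y f (rV_cons (t, y)).
Proof.
move=> mf f0.
have -> : \int[lebn n.+1]_x f x = \int[leb \x lebn n]_p f (rV_cons p).
  exact: (@ge0_integral_pushforward _ _ _ _ _ _ (@measurable_rV_cons R n) (leb \x lebn n) setT f).
rewrite (@fubini_tonelli1 _ _ _ _ _ _ (lebn n : {sigma_finite_measure set _ -> \bar R}))//.
exact: (measurableT_comp mf (@measurable_rV_cons R n)).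
Qed.

Lemma ge0_integral_rV_swap f : measurable_fun setT f -> (forall x, 0 <= f x) ->
  \int[lebn n.+1]_x f x = \int[lebn n]_y \int[leb]_t f (rV_cons (t, y)).
Proof.
move=> mf f0.
have -> : \int[lebn n.+1]_x f x = \int[leb \x lebn n]_p f (rV_cons p).
  exact: (@ge0_integral_pushforward _ _ _ _ _ _ (@measurable_rV_cons R n) (leb \x lebn n) setT f).
rewrite (@fubini_tonelli2 _ _ _ _ _ _ (lebn n : {sigma_finite_measure set _ -> \bar R}))//.
exact: (measurableT_comp mf (@measurable_rV_cons R n)).
Qed.

Lemma measurable_integral_rV_cons2 f : measurable_fun setT f -> (forall x, 0 <= f x) ->
  measurable_fun setT (fun t : R => \int[lebn n]_y f (rV_cons (t, y))).
Proof.
move=> mf f0.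
apply: (@measurable_fun_fubini_tonelli_F _ _ _ _ _ (lebn n) (f \o @rV_cons R n)) => //.
  exact: (measurableT_comp mf (@measurable_rV_cons R n)).
by move=> p; exact: f0.
Qed.

Lemma measurable_integral_rV_cons1 f : measurable_fun setT f -> (forall x, 0 <= f x) ->
  measurable_fun setT (fun y : 'rV[R]_n => \int[leb]_t f (rV_cons (t, y))).
Proof.
move=> mf f0.
apply: (@measurable_fun_fubini_tonelli_G _ _ _ _ _ leb (f \o @rV_cons R n)) => //.
  exact: (measurableT_comp mf (@measurable_rV_cons R n)).
by move=> p; exact: f0.
Qed.

Lemma integrable_rV f : (lebn n.+1).-integrable setT f ->
  (leb \x lebn n).-integrable setT (f \o @rV_cons R n).
Proof.
move=> /integrableP[mf foo]; apply/integrableP; split.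
  exact: (measurableT_comp mf (@measurable_rV_cons R n)).
apply: le_lt_trans foo; rewrite le_eqVlt; apply/orP; left; apply/eqP.
rewrite -(@ge0_integral_pushforward _ _ _ _ _ _ (@measurable_rV_cons R n) (leb \x lebn n)
  setT (abse \o f))//.
exact: measurableT_comp.
by move=> y _; exact: abse_ge0.
Qed.

Lemma integral_rV f : (lebn n.+1).-integrable setT f ->
  \int[lebn n.+1]_x f x = \int[leb]_t \int[lebn n]_y f (rV_cons (t, y)).
Proof.
move=> intf; have := integrable_rV intf => inth; have /integrableP[mf _] := intf.
have -> : \int[lebn n.+1]_x f x = \int[leb \x lebn n]_p f (rV_cons p).
  exact: (@integral_pushforward _ _ _ _ _ _ (@measurable_rV_cons R n) (leb \x lebn n) setT f).
by rewrite -(integral12_prod_meas1 inth).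
Qed.

Lemma integral_rV_swap f : (lebn n.+1).-integrable setT f ->
  \int[lebn n.+1]_x f x = \int[lebn n]_y \int[leb]_t f (rV_cons (t, y)).
Proof.
move=> intf; have := integrable_rV intf => inth; have /integrableP[mf _] := intf.
have -> : \int[lebn n.+1]_x f x = \int[leb \x lebn n]_p f (rV_cons p).
  exact: (@integral_pushforward _ _ _ _ _ _ (@measurable_rV_cons R n) (leb \x lebn n) setT f).
by rewrite -(integral21_prod_meas1 inth).
Qed.

End iterated_integrals.

Definition lnp {R : realType} (x : R) : R := Num.max 0 (ln x).

Section lnp.
Context {R : realType}.
Implicit Types x y : R.

Lemma lnp_ge0 x : 0 <= lnp x.
Proof. by rewrite /lnp le_max lexx. Qed.

Lemma lnp_ge x : ln x <= lnp x.
Proof. by rewrite /lnp le_max lexx orbT. Qed.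

Lemma lnp_le1 x : x <= 1 -> lnp x = 0.
Proof. by move=> x1; rewrite /lnp max_l// ln_le0. Qed.

Lemma lnp_ge1 x : 1 <= x -> lnp x = ln x.
Proof. by move=> x1; rewrite /lnp max_r// ln_ge0. Qed.

Lemma le_lnp x y : x <= y -> lnp x <= lnp y.
Proof.
move=> xy; have [x1|x1] := leP x 1; first by rewrite lnp_le1// lnp_ge0.
rewrite !lnp_ge1 ?ler_ln ?posrE//; lra.
Qed.

Lemma lnpM x y : 0 <= x -> 0 <= y -> lnp (x * y) <= lnp x + lnp y.
Proof.
rewrite le_eqVlt => /orP[/eqP <-|x0].
  by move=> _; rewrite mul0r lnp_le1 ?ler01// addr_ge0 ?lnp_ge0.
rewrite le_eqVlt => /orP[/eqP <-|y0].
  by rewrite mulr0 lnp_le1 ?ler01// addr_ge0 ?lnp_ge0.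
rewrite {1}/lnp ge_max addr_ge0 ?lnp_ge0//= lnM ?posrE// lerD//; exact: lnp_ge.
Qed.

Lemma lnp_le x : 0 <= x -> lnp x <= x.
Proof.
move=> x0; rewrite /lnp ge_max x0/=; move: x0; rewrite le_eqVlt => /orP[/eqP <-|x0].
  by rewrite ln0.
by rewrite ltW// ln_sublinear.
Qed.

(** From [k = m * (k / m)] and [lnp (k / m) <= k / m]. In the entropy bound it removes the logarithm
    of the slice bound [k] at the price of [k] itself. *)
Lemma mul_lnp_le (m k : R) : 0 <= m -> 0 <= k -> m * lnp k <= m * lnp m + k.
Proof.
rewrite le_eqVlt => /orP[/eqP <-|m0] k0; first by rewrite !mul0r add0r.
have : lnp k <= lnp m + k / m.
  rewrite -[in leLHS](divfK (lt0r_neq0 m0) k) addrC.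
  have km : 0 <= k / m by rewrite divr_ge0// ltW.
  by rewrite (le_trans (lnpM _ _))// ?lerD2r ?lnp_le// ltW.
move=> /(ler_wpM2l (ltW m0)); rewrite mulrDr mulrCA divff ?mulr1//.
exact: lt0r_neq0.
Qed.

Lemma measurable_lnp : measurable_fun [set: R] (@lnp R).
Proof. by apply: measurable_maxr => //; exact: measurable_ln. Qed.

End lnp.

Section sup_bound.
Context {R : realType}.
Local Notation leb := (@lebesgue_measure R).
Local Open Scope ereal_scope.

(** If [u t] exceeded the total variation of [u], then [u] would stay above a positive constant on
    the whole line and could not be integrable. *)
Lemma le_integral_derivativeT (u v : R -> R) (t : R) :
  (forall x, is_derive x (1%R : R) u (v x)) -> continuous v ->
  (forall x, (0 <= u x)%R) -> \int[leb]_x (u x)%:E < +oo ->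
  (u t)%:E <= \int[leb]_x `|v x|%:E.
Proof.
move=> du cv u0 uoo; rewrite leNgt; apply/negP => ut.
have mv : measurable_fun setT (fun x => `|v x|%:E).
  by apply/measurable_EFinP; apply: measurableT_comp => //; exact: continuous_measurable_fun.
have mu : measurable_fun setT (fun x => (u x)%:E).
  apply/measurable_EFinP; apply: continuous_measurable_fun => x.
  exact/differentiable_continuous/derivable1_diffP.
have I0 : 0 <= \int[leb]_x `|v x|%:E by exact: integral_ge0.
have Ifin : \int[leb]_x `|v x|%:E \is a fin_num.
  by rewrite ge0_fin_numE// (lt_trans ut)// ltry.
pose i := fine (\int[leb]_x `|v x|%:E).
have iE : \int[leb]_x `|v x|%:E = i%:E by rewrite fineK.
rewrite iE lte_fin in ut.
pose e := (u t - i)%R; have e0 : (0 < e)%R by rewrite subr_gt0.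
have ue s : (e <= u s)%R.
  suff : (`|u t - u s| <= i)%R by have := ler_norm (u t - u s); rewrite /e; lra.
  rewrite -lee_fin -iE.
  apply: (le_trans (@le_integral_norm_derivative R u v (Num.min t s) (Num.max t s) t s du cv _ _)).
  - by rewrite in_itv/= ge_min le_max lexx.
  - by rewrite in_itv/= ge_min le_max lexx !orbT.
  - exact: ge0_subset_integral.
have : \int[leb]_x (cst e%:E) x <= \int[leb]_x (u x)%:E.
  by apply: ge0_le_integral => // x _; rewrite lee_fin // ltW.
rewrite integral_cst//.
rewrite [X in _ * X](_ : _ = +oo); last first.
  by rewrite -set_itvNyy; exact: lebesgue_measure_itv.
by rewrite gt0_muley ?lte_fin// leye_eq => /eqP E; rewrite E in uoo.
Qed.

End sup_bound.

Section entropy_bound.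
Context {R : realType}.
Local Notation leb := (@lebesgue_measure R).
Local Notation lebn m := (@lebesgue_rV R m).
Local Open Scope ereal_scope.

Lemma has_gradient_measurable n (f : 'rV[R]_n -> R) g : has_gradient f g ->
  measurable_fun setT f.
Proof. by move=> [? _ _]; exact: continuous_measurable_rV. Qed.

Lemma has_gradient_measurable_grad n (f : 'rV[R]_n -> R) g i : has_gradient f g ->
  measurable_fun setT (g i).
Proof. by move=> [_ _ ?]; exact: continuous_measurable_rV. Qed.

Lemma integral_rV0 (f : 'rV[R]_0 -> R) : measurable_fun setT f ->
  \int[lebn 0]_x (f x)%:E = (f 0%R)%:E.
Proof.
move=> mf; rewrite /= integral_dirac//; last exact/measurable_EFinP.
by rewrite diracE mem_set// mul1e.
Qed.

(* In the induction step the marginal int u dy is bounded by the whole of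
   int |d_0 u|, so its own entropy costs only that integral. *)
Lemma integral_lnp_le n (u : 'rV[R]_n -> R) g (m : R) : has_gradient u g ->
  (forall x, 0 <= u x)%R -> (0 <= m)%R ->
  \int[lebn n]_x (u x)%:E <= m%:E ->
  \int[lebn n]_x (u x * lnp (u x))%:E <=
    (m * lnp m)%:E + \sum_(i < n) \int[lebn n]_x `|g i x|%:E.
Proof.
elim: n u g m => [|n IH] u g m ug u0 m0 um.
  rewrite big_ord0 adde0; move: um.
  have mu := has_gradient_measurable ug.
  rewrite !integral_rV0//; last first.
    by apply: measurable_funM => //; exact: (measurableT_comp measurable_lnp).
  rewrite !lee_fin => um.
  by rewrite ler_pM ?lnp_ge0 ?le_lnp.
have mu : measurable_fun setT (fun x => (u x)%:E).
  by apply/measurable_EFinP; exact: has_gradient_measurable ug.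
have mulnp : measurable_fun setT (fun x => (u x * lnp (u x))%:E).
  apply/measurable_EFinP; apply: measurable_funM; first exact: has_gradient_measurable ug.
  by apply: (measurableT_comp measurable_lnp); exact: has_gradient_measurable ug.
have mg i : measurable_fun setT (fun x => `|g i x|%:E).
  by apply/measurable_EFinP; apply: measurableT_comp => //; exact: has_gradient_measurable_grad ug.
have K0 i : 0 <= \int[lebn n.+1]_x `|g i x|%:E by exact: integral_ge0.
rewrite big_ord_recl.
have [Koo|Koo] := eqVneq (\int[lebn n.+1]_x `|g ord0 x|%:E) +oo.
  rewrite Koo addye ?addey ?leey// gt_eqF// (lt_le_trans ltNy0)//.
  exact: sume_ge0.
pose k := fine (\int[lebn n.+1]_x `|g ord0 x|%:E).
have kE : \int[lebn n.+1]_x `|g ord0 x|%:E = k%:E.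
  by rewrite fineK// ge0_fin_numE// lt_neqAle Koo leey.
have k0 : (0 <= k)%R by rewrite -lee_fin -kE.
have int_fin : \int[lebn n]_y \int[leb]_t (u (rV_cons (t, y)))%:E < +oo.
  rewrite -(ge0_integral_rV_swap mu) => [|x]; last by rewrite lee_fin.
  by rewrite (le_lt_trans um)// ltry.
have mint : measurable_fun setT (fun y => \int[leb]_t (u (rV_cons (t, y)))%:E).
  by apply: (measurable_integral_rV_cons1 mu) => x; rewrite lee_fin.
(* Bounding [u] on a line by the integral of its derivative needs [u] integrable on that line;
   Fubini provides this for almost every [y] only. *)
have ae_fin : {ae lebn n, forall y, setT y -> \int[leb]_t (u (rV_cons (t, y)))%:E \is a fin_num}.
  apply: integrable_ae => //; apply/integrableP; split => //.
  apply: le_lt_trans int_fin; rewrite le_eqVlt; apply/orP; left; apply/eqP.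
  apply: eq_integral => y _; rewrite gee0_abs// integral_ge0// => t _.
  by rewrite lee_fin.
have slice t : \int[lebn n]_y (u (rV_cons (t, y)))%:E <= k%:E.
  rewrite -kE ge0_integral_rV_swap//.
  apply: ae_ge0_le_integral => //.
  - by move=> y _; rewrite lee_fin.
  - apply/measurable_EFinP; exact: has_gradient_measurable (has_gradient_rV_cons2 t ug).
  - by move=> y _; exact: integral_ge0.
  - exact: (measurable_integral_rV_cons1 (mg ord0)).
  - apply: filterS ae_fin => y /(_ I) yfin _.
    apply: (@le_integral_derivativeT _ (fun t => u (rV_cons (t, y)))
      (fun t => g ord0 (rV_cons (t, y)))) => //.
    + by move=> s; exact: has_gradient_rV_cons1 ug.
    + by case: ug => _ _ cg; exact: continuous_rV_cons1_comp.
    + by rewrite -ge0_fin_numE// integral_ge0// => s _; rewrite lee_fin.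
rewrite ge0_integral_rV//; last by move=> x; rewrite lee_fin mulr_ge0// lnp_ge0.
pose S t := \sum_(i < n) \int[lebn n]_y `|g (lift ord0 i) (rV_cons (t, y))|%:E.
have mS i : measurable_fun setT (fun t => \int[lebn n]_y `|g (lift ord0 i) (rV_cons (t, y))|%:E).
  exact: (@measurable_integral_rV_cons2 _ _ (fun x => `|g (lift ord0 i) x|%:E)).
(* The induction hypothesis is used with the exact mass of the slice; this mass is at most [k], so
   its logarithm is replaced by [lnp k], uniformly in [t]. *)
have step t : \int[lebn n]_y (u (rV_cons (t, y)) * lnp (u (rV_cons (t, y))))%:E <=
    (lnp k)%:E * \int[lebn n]_y (u (rV_cons (t, y)))%:E + S t.
  have I0 : 0 <= \int[lebn n]_y (u (rV_cons (t, y)))%:E.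
    by apply: integral_ge0 => y _; rewrite lee_fin.
  have Ifin : \int[lebn n]_y (u (rV_cons (t, y)))%:E \is a fin_num.
    by rewrite ge0_fin_numE// (le_lt_trans (slice t))// ltry.
  apply: (le_trans (IH _ _ (fine (\int[lebn n]_y (u (rV_cons (t, y)))%:E))
    (has_gradient_rV_cons2 t ug) _ _ _)).
  - by [].
  - exact: fine_ge0.
  - by rewrite fineK.
  - rewrite leeD2r// muleC -[X in _ <= X * _](fineK Ifin) -EFinM lee_fin.
    rewrite ler_wpM2l ?fine_ge0// le_lnp//.
    by rewrite -lee_fin fineK.
apply: (@le_trans _ _ (\int[leb]_t ((lnp k)%:E * \int[lebn n]_y (u (rV_cons (t, y)))%:E + S t))).
  apply: ge0_le_integral => //.
  - move=> t _; apply: integral_ge0 => y _.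
    by rewrite lee_fin mulr_ge0 ?lnp_ge0.
  - apply: (measurable_integral_rV_cons2 mulnp) => x.
    by rewrite lee_fin mulr_ge0 ?lnp_ge0.
  - apply: emeasurable_funD.
      apply: measurable_funeM.
      by apply: (measurable_integral_rV_cons2 mu) => x; rewrite lee_fin.
    exact: emeasurable_sum.
rewrite ge0_integralD//; last 4 first.
- move=> t _; rewrite mule_ge0 ?lee_fin ?lnp_ge0// integral_ge0// => y _.
  by rewrite lee_fin.
- apply: measurable_funeM.
  by apply: (measurable_integral_rV_cons2 mu) => x; rewrite lee_fin.
- by move=> t _; apply: sume_ge0 => i _; exact: integral_ge0.
- exact: emeasurable_sum.
rewrite ge0_integralZl//; last 3 first.
- by apply: (measurable_integral_rV_cons2 mu) => x; rewrite lee_fin.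
- by move=> t _; rewrite integral_ge0// => y _; rewrite lee_fin.
- by rewrite lee_fin lnp_ge0.
rewrite -(ge0_integral_rV mu); last by move=> x; rewrite lee_fin.
rewrite ge0_integral_sum//; last by move=> i t _; exact: integral_ge0.
rewrite addeA; apply: leeD.
  rewrite kE -EFinD.
  apply: (@le_trans _ _ ((lnp k)%:E * m%:E)).
    by rewrite lee_wpmul2l// lee_fin lnp_ge0.
  by rewrite -EFinM lee_fin mulrC mul_lnp_le.
apply: lee_sum => i _.
by rewrite (ge0_integral_rV (mg (lift ord0 i))) //=.
Qed.

End entropy_bound.

(** * Divergence theorem with a radial weight *)

Definition cube {R : realType} (n : nat) (r : R) : set 'rV[R]_n :=
  [set x | forall i, `[- r, r]%classic (x ord0 i)].
Arguments cube {R n} r.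

Section cube.
Context {R : realType} {n : nat}.
Local Notation lebn m := (@lebesgue_rV R m).
Implicit Types r : R.

Lemma measurable_cube r : measurable (@cube R n r).
Proof.
rewrite (_ : cube r = \bigcap_(i in [set: 'I_n])
    ((fun y : 'rV[R]_n => y ord0 i) @^-1` `[- r, r]%classic)).
  apply: fin_bigcap_measurable => // i _.
  by rewrite -[X in measurable X]setTI; apply: measurable_rV_coord.
by apply/seteqP; split => x /= h i; [move=> _; exact: h|exact: (h i)].
Qed.

Lemma cube_measure_lty r : (lebn n (cube r) < +oo)%E.
Proof.
have -> : lebn n (cube r) = (\prod_(i < n) (@lebesgue_measure R) (`[(- r)%R, r]%classic : set R))%E.
  exact: (@lebesgue_rV_box R n (fun=> `[- r, r]%classic : set R)).
suff /andP[] : (0 <= \prod_(i < n) (@lebesgue_measure R)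
  (`[(- r)%R, r]%classic : set R) < +oo)%E by [].
elim/big_ind : _ => [|x y /andP[x0 xoo] /andP[y0 yoo]|i _]; first by rewrite lee01 ltry.
- by rewrite mule_ge0//= lte_mul_pinfty// ge0_fin_numE.
- by rewrite measure_ge0/=; exact/compact_finite_measure/segment_compact.
Qed.

Lemma compact_cube r : compact (@cube R n r).
Proof. exact: (@rV_compact _ _ (fun=> `[- r, r]%classic : set R)
  (fun=> @segment_compact _ _ _)). Qed.

Lemma bounded_cube (f : 'rV[R]_n -> R) r : continuous f ->
  exists M, 0 < M /\ forall x, cube r x -> `|f x| <= M.
Proof.
move=> cf.
have : bounded_set (f @` cube r).
  apply: compact_bounded; apply: continuous_compact; last exact: compact_cube.
  exact: continuous_subspaceT.
move=> [M [_ /(_ (Num.max 1 (M + 1)))]] h; exists (Num.max 1 (M + 1)).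
split; first by rewrite lt_max ltr01.
by move=> x rx; apply: h; [rewrite lt_max ltrDl ltr01 orbT|exists x].
Qed.

Lemma integrable_cube (f : 'rV[R]_n -> R) r : continuous f ->
  (forall x, ~ cube r x -> f x = 0) -> (lebn n).-integrable setT (EFin \o f).
Proof.
move=> cf f0; have [M [M0 fM]] := bounded_cube r cf.
have intM : (lebn n).-integrable setT (EFin \o (fun x => M * \1_(cube r) x)).
  apply/integrableP; split.
    apply/measurable_EFinP; apply: measurable_funM => //.
    exact: measurable_indic (measurable_cube r).
  under eq_integral => x _.
    rewrite /= ger0_norm; last by rewrite mulr_ge0// ltW.
    rewrite EFinM; over.
  rewrite ge0_integralZl//; last 2 first.
  - by apply/measurable_EFinP; exact: measurable_indic (measurable_cube r).
  - by rewrite lee_fin ltW.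
  rewrite integral_indic ?setIT//; last exact: measurable_cube.
  by rewrite lte_mul_pinfty ?lee_fin ?ltW// cube_measure_lty.
apply: le_integrable intM => //.
  by apply/measurable_EFinP; exact: continuous_measurable_rV.
move=> x _ /=; rewrite lee_fin.
have [rx|rx] := pselect (cube r x).
  by rewrite indicE mem_set//= mulr1 (ger0_norm (ltW M0)) fM.
by rewrite f0// normr0.
Qed.

End cube.

Section integral_partial.
Context {R : realType}.
Local Notation leb := (@lebesgue_measure R).
Local Notation lebn m := (@lebesgue_rV R m).

Lemma integral_derivative_eq0 (u v : R -> R) r :
  (forall x, is_derive x (1 : R) u (v x)) -> continuous v ->
  (forall x, ~~ (x \in `[- r, r]) -> u x = 0 /\ v x = 0) ->
  (\int[leb]_x (v x)%:E = 0)%E.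
Proof.
move=> du cv uv0; pose s := `|r| + 1.
have rs : r < s by rewrite /s (le_lt_trans (ler_norm r))// ltrDl.
have s0 : 0 < s by rewrite /s; have := normr_ge0 r; lra.
rewrite (_ : (\int[leb]_x (v x)%:E = \int[leb]_(x in `[(- s)%R, s]) (v x)%:E)%E).
  rewrite (integral_derivative _ du cv); last lra.
  have [-> _] : u s = 0 /\ v s = 0 by apply: uv0; rewrite in_itv/= negb_and -!ltNge rs orbT.
  have [-> _] : u (- s) = 0 /\ v (- s) = 0.
    by apply: uv0; rewrite in_itv/= negb_and -!ltNge; apply/orP; left; lra.
  by rewrite subrr.
rewrite [RHS]integral_mkcond; apply: eq_integral => x _.
rewrite patchE; case: ifPn => //; rewrite mem_setE in_itv/= => xs.
suff [_ ->] : u x = 0 /\ v x = 0 by [].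
apply: uv0; rewrite in_itv/= negb_and -!ltNge; move: xs.
by rewrite negb_and -!ltNge => /orP[xs|xs]; apply/orP; [left|right]; lra.
Qed.

(** Fubini reduces to the line in direction [i]: directly when [i] is the first axis, by induction
    on the slices otherwise. Vanishing outside a cube makes the signed integrand integrable, as
    Fubini requires. *)
Lemma integral_partial_eq0 n (u : 'rV[R]_n -> R) g i r : has_gradient u g ->
  (forall x, ~ cube r x -> u x = 0 /\ g i x = 0) ->
  (\int[lebn n]_x (g i x)%:E = 0)%E.
Proof.
elim: n u g i => [|n IH] u g i ug ug0; first by case: i ug0.
have cg : continuous (g i) by case: ug.
have intg : (lebn n.+1).-integrable setT (EFin \o g i).
  by apply: (integrable_cube cg) => x /ug0[].
have [j ij|i0] := unliftP ord0 i.
  rewrite (integral_rV intg) integral0_eq// => t _ /=.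
  subst i.
  apply: (IH (fun y => u (rV_cons (t, y))) (fun k y => g (lift ord0 k) (rV_cons (t, y)))).
    exact: has_gradient_rV_cons2.
  move=> y ry; apply: ug0; apply: contra_not ry => ry k.
  by have := ry (lift ord0 k); rewrite rV_cons_lift.
subst i.
rewrite (integral_rV_swap intg) integral0_eq// => y _ /=.
apply: (@integral_derivative_eq0 (fun t => u (rV_cons (t, y))) _ r).
- by move=> t; exact: has_gradient_rV_cons1.
- exact: continuous_rV_cons1_comp.
- move=> t rt; apply: ug0; apply: contra_not (negP rt) => /(_ ord0).
  by rewrite rV_cons_ord0.
Qed.

End integral_partial.

Section real_functions.
Context {R : realType}.
Implicit Types s x y : R.

Definition pospart s : R := Num.max 0 s.

Lemma pospart_ge0 s : 0 <= pospart s.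
Proof. by rewrite /pospart le_max lexx. Qed.

Lemma pospart_id s : 0 <= s -> pospart s = s.
Proof. by move=> s0; rewrite /pospart max_r. Qed.

Lemma pospart_eq0 s : s <= 0 -> pospart s = 0.
Proof. by move=> s0; rewrite /pospart max_l. Qed.

Lemma le_pospart x y : x <= y -> pospart x <= pospart y.
Proof. by move=> xy; rewrite /pospart ge_max !le_max lexx xy orbT. Qed.

Lemma continuous_pospart : continuous pospart.
Proof.
move=> x; apply: (@continuous_max R R (fun=> 0) id x); first exact: cvg_cst.
exact: cvg_id.
Qed.

Lemma continuous_pospartX k : continuous (fun s => pospart s ^+ k).
Proof.
move=> x; apply: (@continuous_comp _ _ _ pospart (fun s => s ^+ k)).
  exact: continuous_pospart.
exact: exprn_continuous.
Qed.

(** From exponent 2 on the corner of the positive part disappears. At 0 the slope in Caratheodory's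
    criterion is [pospart s ^+ k.+1], continuous and vanishing there. *)
Lemma is_derive_pospartX k s :
  is_derive s (1 : R) (fun s => pospart s ^+ k.+2) (k.+2%:R * pospart s ^+ k.+1).
Proof.
have [s0|s0|<-] := ltgtP 0 s.
- rewrite pospart_id ?ltW//.
  have h : is_derive s (1 : R) (id ^+ k.+2) (k.+2%:R * s ^+ k.+1).
    by apply: is_derive_eq; rewrite [LHS]mulr1.
  apply: near_eq_is_derive h.
  apply: filterS (lt_nbhsr s0) => x x0.
  by rewrite fctE/= pospart_id ?ltW.
- rewrite pospart_eq0 ?ltW// expr0n/= mulr0.
  apply: near_eq_is_derive (is_derive_cst 0 s 1).
  apply: filterS (lt_nbhsl s0) => x x0.
  by rewrite pospart_eq0 ?ltW// expr0n.
- apply/is_derive1_caratheodory; exists (fun s => pospart s ^+ k.+1); split.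
  + move=> z; rewrite (pospart_eq0 (lexx 0)) expr0n/= !subr0.
    have [z0|z0] := leP 0 z; first by rewrite pospart_id// -exprSr.
    by rewrite pospart_eq0 ?ltW// expr0n/= expr0n/= mul0r.
  + exact: continuous_pospartX.
  + by rewrite (pospart_eq0 (lexx 0)) expr0n/= mulr0.
Qed.

Lemma continuous_powR_gt0 (a s : R) : 0 < s -> {for s, continuous (fun x : R => x `^ a)}.
Proof.
move=> s0; apply/differentiable_continuous/derivable1_diffP.
by have [] := is_derive1_powR a s0.
Qed.

End real_functions.

Section squared_norm.
Context {R : realType} {n : nat}.

Definition sqnorm (x : 'rV[R]_n) : R := \sum_(i < n) x ord0 i ^+ 2.

Lemma sqnorm_ge0 (x : 'rV[R]_n) : 0 <= sqnorm x.
Proof. by apply: sumr_ge0 => i _; exact: sqr_ge0. Qed.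

Lemma has_gradient_sqnorm : has_gradient sqnorm (fun i x => 2 * x ord0 i).
Proof.
have h (k : 'I_n) : has_gradient (fun x : 'rV[R]_n => x ord0 k ^+ 2)
    (fun i x => 2 * x ord0 k * (k == i)%:R).
  apply: has_gradient_ext (has_gradientM (has_gradient_coord k) (has_gradient_coord k)) => i x.
  by ring.
apply: has_gradient_ext (has_gradient_sum h) => i x.
rewrite (bigD1 i)//= eqxx mulr1 big1 ?addr0// => k /negbTE ki.
by rewrite ki mulr0.
Qed.

Lemma le_sqnorm (x : 'rV[R]_n) (i : 'I_n) : x ord0 i ^+ 2 <= sqnorm x.
Proof.
by rewrite /sqnorm (bigD1 i)//= lerDl sumr_ge0// => j _; exact: sqr_ge0.
Qed.

End squared_norm.

Lemma has_gradient_expRN {R : realType} n (W : 'rV[R]_n -> R) gW :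
  has_gradient W gW ->
  has_gradient (fun x => expR (- W x)) (fun i x => - (expR (- W x) * gW i x)).
Proof.
move=> hW.
have h : has_gradient (fun x : 'rV[R]_n => -1 * W x) (fun i x => - gW i x).
  apply: has_gradient_ext (has_gradientM (has_gradient_cst (-1)) hW) => i x.
  by ring.
have e : (fun x => expR (- W x)) = fun x => expR (-1 * W x).
  by apply/funext => x; rewrite mulN1r.
rewrite e.
apply: has_gradient_ext (has_gradient_comp (dphi := expR) h
  (fun x => is_derive_expR _) _) => [i x|x].
- by rewrite mulrN mulN1r.
- exact: continuous_expR.
Qed.

Section divergence.
Context {R : realType} {n : nat}.
Local Notation lebn := (@lebesgue_rV R n).
Variables (W w : 'rV[R]_n -> R) (gW gw : 'I_n -> 'rV[R]_n -> R).
Variables (A B : 'rV[R]_n -> R) (b : R).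
Hypotheses (hW : has_gradient W gW) (hw : has_gradient w gw).
Hypothesis w0 : forall x, 0 <= w x.
Hypotheses (mA : measurable_fun setT A) (mB : measurable_fun setT B).
Hypotheses (A0 : forall x, 0 <= A x) (B0 : forall x, 0 <= B x).
Hypothesis b0 : b <= 0.
Hypothesis AB : forall x, A x + (1 + sqnorm x) `^ b *
  (n%:R * w x + \sum_i x ord0 i * gw i x - w x * \sum_i x ord0 i * gW i x) <= B x.

(* The cut-off is radially nonincreasing, so the term containing its derivative
   has a sign and can be dropped. *)
Let cut (k : nat) (x : 'rV[R]_n) : R := pospart (1 - sqnorm x / k.+1%:R) ^+ 2.

Let dcut (k : nat) (x : 'rV[R]_n) : R :=
  - (2 / k.+1%:R * pospart (1 - sqnorm x / k.+1%:R)).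

Let cut_grad k : has_gradient (cut k) (fun i x => dcut k x * (2 * x ord0 i)).
Proof.
have h : has_gradient (fun x : 'rV[R]_n => 1 + (- k.+1%:R^-1) * sqnorm x)
    (fun i x => (- k.+1%:R^-1) * (2 * x ord0 i)).
  apply: has_gradient_ext (has_gradientD (has_gradient_cst 1)
    (has_gradientM (has_gradient_cst (- k.+1%:R^-1)) has_gradient_sqnorm)) => i x.
  by ring.
have h2 := has_gradient_comp (phi := fun s => pospart s ^+ 2)
  (dphi := fun s => 2 * pospart s ^+ 1) h (fun x => @is_derive_pospartX R 0 _).
have e : cut k = fun x => pospart (1 + (- k.+1%:R^-1) * sqnorm x) ^+ 2.
  by apply/funext => x; rewrite /cut mulNr (mulrC (_^-1)).
rewrite e; apply: has_gradient_ext (h2 _) => [i x|x].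
  by rewrite /dcut expr1 mulNr (mulrC (_^-1) (sqnorm x)) ; ring.
apply: (@continuousM _ _ (fun=> 2%:R) (fun s => pospart s ^+ 1)); first exact: cvg_cst.
exact: continuous_pospartX.
Qed.

Let rb (x : 'rV[R]_n) : R := (1 + sqnorm x) `^ b.

Let drb (x : 'rV[R]_n) : R := b * (1 + sqnorm x) `^ (b - 1).

Let rb_grad : has_gradient rb (fun i x => drb x * (2 * x ord0 i)).
Proof.
have h : has_gradient (fun x : 'rV[R]_n => 1 + sqnorm x) (fun i x => 2 * x ord0 i).
  apply: has_gradient_ext (has_gradientD (has_gradient_cst 1) has_gradient_sqnorm) => i x.
  by rewrite add0r.
have pos (x : 'rV[R]_n) : 0 < 1 + sqnorm x by have := sqnorm_ge0 x; lra.
apply: (has_gradient_comp (phi := fun s => s `^ b) (dphi := fun s => b * s `^ (b - 1)) h).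
  by move=> x; exact: is_derive1_powR.
move=> x; apply: continuousM; first exact: cvg_cst.
exact: continuous_powR_gt0.
Qed.

Let ew (x : 'rV[R]_n) : R := expR (- W x).

Let ew_grad : has_gradient ew (fun i x => - (ew x * gW i x)).
Proof. exact: has_gradient_expRN. Qed.

(** Components of the vector field [cut * r^(2b) * w * e^-W * x]; below, [Yg k i j] is the
    derivative of the [i]-th one in direction [j]. *)
Let Y k (i : 'I_n) x := (cut k x * rb x) * (x ord0 i * (w x * ew x)).

Let Yg k (i j : 'I_n) x :=
  (cut k x * rb x) * (x ord0 i * (w x * - (ew x * gW j x) + ew x * gw j x) +
     (w x * ew x) * (i == j)%:R) +
  (x ord0 i * (w x * ew x)) *
   (cut k x * (drb x * (2 * x ord0 j)) + rb x * (dcut k x * (2 * x ord0 j))).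

Let Y_grad k i : has_gradient (Y k i) (Yg k i).
Proof.
exact: has_gradientM (has_gradientM (cut_grad k) rb_grad)
  (has_gradientM (has_gradient_coord i) (has_gradientM hw ew_grad)).
Qed.

Let dcut_le0 k x : dcut k x <= 0.
Proof. by rewrite /dcut oppr_le0 mulr_ge0 ?pospart_ge0. Qed.

Let drb_le0 x : drb x <= 0.
Proof. by rewrite /drb mulr_le0_ge0 ?powR_ge0. Qed.

Let cut_ge0 k x : 0 <= cut k x.
Proof. exact: sqr_ge0. Qed.

Let cut_le1 k x : cut k x <= 1.
Proof.
rewrite /cut expr_le1// ?pospart_ge0// /pospart ge_max ler01/=.
by rewrite lerBlDr lerDl divr_ge0 ?sqnorm_ge0.
Qed.

Let div_le k x : cut k x * A x * ew x + \sum_i Yg k i i x <= cut k x * B x * ew x.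
Proof.
have ew0 : 0 <= ew x by exact: expR_ge0.
have -> : \sum_i Yg k i i x = cut k x * ew x * (rb x *
     (n%:R * w x + \sum_i x ord0 i * gw i x - w x * \sum_i x ord0 i * gW i x)) +
   2 * (w x * ew x) * (cut k x * drb x + rb x * dcut k x) * sqnorm x.
  rewrite /Yg /sqnorm !mulr_sumr.
  have -> : n%:R * w x = \sum_(i < n) w x.
    by rewrite sumr_const card_ord mulr_natl.
  rewrite -big_split/= -sumrB mulr_sumr mulr_sumr -big_split/=.
  apply: eq_bigr => i _; rewrite eqxx mulr1; ring.
have := ler_wpM2l (mulr_ge0 (cut_ge0 k x) ew0) (AB x).
(* Both factors of the radial weight decrease with the norm, since [b <= 0], so their derivatives
   only lower the divergence. *)
have : (w x * ew x) * (cut k x * drb x + rb x * dcut k x) * sqnorm x <= 0.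
  rewrite mulr_le0_ge0 ?sqnorm_ge0// mulr_ge0_le0 ?mulr_ge0//.
  by rewrite -oppr_ge0 opprD addr_ge0// -mulrN mulr_ge0 ?oppr_ge0 ?powR_ge0.
by rewrite -/(rb x); lra.
Qed.

Let cube_cut k (x : 'rV[R]_n) : ~ cube k.+1%:R x -> pospart (1 - sqnorm x / k.+1%:R) = 0.
Proof.
move=> rx; apply: pospart_eq0; rewrite subr_le0 ler_pdivlMr// mul1r.
move/existsNP : rx => [i /negP]; rewrite in_itv/= -ler_norml -ltNge => xi.
apply: le_trans (le_sqnorm x i); rewrite -real_normK ?num_real//.
(* The cut-off lives on [|x|^2 < k.+1]; from [|x_i| > k.+1 >= 1] follows [x_i^2 > k.+1]. *)
have k1 : 1 <= k.+1%:R :> R by rewrite ler1n.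
by nra.
Qed.

Let Y_cube k i x : ~ cube k.+1%:R x -> Y k i x = 0 /\ Yg k i i x = 0.
Proof.
move=> /cube_cut cx; rewrite /Yg /Y /cut /dcut cx expr0n/=.
by split; ring.
Qed.

Let Yg_integrable k i : lebn.-integrable setT (EFin \o Yg k i i).
Proof.
apply: (@integrable_cube _ _ _ k.+1%:R).
  by have [_ _] := Y_grad k i; exact.
by move=> x /(Y_cube i)[].
Qed.

Let Yg_integral k i : (\int[lebn]_x (Yg k i i x)%:E = 0)%E.
Proof.
exact: (integral_partial_eq0 (Y_grad k i) (@Y_cube k i)).
Qed.

Let cont_measurable (f : 'rV[R]_n -> R) g : has_gradient f g -> measurable_fun setT f.
Proof. exact: has_gradient_measurable. Qed.

Let step k : (\int[lebn]_x (cut k x * A x * ew x)%:E <=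
  \int[lebn]_x (B x * ew x)%:E)%E.
Proof.
have mew := cont_measurable ew_grad.
have mBe : measurable_fun setT (fun x => (B x * ew x)%:E).
  by apply/measurable_EFinP; exact: measurable_funM.
have Be0 x : (0 <= (B x * ew x)%:E)%E by rewrite lee_fin mulr_ge0 ?expR_ge0.
have [Boo|Boo] := eqVneq (\int[lebn]_x (B x * ew x)%:E)%E +oo%E.
  by rewrite Boo leey.
have iB : lebn.-integrable setT (fun x => (B x * ew x)%:E).
  apply/integrableP; split => //.
  under eq_integral do rewrite gee0_abs//.
  by rewrite lt_neqAle Boo leey.
have iY : lebn.-integrable setT (fun x => \sum_i (Yg k i i x)%:E)%E.
  by apply: integrable_sum => // i _; exact: Yg_integrable.
(* Subtracting the divergence, whose integral is zero, makes the comparison pointwise. The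
   subtraction is legitimate because the integral of [B * ew] is finite here. *)
rewrite -[leRHS]sube0.
have <- : (\int[lebn]_x (\sum_i (Yg k i i x)%:E) = 0)%E.
  rewrite integral_sum//; last by move=> i; exact: Yg_integrable.
  by rewrite big1.
rewrite -integralB//; apply: ge0_le_integral => //.
- move=> x _; rewrite lee_fin; apply: mulr_ge0; last exact: expR_ge0.
  exact: mulr_ge0.
- apply/measurable_EFinP; apply: measurable_funM => //; apply: measurable_funM => //.
  exact: cont_measurable (cut_grad k).
- apply: emeasurable_funB => //.
  by case/integrableP : iY.
- move=> x _; rewrite sumEFin -EFinB lee_fin lerBrDr.
  apply: (le_trans (div_le k x)).
  by rewrite -mulrA ler_piMl// mulr_ge0// expR_ge0.
Qed.

(** In [AB] the weighted bracket times [e^-W] is the divergence of [r^(2b) w e^-W x], short of the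
    nonpositive derivative of [r^(2b)]. Keeping [A] and [B] nonnegative and on opposite sides avoids
    any integrability assumption. The cut-offs increase to 1, so monotone convergence removes
    them. *)
Lemma integral_divergence_le : (\int[lebn]_x (A x * ew x)%:E <=
  \int[lebn]_x (B x * ew x)%:E)%E.
Proof.
have mew := cont_measurable ew_grad.
have cut_cvg x : cut k x @[k --> \oo] --> (1 : R).
  have h : (fun y : R => pospart (1 - sqnorm x * y) ^+ 2) y @[y --> 0] --> (1 : R).
    have e : pospart (1 - sqnorm x * 0) ^+ 2 = 1 :> R.
      by rewrite mulr0 subr0 pospart_id ?ler01// expr1n.
    rewrite -[X in _ --> X]e.
    apply: (@continuous_comp _ _ _ (fun y : R => 1 - sqnorm x * y) (fun y => pospart y ^+ 2)).
      apply: continuousB; first exact: cst_continuous.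
      by apply: continuousM; [exact: cst_continuous|exact: id].
    exact: continuous_pospartX.
  exact: (cvg_comp _ _ (@cvg_harmonic R) h).
have cut_lim x : (cut k x * A x * ew x)%:E @[k --> \oo] --> (A x * ew x)%:E.
  apply: cvg_EFin; first by near=> k.
  rewrite -[X in _ --> X]mul1r.
  under eq_fun do rewrite -mulrA.
  by apply: cvgM; [exact: cut_cvg|exact: cvg_cst].
have -> : (\int[lebn]_x (A x * ew x)%:E =
    \int[lebn]_x limn (fun k => (cut k x * A x * ew x)%:E))%E.
  by apply: eq_integral => x _; apply/esym/cvg_lim => //; exact: cut_lim.
have mk k : measurable_fun setT (fun x => (cut k x * A x * ew x)%:E).
  apply/measurable_EFinP; apply: measurable_funM => //; apply: measurable_funM => //.
  exact: cont_measurable (cut_grad k).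
have k0 k x : setT x -> (0 <= (cut k x * A x * ew x)%:E)%E.
  by move=> _; rewrite lee_fin mulr_ge0 ?expR_ge0// mulr_ge0.
have kmono x : setT x ->
    {homo (fun k => (cut k x * A x * ew x)%:E) : k l / (k <= l)%N >-> (k <= l)%E}.
  move=> _ k l kl; have ckl : cut k x <= cut l x.
    rewrite /cut ler_pXn2r ?nnegrE ?pospart_ge0// le_pospart// lerD2l lerN2.
    by rewrite ler_wpM2l ?sqnorm_ge0// lef_pV2 ?posrE// ler_nat.
  rewrite lee_fin; apply: ler_wpM2r; first exact: expR_ge0.
  exact: ler_wpM2r.
have cvg := cvg_monotone_convergence (mu := lebn) measurableT mk k0 kmono.
rewrite -(cvg_lim _ cvg)//.
apply: lime_le; last by near=> k; exact: step.
by apply/cvg_ex; eexists; exact: cvg.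
Unshelve. all: by end_near. Qed.

End divergence.

(** * Poincare inequality on cubes *)

Section cube_poincare.
Context {R : realType}.
Local Notation leb := (@lebesgue_measure R).
Local Notation lebn m := (@lebesgue_rV R m).
Local Open Scope ereal_scope.

Lemma ge0_integral_cube n (r : R) (f : 'rV[R]_n.+1 -> \bar R) :
  measurable_fun setT f -> (forall x, 0 <= f x) ->
  \int[lebn n.+1]_(x in cube r) f x =
  \int[leb]_(t in `[(- r)%R, r]) \int[lebn n]_(y in cube r) f (rV_cons (t, y)).
Proof.
move=> mf f0; rewrite integral_mkcond ge0_integral_rV; last 2 first.
- by apply/(measurable_restrictT _ _).1; [exact: measurable_cube|exact: measurable_funTS].
- by move=> x; rewrite patchE; case: ifP.
rewrite [RHS]integral_mkcond; apply: eq_integral => t _.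
rewrite patchE; case: ifPn => [|] tr.
  rewrite [RHS]integral_mkcond; apply: eq_integral => y _.
  rewrite !patchE; congr (if _ then _ else _).
  apply/idP/idP; rewrite !inE => h.
    by move=> i; have := h (lift ord0 i); rewrite rV_cons_lift.
  move=> i; have [j ->|->] := unliftP ord0 i; first by rewrite rV_cons_lift; exact: h.
  by rewrite rV_cons_ord0; move: tr; rewrite inE.
apply: integral0_eq => y _; rewrite patchE; case: ifPn => //; rewrite inE.
move=> /(_ ord0); rewrite rV_cons_ord0/= => h.
by move: tr; rewrite notin_setE => /(_ h).
Qed.

Lemma ge0_integral_cube_swap n (r : R) (f : 'rV[R]_n.+1 -> \bar R) :
  measurable_fun setT f -> (forall x, 0 <= f x) ->
  \int[lebn n.+1]_(x in cube r) f x =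
  \int[lebn n]_(y in cube r) \int[leb]_(t in `[(- r)%R, r]) f (rV_cons (t, y)).
Proof.
move=> mf f0; rewrite integral_mkcond ge0_integral_rV_swap; last 2 first.
- by apply/(measurable_restrictT _ _).1; [exact: measurable_cube|exact: measurable_funTS].
- by move=> x; rewrite patchE; case: ifP.
rewrite [RHS]integral_mkcond; apply: eq_integral => y _.
rewrite patchE; case: ifPn => [|] yr.
  rewrite [RHS]integral_mkcond; apply: eq_integral => t _.
  rewrite !patchE; congr (if _ then _ else _).
  apply/idP/idP; rewrite !inE => h.
    by have := h ord0; rewrite rV_cons_ord0.
  move=> i; have [j ->|->] := unliftP ord0 i; last by rewrite rV_cons_ord0.
  by rewrite rV_cons_lift; move: yr; rewrite inE; exact.
apply: integral0_eq => t _; rewrite patchE; case: ifPn => //; rewrite inE.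
move=> h; move: yr; rewrite notin_setE; case=> i.
by have := h (lift ord0 i); rewrite rV_cons_lift.
Qed.

Lemma measurable_integral_cube n (r : R) (f : 'rV[R]_n.+1 -> \bar R) :
  measurable_fun setT f -> (forall x, 0 <= f x) ->
  measurable_fun setT (fun t : R => \int[lebn n]_(y in cube r) f (rV_cons (t, y))).
Proof.
move=> mf f0.
pose Q : set 'rV[R]_n.+1 := [set x | forall j, `[(- r)%R, r]%classic (x ord0 (lift ord0 j))].
have mQ : measurable Q.
  rewrite (_ : Q = \bigcap_(j in [set: 'I_n])
      ((fun x : 'rV[R]_n.+1 => x ord0 (lift ord0 j)) @^-1` `[(- r)%R, r]%classic)).
    apply: fin_bigcap_measurable => // j _.
    by rewrite -[X in measurable X]setTI; apply: measurable_rV_coord.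
  by apply/seteqP; split => x /= h j; [move=> _; exact: h|exact: (h j)].
rewrite (_ : (fun t : R => _) = fun t => \int[lebn n]_y (f \_ Q) (rV_cons (t, y))).
  apply: measurable_integral_rV_cons2.
    by apply/(measurable_restrictT _ _).1 => //; exact: measurable_funTS.
  by move=> x; rewrite patchE; case: ifP.
apply/funext => t; rewrite integral_mkcond; apply: eq_integral => y _.
rewrite !patchE; congr (if _ then _ else _).
apply/idP/idP; rewrite !inE => h j; have := h j; by rewrite rV_cons_lift.
Qed.

Lemma measurable_integral_itv n (r : R) (f : 'rV[R]_n.+1 -> R) :
  measurable_fun setT (fun x => (f x ^+ 2)%:E) ->
  measurable_fun setT
    (fun y : 'rV[R]_n => \int[leb]_(t in `[(- r)%R, r]) (f (rV_cons (t, y)) ^+ 2)%:E).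
Proof.
move=> mf.
pose Q : set 'rV[R]_n.+1 := [set x | `[(- r)%R, r]%classic (x ord0 ord0)].
have mQ : measurable Q.
  by rewrite -[X in measurable X]setTI; apply: measurable_rV_coord.
rewrite (_ : (fun y => _) = fun y => \int[leb]_t ((fun x => (f x ^+ 2)%:E) \_ Q) (rV_cons (t, y))).
  apply: measurable_integral_rV_cons1.
    by apply/(measurable_restrictT _ _).1 => //; exact: measurable_funTS.
  by move=> x; rewrite patchE; case: ifP => // _; rewrite lee_fin sqr_ge0.
apply/funext => y; rewrite integral_mkcond; apply: eq_integral => t _.
rewrite !patchE; congr (if _ then _ else _).
by apply/idP/idP; rewrite !inE /Q /= rV_cons_ord0.
Qed.

Lemma lebesgue_measure_symitv (r : R) : (0 <= r)%R ->
  leb (`[(- r)%R, r]%classic : set R) = (2 * r)%:E.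
Proof.
move=> r0; rewrite lebesgue_measure_itv/= lte_fin.
case: ltP => rr; first by rewrite -EFinB; congr (_%:E); ring.
by congr (_%:E); lra.
Qed.

Lemma sqr_diff_le (u v : R -> R) (r x y : R) : (0 < r)%R ->
  (forall x, is_derive x (1%R : R) u (v x)) -> continuous v ->
  x \in `[(- r)%R, r] -> y \in `[(- r)%R, r] ->
  ((u x - u y) ^+ 2)%:E <= (2 * r)%:E * \int[leb]_(s in `[(- r)%R, r]) (v s ^+ 2)%:E.
Proof.
move=> r0 du cv xr yr.
have mv : measurable_fun `[(- r)%R, r] v.
  by apply: measurable_funTS; exact: continuous_measurable_fun.
have mv2 : measurable_fun `[(- r)%R, r] (fun s => (v s ^+ 2)%:E).
  by apply/measurable_EFinP; exact: measurable_funX.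
have J0 : 0 <= \int[leb]_(s in `[(- r)%R, r]) (v s ^+ 2)%:E.
  by apply: integral_ge0 => s _; rewrite lee_fin sqr_ge0.
have [Joo|Joo] := eqVneq (\int[leb]_(s in `[(- r)%R, r]) (v s ^+ 2)%:E) +oo.
  by rewrite Joo gt0_muley ?leey// lte_fin mulr_gt0.
pose j := fine (\int[leb]_(s in `[(- r)%R, r]) (v s ^+ 2)%:E).
have jE : \int[leb]_(s in `[(- r)%R, r]) (v s ^+ 2)%:E = j%:E.
  by rewrite fineK// ge0_fin_numE// lt_neqAle Joo leey.
have j0 : (0 <= j)%R by rewrite -lee_fin -jE.
rewrite jE -EFinM lee_fin -real_normK ?num_real//.
set D := `|u x - u y|%R; have : (0 <= D)%R by exact: normr_ge0.
rewrite le_eqVlt => /orP[/eqP <-|D0]; first by rewrite expr0n/= !mulr_ge0// ltW.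
(* Cauchy-Schwarz through [|v| <= D / (4 r) + (r / D) v^2]: the interval has length [2 r], so the
   constant integrates to [D / 2] and is absorbed on the left. *)
have : D%:E <= (D / 2 + r / D * j)%:E.
  apply: (le_trans (le_integral_norm_derivative du cv xr yr)).
  apply: (@le_trans _ _ (\int[leb]_(s in `[(- r)%R, r])
     ((D / (4 * r))%:E + (r / D)%:E * (v s ^+ 2)%:E))).
    apply: ge0_le_integral => //.
    - by apply/measurable_EFinP; exact: measurableT_comp.
    - apply: emeasurable_funD => //; exact: measurable_funeM.
    - move=> s _; rewrite -EFinM -EFinD lee_fin -(real_normK (num_real (v s))).
      set a := `|v s|%R.
      rewrite -subr_ge0.
      have -> : (D / (4 * r) + r / D * a ^+ 2 - a = (D / (2 * r) - a) ^+ 2 * (r / D))%R.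
        by field; rewrite !gt_eqF.
      by rewrite mulr_ge0 ?sqr_ge0// divr_ge0// ltW.
  rewrite ge0_integralD//; last 3 first.
  - by move=> s _; rewrite lee_fin divr_ge0// ?mulr_ge0// ltW.
  - by move=> s _; rewrite -EFinM lee_fin mulr_ge0 ?sqr_ge0// divr_ge0// ltW.
  - exact: measurable_funeM.
  rewrite integral_cst// ge0_integralZl//; last 2 first.
  - by move=> s _; rewrite lee_fin sqr_ge0.
  - by rewrite lee_fin divr_ge0// ltW.
  rewrite jE [X in _ * X + _](lebesgue_measure_symitv (ltW r0)).
  rewrite -!EFinM -EFinD lee_fin lerD2r.
  rewrite le_eqVlt; apply/orP; left; apply/eqP; field; exact: lt0r_neq0.
rewrite lee_fin => h.
have : (D / 2 <= r / D * j)%R by lra.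
move=> /(ler_wpM2r (ltW D0)).
have -> : (r / D * j * D = r * j)%R by field; exact: lt0r_neq0.
by rewrite expr2; lra.
Qed.

Lemma exists_le_average (r : R) (G : R -> \bar R) (e e' : R) : (0 < r)%R ->
  measurable_fun setT G -> (forall t, 0 <= G t) ->
  \int[leb]_(t in `[(- r)%R, r]) G t <= e%:E -> (e < e')%R ->
  exists2 t, t \in `[(- r)%R, r] & G t <= (e' / (2 * r))%:E.
Proof.
move=> r0 mG G0 Ge ee'; apply: contrapT => H.
have Gt t : `[(- r)%R, r]%classic t -> (e' / (2 * r))%:E <= G t.
  move=> tr; rewrite leNgt; apply/negP => Gt; apply: H; exists t => //.
  exact: ltW.
have e0 : (0 <= e)%R by rewrite -lee_fin (le_trans _ Ge)// integral_ge0.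
have : \int[leb]_(t in `[(- r)%R, r]) (cst (e' / (2 * r))%:E) t <= e%:E.
  apply: le_trans Ge; apply: ge0_le_integral => //.
    move=> t _; rewrite lee_fin divr_ge0//; first by rewrite ltW// (le_lt_trans e0).
    by rewrite mulr_ge0// ltW.
  exact: measurable_funTS.
rewrite integral_cst// [X in _ * X <= _](lebesgue_measure_symitv (ltW r0)) -EFinM.
by rewrite lee_fin divfK; [rewrite leNgt ee'|rewrite lt0r_neq0// mulr_gt0].
Qed.

(* [eps] pays for choosing a slice of at most average energy: the average need
   not be attained. *)
Lemma cube_poincare n (r : R) : (0 < r)%R -> exists K, (0 < K)%R /\
  forall (f : 'rV[R]_n -> R) g (eps : R), has_gradient f g -> (0 < eps)%R ->
  exists c : R, \int[lebn n]_(x in cube r) ((f x - c) ^+ 2)%:E <=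
    K%:E * \int[lebn n]_(x in cube r) (\sum_i g i x ^+ 2)%:E + eps%:E.
Proof.
move=> r0; elim: n => [|n [K [K0 IH]]].
  exists 1%R; split => // f g e fg e0; exists (f 0%R).
  rewrite integral0_eq; last by move=> x _; rewrite (thinmx0 x) subrr expr0n.
  apply: adde_ge0; last by rewrite lee_fin ltW.
  apply: mule_ge0; first by rewrite lee_fin.
  apply: integral_ge0 => x _; by rewrite lee_fin sumr_ge0// => i _; exact: sqr_ge0.
exists (8 * r ^+ 2 + 2 * K)%R; split.
  by rewrite addr_gt0// mulr_gt0// exprn_gt0.
move=> f g eps fg eps0.
have mfun (h : 'rV[R]_n.+1 -> R) : measurable_fun setT h ->
    measurable_fun setT (fun x => (h x ^+ 2)%:E).
  by move=> mh; apply/measurable_EFinP; exact: measurable_funX.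
have mg i := mfun _ (has_gradient_measurable_grad i fg).
pose S x := (\sum_(j < n) g (lift ord0 j) x ^+ 2)%R.
have S0 x : (0 <= S x)%R by apply: sumr_ge0 => j _; exact: sqr_ge0.
have mS : measurable_fun setT (fun x => (S x)%:E).
  apply/measurable_EFinP; apply: measurable_sum => j.
  by apply: measurable_funX; exact: has_gradient_measurable_grad fg.
have mc := @measurable_cube R n.+1 r.
have DE : \int[lebn n.+1]_(x in cube r) (\sum_i g i x ^+ 2)%:E =
   \int[lebn n.+1]_(x in cube r) (g ord0 x ^+ 2)%:E + \int[lebn n.+1]_(x in cube r) (S x)%:E.
  rewrite -ge0_integralD//.
  - by apply: eq_integral => x _; rewrite big_ord_recl.
  - by move=> x _; rewrite lee_fin sqr_ge0.
  - exact: measurable_funTS.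
  - by move=> x _; rewrite lee_fin.
  - exact: measurable_funTS.
have D00 : 0 <= \int[lebn n.+1]_(x in cube r) (g ord0 x ^+ 2)%:E.
  by apply: integral_ge0 => x _; rewrite lee_fin sqr_ge0.
have DS0 : 0 <= \int[lebn n.+1]_(x in cube r) (S x)%:E.
  by apply: integral_ge0 => x _; rewrite lee_fin.
have [Doo|Doo] := eqVneq (\int[lebn n.+1]_(x in cube r) (\sum_i g i x ^+ 2)%:E) +oo.
  exists 0%R; rewrite Doo gt0_muley ?addye ?leey//.
  by rewrite lte_fin addr_gt0// mulr_gt0// exprn_gt0.
have Dfin : \int[lebn n.+1]_(x in cube r) (g ord0 x ^+ 2)%:E \is a fin_num /\
    \int[lebn n.+1]_(x in cube r) (S x)%:E \is a fin_num.
  apply/andP; rewrite -fin_numD -DE ge0_fin_numE ?lt_neqAle ?Doo ?leey//.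
  by rewrite DE adde_ge0.
have [/fineK D0E /fineK DSE] := Dfin.
set D0 := fine _ in D0E; set DS := fine _ in DSE.
pose G t := \int[lebn n]_(y in cube r) (S (rV_cons (t, y)))%:E.
have mG : measurable_fun setT G.
  by apply: measurable_integral_cube mS _ => x; rewrite lee_fin.
have G0 t : 0 <= G t by apply: integral_ge0 => y _; rewrite lee_fin.
have GE : \int[leb]_(t in `[(- r)%R, r]) G t <= DS%:E.
  by rewrite DSE (ge0_integral_cube r mS)// => x; rewrite lee_fin.
(* The errors enter the final bound as [2 K e1 + 4 r e2], and each term is half of [eps]. *)
pose e1 := (eps / (4 * K))%R; pose e2 := (eps / (8 * r))%R.
have e10 : (0 < e1)%R by rewrite divr_gt0// mulr_gt0.
have e20 : (0 < e2)%R by rewrite divr_gt0// mulr_gt0.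
(* The constant [c] of the induction hypothesis on this one slice serves the whole cube, every point
   being compared with the slice along the first axis. *)
have [ts tsr Gts] : exists2 t, t \in `[(- r)%R, r] & G t <= ((DS + e1) / (2 * r))%:E.
  by apply: (exists_le_average r0 mG G0 GE); rewrite ltrDl.
have [c cP] := IH _ _ e2 (has_gradient_rV_cons2 ts fg) e20.
exists c; rewrite DE -D0E -DSE -EFinD.
have mfc : measurable_fun setT (fun x => ((f x - c) ^+ 2)%:E).
  by apply: mfun; apply: measurable_funB => //; exact: has_gradient_measurable fg.
rewrite (ge0_integral_cube r mfc); last by move=> x; rewrite lee_fin sqr_ge0.
pose kap := (4 * r * D0 + 2 * (K * ((DS + e1) / (2 * r)) + e2))%R.
have D0ge : (0 <= D0)%R by rewrite fine_ge0.
have DSge : (0 <= DS)%R by rewrite fine_ge0.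
have kap0 : (0 <= kap)%R.
  have r0' := ltW r0; have K0' := ltW K0.
  apply: addr_ge0; first by rewrite !mulr_ge0.
  apply: mulr_ge0 => //; apply: addr_ge0; last exact: ltW.
  by rewrite mulr_ge0// divr_ge0 ?mulr_ge0// addr_ge0// ltW.
have mc' := @measurable_cube R n r.
have inner t : `[(- r)%R, r]%classic t ->
    \int[lebn n]_(y in cube r) ((f (rV_cons (t, y)) - c) ^+ 2)%:E <= kap%:E.
  move=> tr.
  have mfy s : measurable_fun setT (fun y => f (rV_cons (s, y))).
    exact: has_gradient_measurable (has_gradient_rV_cons2 s fg).
  pose H y := \int[leb]_(s in `[(- r)%R, r]) (g ord0 (rV_cons (s, y)) ^+ 2)%:E.
  have mH : measurable_fun setT H.
    exact: (measurable_integral_itv r (mg ord0)).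
  have H0 y : 0 <= H y by apply: integral_ge0 => s _; rewrite lee_fin sqr_ge0.
  have mts : measurable_fun setT (fun y => ((f (rV_cons (ts, y)) - c) ^+ 2)%:E).
    by apply/measurable_EFinP; apply: measurable_funX; apply: measurable_funB.
  apply: (@le_trans _ _ (\int[lebn n]_(y in cube r)
      ((4 * r)%:E * H y + 2%:E * ((f (rV_cons (ts, y)) - c) ^+ 2)%:E))).
    apply: ge0_le_integral => //.
    - by move=> y _; rewrite lee_fin sqr_ge0.
    - apply: measurable_funTS; apply/measurable_EFinP.
      by apply: measurable_funX; apply: measurable_funB.
    - by apply: measurable_funTS; apply: emeasurable_funD; exact: measurable_funeM.
    - move=> y _.
      apply: (@le_trans _ _ (2%:E * ((f (rV_cons (t, y)) - f (rV_cons (ts, y))) ^+ 2)%:E +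
                 2%:E * ((f (rV_cons (ts, y)) - c) ^+ 2)%:E)).
        rewrite -!EFinM -EFinD lee_fin.
        set a := f _; set b := f _.
        have : (0 <= (a - b - (b - c)) ^+ 2)%R by exact: sqr_ge0.
        by nra.
      rewrite leeD2r//.
      have -> : ((4 * r)%:E = 2%:E * (2 * r)%:E :> \bar R).
        by rewrite -EFinM; congr (_%:E); ring.
      rewrite -muleA lee_wpmul2l//.
      apply: (@sqr_diff_le (fun s => f (rV_cons (s, y))) (fun s => g ord0 (rV_cons (s, y)))) => //.
      + by move=> s; exact: has_gradient_rV_cons1 fg.
      + by case: fg => _ _ cg; exact: continuous_rV_cons1_comp.
  rewrite ge0_integralD//; last 4 first.
  - by move=> y _; rewrite mule_ge0// lee_fin mulr_ge0// ltW.
  - by apply: measurable_funTS; exact: measurable_funeM.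
  - by move=> y _; rewrite mule_ge0// lee_fin sqr_ge0.
  - by apply: measurable_funTS; exact: measurable_funeM.
  rewrite ge0_integralZl//; last 2 first.
  - exact: measurable_funTS.
  - by rewrite lee_fin mulr_ge0// ltW.
  rewrite ge0_integralZl//; last 2 first.
  - exact: measurable_funTS.
  - by move=> y _; rewrite lee_fin sqr_ge0.
  have -> : kap%:E = (4 * r)%:E * D0%:E +
      2%:E * (K%:E * ((DS + e1) / (2 * r))%:E + e2%:E) :> \bar R by [].
  apply: leeD.
    rewrite D0E (ge0_integral_cube_swap r (mg ord0))// => x.
    by rewrite lee_fin sqr_ge0.
  rewrite lee_wpmul2l//; apply: (le_trans cP).
  by rewrite leeD2r// lee_wpmul2l// lee_fin ltW.
apply: (@le_trans _ _ (\int[leb]_(t in `[(- r)%R, r]) (cst kap%:E) t)).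
  apply: ge0_le_integral => //.
  - by move=> t _; apply: integral_ge0 => y _; rewrite lee_fin sqr_ge0.
  - apply: measurable_funTS.
    by apply: measurable_integral_cube mfc _ => x; rewrite lee_fin sqr_ge0.
rewrite integral_cst// [X in _ * X <= _](lebesgue_measure_symitv (ltW r0)) -EFinM lee_fin.
have -> : (kap * (2 * r) = 8 * r ^+ 2 * D0 + 2 * K * DS + eps)%R.
  by rewrite /kap /e1 /e2; field; rewrite !lt0r_neq0.
rewrite lerD2r mulrDl; rewrite !mulrDr.
have : (0 <= r ^+ 2 * DS)%R by rewrite mulr_ge0// sqr_ge0.
have : (0 <= K * D0)%R by rewrite mulr_ge0// ltW.
by lra.
Qed.

End cube_poincare.

(** * Densities and elementary real inequalities *)

Section density.
Context d (T : measurableType d) (R : realType).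
Variables (mu nu : {measure set T -> \bar R}) (h : T -> R).
Hypotheses (mh : measurable_fun setT h) (h0 : forall x, 0 <= h x).
Hypothesis nuE : forall A, measurable A -> nu A = (\int[mu]_(x in A) (h x)%:E)%E.
Local Open Scope ereal_scope.
Import HBNNSimple.

Let integral_density_indic (E : set T) : measurable E ->
  \int[nu]_x (\1_E x)%:E = \int[mu]_x ((\1_E x)%:E * (h x)%:E).
Proof.
move=> mE; rewrite integral_indic//= setIT nuE// integral_mkcond.
apply: eq_integral => x _; rewrite patchE indicE.
by case: ifPn => _; rewrite ?mul1e ?mul0e.
Qed.

Let integral_density_nnsfun (f : {nnsfun T >-> R}) :
  \int[nu]_x (f x)%:E = \int[mu]_x ((f x)%:E * (h x)%:E).
Proof.
have h0' x : 0 <= (h x)%:E by rewrite lee_fin.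
under [LHS]eq_integral do rewrite fimfunE -fsumEFin//.
rewrite [LHS]ge0_integral_fsum//; last 2 first.
  - by move=> r; exact/measurable_EFinP/measurableT_comp.
  - by move=> n x _; rewrite EFinM nnfun_muleindic_ge0.
under [RHS]eq_integral.
  move=> x xD; rewrite fimfunE -fsumEFin// muleC ge0_mule_fsumr; last first.
    by move=> r; rewrite EFinM nnfun_muleindic_ge0.
  over.
rewrite [RHS]ge0_integral_fsum//; last 2 first.
  - move=> r; apply: emeasurable_funM; first exact/measurable_EFinP.
    exact/measurable_EFinP/measurableT_comp.
  - move=> n x _; rewrite EFinM mule_ge0//; by rewrite nnfun_muleindic_ge0.
apply: eq_fsbigr => r; rewrite inE => -[t _ <-].
under eq_integral do rewrite EFinM.
under [RHS]eq_integral do rewrite EFinM muleCA.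
rewrite ge0_integralZl//; last 2 first.
- exact/measurable_EFinP/measurable_indic.
- by rewrite lee_fin.
rewrite ge0_integralZl//; last 3 first.
- by apply: emeasurable_funM; [exact/measurable_EFinP|exact/measurable_EFinP/measurable_indic].
- by move=> x _; rewrite mule_ge0// lee_fin.
- by rewrite lee_fin.
rewrite integral_density_indic//.
by under [in RHS]eq_integral do rewrite muleC.
Qed.

Lemma ge0_integral_density (f : T -> R) : measurable_fun setT f ->
  (forall x, 0 <= f x)%R ->
  \int[nu]_x (f x)%:E = \int[mu]_x (f x * h x)%:E.
Proof.
move=> mf f0.
have mf' : measurable_fun setT (fun x => (f x)%:E) by exact/measurable_EFinP.
have f0' x : setT x -> 0 <= (f x)%:E by move=> _; rewrite lee_fin.
pose f_ := nnsfun_approx measurableT mf'.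
transitivity (lim (\int[nu]_x (f_ n x)%:E @[n --> \oo])).
  rewrite -monotone_convergence//=.
  - apply: eq_integral => x _; apply/esym/cvg_lim => //.
    exact: cvg_nnsfun_approx.
  - by move=> n; exact/measurable_EFinP/measurable_funTS.
  - by move=> n x _; rewrite lee_fin.
  - by move=> x _ a b ab; rewrite lee_fin; exact/lefP/nd_nnsfun_approx.
transitivity (lim (\int[mu]_x ((f_ n x)%:E * (h x)%:E) @[n --> \oo])).
  by congr (lim (_ @ \oo)); apply/funext => n; rewrite integral_density_nnsfun.
rewrite -monotone_convergence//=.
- apply: eq_integral => x _; apply/cvg_lim => //.
  rewrite EFinM; apply: cvgeZr => //; exact: cvg_nnsfun_approx.
- move=> n; apply: emeasurable_funM; last exact/measurable_EFinP.
  exact/measurable_EFinP/measurable_funTS.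
- by move=> n x _; rewrite mule_ge0// lee_fin.
- move=> x _ a b ab; rewrite lee_wpmul2r// lee_fin//; exact/lefP/nd_nnsfun_approx.
Qed.

End density.

Section real_inequalities.
Context {R : realType}.
Implicit Types a b c p q r t x y tau eps : R.

Lemma ge0_le_powR p x y : 0 <= p -> 0 <= x -> x <= y -> x `^ p <= y `^ p.
Proof. by move=> p0 x0 xy; apply: ge0_ler_powR => //; rewrite nnegrE// (le_trans x0). Qed.

Lemma powR_subadditive p a b : 0 <= p -> p <= 1 -> 0 <= a -> 0 <= b ->
  (a + b) `^ p <= a `^ p + b `^ p.
Proof.
move=> p0 p1 a0 b0.
have [ab0|ab0] := leP (a + b) 0.
  have -> : a = 0 by lra.
  by rewrite add0r lerDr powR_ge0.
(* With [s = x / (a + b)] in [0, 1] one has [s <= s^p]; the claim is the sum over [x = a] and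
   [x = b]. *)
have frac x : 0 <= x -> x <= a + b -> (a + b) `^ p * (x / (a + b)) <= x `^ p.
  rewrite le_eqVlt => /orP[/eqP <- _|x0 xab]; first by rewrite mul0r mulr0 powR_ge0.
  have xE : x = (a + b) * (x / (a + b)) by rewrite mulrCA divff ?mulr1// gt_eqF.
  have q0 : 0 < x / (a + b) by rewrite divr_gt0.
  rewrite {2}xE powRM ?(ltW q0)//; last exact: ltW.
  rewrite ler_wpM2l ?powR_ge0// ger1_powR// q0/=.
  by rewrite ler_pdivrMr// mul1r.
have -> : (a + b) `^ p = (a + b) `^ p * (a / (a + b)) + (a + b) `^ p * (b / (a + b)).
  by rewrite -mulrDr -mulrDl divff ?mulr1// gt_eqF.
by rewrite lerD// frac// ?lerDl ?lerDr.
Qed.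

Lemma powR_large p M : 0 < p -> 0 <= M -> exists r0, forall r, r0 <= r -> M <= r `^ p.
Proof.
move=> p0 M0; exists (M `^ p^-1) => r rr.
have {1}-> : M = (M `^ p^-1) `^ p by rewrite -powRrM mulVf ?gt_eqF// powRr1.
by apply: ge0_le_powR; rewrite ?powR_ge0// ltW.
Qed.

Lemma powR_absorb p q eps : 0 <= p -> p < q -> 0 < eps ->
  exists2 K, 0 <= K & forall r, 0 <= r -> r `^ p <= eps * r `^ q + K.
Proof.
move=> p0 pq e0.
have [r0 r0P] := @powR_large (q - p) eps^-1 ltac:(lra) ltac:(by rewrite invr_ge0 ltW).
pose s := Num.max 1 r0.
exists (s `^ p); first exact: powR_ge0.
move=> r rge0; have [rs|rs] := leP s r.
  have r1 : 0 < r by apply: lt_le_trans rs; rewrite lt_max ltr01.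
  rewrite (_ : q = p + (q - p)); last by ring.
  rewrite powRD; last by rewrite (gt_eqF r1) implybT.
  have := r0P r (le_trans _ rs); rewrite le_max lexx orbT => /(_ isT) h.
  have h1 : 1 <= eps * r `^ (q - p) by rewrite mulrC -ler_pdivrMr// mul1r.
  have := ler_wpM2r (powR_ge0 r p) h1.
  by have := powR_ge0 s p; nra.
apply: (le_trans (ge0_le_powR p0 rge0 (ltW rs))).
by rewrite lerDr mulr_ge0 ?powR_ge0// ltW.
Qed.

Lemma young_eps a b eps : 0 < a -> 0 < b -> a^-1 + b^-1 = 1 -> 0 < eps ->
  exists2 K, 0 <= K & forall x y, 0 <= x -> 0 <= y -> x * y <= eps * x `^ a + K * y `^ b.
Proof.
move=> a0 b0 ab e0.
(* The inequality is rescaled to [l * x] and [y / l], with [l^a / a = eps]. *)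
pose l := (eps * a) `^ a^-1.
have l0 : 0 < l by rewrite powR_gt0// mulr_gt0.
exists ((l^-1) `^ b / b); first by rewrite divr_ge0 ?powR_ge0// ltW.
move=> x y x0 y0.
have -> : x * y = (l * x) * (l^-1 * y) by field; rewrite gt_eqF.
apply: (le_trans (conjugate_powR _ _ a0 b0 ab)).
- by rewrite mulr_ge0// ltW.
- by rewrite mulr_ge0// invr_ge0 ltW.
rewrite !powRM ?invr_ge0 ?(ltW l0)//.
have -> : l `^ a = eps * a.
  by rewrite -powRrM mulVf ?gt_eqF// powRr1// mulr_ge0// ltW.
rewrite le_eqVlt; apply/orP; left; apply/eqP; field.
by rewrite !gt_eqF.
Qed.

Lemma cauchy_schwarz_sum n (u v : 'I_n -> R) :
  (\sum_i u i * v i) ^+ 2 <= (\sum_i u i ^+ 2) * (\sum_i v i ^+ 2).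
Proof.
set A := \sum_i u i ^+ 2; set B := \sum_i v i ^+ 2; set P := \sum_i u i * v i.
have A0 : 0 <= A by apply: sumr_ge0 => i _; exact: sqr_ge0.
have [A00|A00] := eqVneq A 0.
  have u0 i : u i = 0.
    apply/eqP; rewrite -sqrf_eq0; move/eqP: A00.
    by rewrite psumr_eq0 => [/allP/(_ i)|j _]; [rewrite mem_index_enum; exact|exact: sqr_ge0].
  by rewrite /P big1 ?expr0n ?A00 ?mul0r// => i _; rewrite u0 mul0r.
have Agt : 0 < A by rewrite lt_neqAle eq_sym A00.
have : 0 <= \sum_i (A * v i - P * u i) ^+ 2 by apply: sumr_ge0 => i _; exact: sqr_ge0.
have -> : \sum_i (A * v i - P * u i) ^+ 2 = A * (A * B - P ^+ 2).
  transitivity (\sum_i (A ^+ 2 * v i ^+ 2 + (- (2 * A * P) * (u i * v i) + P ^+ 2 * u i ^+ 2))).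
    by apply: eq_bigr => i _; ring.
  rewrite !big_split/= -!mulr_sumr -/A -/B -/P; ring.
by rewrite pmulr_rge0// subr_ge0.
Qed.

Lemma norm_sum_le n (u v : 'I_n -> R) :
  `|\sum_i u i * v i| <= Num.sqrt (\sum_i u i ^+ 2) * Num.sqrt (\sum_i v i ^+ 2).
Proof.
have s0 (w : 'I_n -> R) : 0 <= \sum_i w i ^+ 2 by apply: sumr_ge0 => i _; exact: sqr_ge0.
rewrite -sqrtrM// -sqrtr_sqr ler_sqrt ?mulr_ge0//; exact: cauchy_schwarz_sum.
Qed.

Lemma le_norm_sqrt n (u : 'I_n -> R) i : `|u i| <= Num.sqrt (\sum_i u i ^+ 2).
Proof.
rewrite -sqrtr_sqr ler_sqrt ?sumr_ge0//; last by move=> j _; exact: sqr_ge0.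
by rewrite (bigD1 i)//= lerDl sumr_ge0// => j _; exact: sqr_ge0.
Qed.

(* When int p^2 = 1 the terms in [z] cancel after integration. *)
Lemma sub_one_bound c : exists2 z, 0 <= z & forall p, 0 <= p ->
  (p - 1) ^+ 2 + p ^+ 2 + z <= 2 * (p - c) ^+ 2 + z * p ^+ 2 + 1.
Proof.
(* Right side minus left side is [z p^2 + (2 - 4 c) p + 2 c^2 - z]. For [c < 1/2] and [z = 2 c^2] no
   term is negative; otherwise [z = c^2] and completing the square leaves [2 c - 1 <= c^2]. *)
have [c2|c2] := leP (1 / 2) c; last first.
  exists (2 * c ^+ 2) => [|p p0]; first by rewrite mulr_ge0// sqr_ge0.
  have : 0 <= (1 / 2 - c) * p by rewrite mulr_ge0//; lra.
  by have := sqr_ge0 (c * p); lra.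
exists (c ^+ 2) => [|p p0]; first exact: sqr_ge0.
have [c0|c0] := eqVneq c 0; first by lra.
have e : 2 * (p - c) ^+ 2 + c ^+ 2 * p ^+ 2 + 1 - ((p - 1) ^+ 2 + p ^+ 2 + c ^+ 2) =
   (c * p - (2 * c - 1) / c) ^+ 2 + (c ^+ 2 - ((2 * c - 1) / c) ^+ 2).
  by field.
rewrite -subr_ge0 e addr_ge0 ?sqr_ge0// subr_ge0.
have cp : 0 < c by lra.
rewrite ler_pXn2r ?nnegrE//; first by rewrite ler_pdivrMr//; have := sqr_ge0 (c - 1); nra.
- by rewrite divr_ge0//; lra.
- exact: ltW.
Qed.

Lemma mul_ln_le t : 0 <= t -> t * ln t <= t * (t - 1).
Proof.
rewrite le_eqVlt => /orP[/eqP <-|t0]; first by rewrite !mul0r.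
rewrite ler_wpM2l ?(ltW t0)//.
have := @le_ln1Dx R (t - 1); rewrite addrCA subrr addr0; apply; lra.
Qed.

(** Young's inequality for [x^p] and 1 with exponents [1/p] and [1/(1-p)]. *)
Lemma powR_tangent p x : 0 < p -> p <= 1 -> 0 <= x -> x `^ p <= 1 + p * (x - 1).
Proof.
move=> p0 p1 x0; move: p1; rewrite le_eqVlt => /orP[/eqP ->|p1].
  by rewrite powRr1//; lra.
have q0 : 0 < 1 - p by lra.
have := @conjugate_powR R (x `^ p) 1 p^-1 (1 - p)^-1 (powR_ge0 _ _) ler01.
rewrite !invr_gt0 !invrK mulr1 powR1 -powRrM mulfV ?gt_eqF// powRr1// mul1r.
by move=> /(_ p0 q0 ltac:(ring)); lra.
Qed.

(** [F_tau tau] is concave and vanishes at 1, so it lies below its tangent there; the coefficient is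
    its derivative at 1. *)
Lemma F_tau_le tau t : 0 < tau -> tau <= 1 -> 0 <= t ->
  F_tau tau t <= tau * ln 2 `^ (tau - 1) / 2 * (t - 1).
Proof.
move=> tau0 tau1 t0; have ln20 : 0 < ln 2 :> R by rewrite ln_gt0// ltr1n.
have lnt0 : 0 <= ln (1 + t) by rewrite ln_ge0//; lra.
have t2 : ln (1 + t) - ln 2 <= (t - 1) / 2.
  rewrite -ln_div ?posrE//; last lra.
  have -> : (1 + t) / 2 = 1 + (t - 1) / 2 by field.
  apply: le_ln1Dx; lra.
rewrite /F_tau.
have -> : ln (1 + t) = ln 2 * (ln (1 + t) / ln 2) by rewrite mulrCA divff ?mulr1// gt_eqF.
rewrite powRM ?(ltW ln20)//; last by rewrite divr_ge0// ltW.
have h := powR_tangent tau0 tau1 (divr_ge0 lnt0 (ltW ln20)).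
apply: (@le_trans _ _ (ln 2 `^ tau * (tau * (ln (1 + t) / ln 2 - 1)))).
  by have := ler_wpM2l (powR_ge0 (ln 2) tau) h; lra.
rewrite -(mulr_powRB1 (ltW ln20) tau0).
have -> : ln 2 * ln 2 `^ (tau - 1) * (tau * (ln (1 + t) / ln 2 - 1)) =
    tau * ln 2 `^ (tau - 1) * (ln (1 + t) - ln 2) by field; rewrite gt_eqF.
rewrite -[leRHS]mulrA ler_wpM2l ?mulr_ge0 ?powR_ge0 ?(ltW tau0)//; lra.
Qed.

End real_inequalities.

(** * The smoothed potential *)

Section japanese_bracket.
Context {R : realType} {n : nat}.
Implicit Types x : 'rV[R]_n.

Definition jap x : R := Num.sqrt (1 + sqnorm x).

Lemma jap_ge1 x : 1 <= jap x.
Proof.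
rewrite /jap -[leLHS]sqrtr1 ler_sqrt; first by rewrite lerDl sqnorm_ge0.
by have := sqnorm_ge0 x; lra.
Qed.

Lemma jap_gt0 x : 0 < jap x. Proof. by have := jap_ge1 x; lra. Qed.

Lemma jap_sqr x : jap x ^+ 2 = 1 + sqnorm x.
Proof. by rewrite sqr_sqrtr//; have := sqnorm_ge0 x; lra. Qed.

Lemma powR_jap x (b : R) : (1 + sqnorm x) `^ b = jap x `^ (2 * b).
Proof. by rewrite powRrM powR_mulrn ?jap_sqr// ltW// jap_gt0. Qed.

Lemma enorm_ge0 x : 0 <= enorm x. Proof. exact: sqrtr_ge0. Qed.

Lemma enorm_sqr x : enorm x ^+ 2 = sqnorm x.
Proof. by rewrite sqr_sqrtr// sqnorm_ge0. Qed.

Lemma enorm_le_jap x : enorm x <= jap x.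
Proof.
have h := sqnorm_ge0 x.
rewrite /jap ler_sqrt ?lerDr//; lra.
Qed.

Lemma enorm_scale (s : R) x : 0 <= s -> s <= 1 -> enorm (s *: x) <= enorm x.
Proof.
move=> s0 s1; rewrite /enorm ler_sqrt; last exact: sqnorm_ge0.
apply: ler_sum => i _; rewrite mxE exprMn ler_piMl ?sqr_ge0//.
by rewrite expr_le1.
Qed.

Lemma not_cube_jap (r0 : R) x : ~ cube r0 x -> r0 <= jap x.
Proof.
move/existsNP => [i /negP]; rewrite in_itv/= -ler_norml -ltNge => xi.
rewrite ltW// (lt_le_trans xi)// (le_trans _ (enorm_le_jap x))//.
exact: (le_norm_sqrt (fun i => x ord0 i)).
Qed.

Lemma jap_powR_le x (a b : R) : a <= b -> jap x `^ a <= jap x `^ b.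
Proof. by move=> ab; apply: ler_powR => //; exact: jap_ge1. Qed.

Lemma jap_powR_ge1 x (a : R) : 0 <= a -> 1 <= jap x `^ a.
Proof. by move=> a0; rewrite -[leLHS](powRr0 (jap x)) jap_powR_le. Qed.

Lemma continuous_jap : continuous jap.
Proof.
have [cs _ _] := @has_gradient_sqnorm R n.
move=> x; apply: (@continuous_comp _ _ _ (fun x => 1 + sqnorm x) Num.sqrt).
  by apply: continuousD; [exact: cst_continuous|exact: cs].
exact: sqrt_continuous.
Qed.

End japanese_bracket.

Section potential.
Context {R : realType} {n : nat}.
Variables (alpha N C delta : R) (V1 : 'rV[R]_n -> R).
Hypotheses (alpha_gt1 : 1 < alpha) (alpha_le2 : alpha <= 2) (N_gt0 : 0 < N).
Hypotheses (V1_C1 : Cn 1 V1) (C_gt0 : 0 < C) (delta0 : 0 <= delta) (delta1 : delta < 1).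
Hypothesis V1_grad : forall x,
  enorm (gradient V1 x) <= delta * enorm x `^ (alpha - 1) + C.

(* |x|^alpha is also C^1, but at 0 this would need a separate argument. *)
Definition smoothed_potential (x : 'rV[R]_n) : R :=
  N * ((1 + sqnorm x) `^ (alpha / 2) / alpha + V1 x).

Definition smoothed_gradient (i : 'I_n) (x : 'rV[R]_n) : R :=
  N * (jap x `^ (alpha - 2) * x ord0 i + partial i V1 x).

Local Notation W := smoothed_potential.
Local Notation gW := smoothed_gradient.

Let alpha0 : 0 < alpha. Proof. exact: lt_trans ltr01 alpha_gt1. Qed.

Let facts : [/\ 1 < alpha, alpha <= 2, 0 < N, 0 < C & 0 <= delta < 1].
Proof. by split => //; rewrite delta0 delta1. Qed.

Lemma has_gradient_smoothed : has_gradient W gW.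
Proof.
have pos (x : 'rV[R]_n) : 0 < 1 + sqnorm x by have := sqnorm_ge0 x; lra.
have h : has_gradient (fun x : 'rV[R]_n => 1 + sqnorm x) (fun i x => 2 * x ord0 i).
  apply: has_gradient_ext (has_gradientD (has_gradient_cst 1) has_gradient_sqnorm) => i x.
  by rewrite add0r.
have h1 := has_gradient_comp (phi := fun s => s `^ (alpha / 2))
   (dphi := fun s => alpha / 2 * s `^ (alpha / 2 - 1)) h
   (fun x => is_derive1_powR (alpha / 2) (pos x)).
have h2 : has_gradient (fun x : 'rV[R]_n => (1 + sqnorm x) `^ (alpha / 2))
    (fun i x => alpha / 2 * (1 + sqnorm x) `^ (alpha / 2 - 1) * (2 * x ord0 i)).
  apply: h1 => x; apply: continuousM; first exact: cvg_cst.
  exact: continuous_powR_gt0.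
apply: has_gradient_ext (has_gradientM (has_gradient_cst N)
  (has_gradientD (has_gradientM h2 (has_gradient_cst alpha^-1)) (has_gradient_Cn V1_C1))) => i x.
rewrite /gW (powR_jap x (alpha / 2 - 1)) (_ : 2 * (alpha / 2 - 1) = alpha - 2); last by field.
by field; rewrite gt_eqF.
Qed.

Lemma partial_le i x : `|partial i V1 x| <= delta * enorm x `^ (alpha - 1) + C.
Proof.
have [a1 a2 hN hC /andP[d0 d1]] := facts.
apply: le_trans (V1_grad x).
have := le_norm_sqrt (fun i => partial i V1 x) i.
rewrite /enorm (eq_bigr (fun i => gradient V1 x ord0 i ^+ 2))// => j _.
by rewrite mxE.
Qed.

(** Direction and base point are kept apart: they coincide in the radial estimate, while the growth
    of [V1] evaluates the gradient at intermediate points of the segment from 0 to [x]. *)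
Lemma radial_le (x y : 'rV[R]_n) : `|\sum_i x ord0 i * partial i V1 y| <=
  enorm x * (delta * enorm y `^ (alpha - 1) + C).
Proof.
apply: (le_trans (norm_sum_le (fun i => x ord0 i) (fun i => partial i V1 y))).
apply: ler_wpM2l; first exact: enorm_ge0.
apply: le_trans (V1_grad y).
by rewrite /enorm (eq_bigr (fun i => gradient V1 y ord0 i ^+ 2))// => j _; rewrite mxE.
Qed.

Lemma enorm_powR_le (x : 'rV[R]_n) p : 0 <= p -> enorm x `^ p <= jap x `^ p.
Proof. by move=> p0; apply: ge0_le_powR => //; [exact: enorm_ge0|exact: enorm_le_jap]. Qed.

Lemma smoothed_grad_le : exists2 K, 0 <= K &
  forall i x, `|gW i x| <= K * jap x `^ (alpha - 1).
Proof.
have [a1 a2 hN hC /andP[d0 d1]] := facts.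
exists (N * (1 + delta + C)); first by rewrite mulr_ge0 ?ltW//; lra.
move=> i x; rewrite /gW normrM (ger0_norm (ltW N_gt0)) -mulrA ler_pM2l//.
apply: (le_trans (ler_normD _ _)).
have h1 : `|jap x `^ (alpha - 2) * x ord0 i| <= jap x `^ (alpha - 1).
  rewrite normrM ger0_norm ?powR_ge0// (_ : alpha - 1 = alpha - 2 + 1); last by ring.
  rewrite (@powRD _ _ (alpha - 2) 1); last by rewrite (gt_eqF (jap_gt0 x)) implybT.
  rewrite ler_wpM2l ?powR_ge0// powRr1; last by rewrite ltW ?jap_gt0.
  exact: le_trans (le_norm_sqrt (fun i => x ord0 i) i) (enorm_le_jap x).
have h2 := partial_le i x.
have h3 : enorm x `^ (alpha - 1) <= jap x `^ (alpha - 1) by apply: enorm_powR_le; lra.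
have h4 : 1 <= jap x `^ (alpha - 1) by apply: jap_powR_ge1; lra.
by nra.
Qed.

Lemma V1_growth : exists2 K, 0 <= K & forall x, `|V1 x| <= K * jap x `^ alpha.
Proof.
have [a1 a2 hN hC /andP[d0 d1]] := facts.
exists (`|V1 0| + delta + C) => [|x]; first by have := normr_ge0 (V1 0); lra.
have h : `|V1 x - V1 0| <= enorm x * (delta * enorm x `^ (alpha - 1) + C).
  have [dV cV] := V1_C1.
  (* The derivative along the arbitrary direction [x] comes from the differentiability in [Cn 1], by
     linearity of the differential. *)
  have dphi (s : R) : is_derive s (1 : R) (fun s => V1 (s *: x))
      (\sum_i x ord0 i * partial i V1 (s *: x)).
    have -> : \sum_i x ord0 i * partial i V1 (s *: x) = 'D_x V1 (s *: x).
      move: (s *: x) => y; rewrite deriveE// [in RHS](row_sum_delta x) linear_sum/=.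
      by apply: eq_bigr => i _; rewrite linearZ/= /partial deriveE.
    apply: is_derive_along (derivableP (diff_derivable (v := x) (dV (s *: x)))) => h.
    by rewrite [_%:A]mulr1 scalerDl.
  have cphi : {within `[0, 1], continuous (fun s : R => V1 (s *: x))}.
    apply: continuous_subspaceT => s.
    exact/differentiable_continuous/derivable1_diffP.
  have [c] := MVT_segment ler01 (fun s _ => dphi s) cphi.
  rewrite in_itv/= => /andP[c0 c1]; rewrite scale1r scale0r subr0 mulr1 => ->.
  apply: (le_trans (radial_le _ _)); rewrite ler_wpM2l ?enorm_ge0// lerD2r ler_wpM2l//.
  by apply: ge0_le_powR; [lra|exact: enorm_ge0|exact: enorm_scale].
have h1 : enorm x * enorm x `^ (alpha - 1) <= jap x `^ alpha.
  by rewrite mulr_powRB1 ?enorm_ge0// enorm_powR_le// ltW.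
have h2 : enorm x <= jap x `^ alpha.
  apply: (le_trans (enorm_le_jap x)); rewrite -[leLHS]powRr1; last exact: ltW (jap_gt0 x).
  by apply: jap_powR_le; lra.
have h3 := jap_powR_ge1 x (ltW alpha0).
have := lerB_dist (V1 x) (V1 0).
have := normr_ge0 (V1 0).
have := ler_wpM2l delta0 h1; have := ler_wpM2l (ltW C_gt0) h2.
by nra.
Qed.

Lemma smoothed_growth : exists2 K, 0 <= K & forall x, `|W x| <= K * jap x `^ alpha.
Proof.
have [a1 a2 hN hC /andP[d0 d1]] := facts.
have [K K0 KP] := V1_growth; exists (N * (alpha^-1 + K)).
  by rewrite mulr_ge0 ?addr_ge0 ?invr_ge0// ltW.
move=> x; rewrite /W normrM (ger0_norm (ltW N_gt0)) -mulrA ler_pM2l//.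
apply: (le_trans (ler_normD _ _)); rewrite mulrDl; apply: lerD; last exact: KP.
rewrite ger0_norm; last by rewrite divr_ge0 ?powR_ge0// ltW.
rewrite powR_jap (_ : 2 * (alpha / 2) = alpha); last by field.
by rewrite mulrC.
Qed.

(** The unperturbed part gives [r^(alpha - 2) |x|^2 = r^alpha - r^(alpha - 2) >= r^alpha - 1], and
    [V1] takes away at most [delta r^alpha + C r]. Half of the gap [1 - delta] absorbs [C r], the
    other half is [a0 / N]. *)
Lemma smoothed_radial : exists a0 b0, [/\ 0 < a0, 0 <= b0 &
  forall x, a0 * jap x `^ alpha - b0 <= \sum_i x ord0 i * gW i x].
Proof.
have [a1 a2 hN hC /andP[d0 d1]] := facts.
have dC : 0 < (1 - delta) / 2 / C by rewrite !divr_gt0//; lra.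
have [K K0 KP] := @powR_absorb R 1 alpha _ ler01 alpha_gt1 dC.
exists (N * ((1 - delta) / 2)), (N * (1 + C * K)); split.
- by rewrite mulr_gt0//; lra.
- by rewrite mulr_ge0 ?addr_ge0 ?mulr_ge0// ltW.
move=> x.
have -> : \sum_i x ord0 i * gW i x =
    N * (jap x `^ (alpha - 2) * sqnorm x + \sum_i x ord0 i * partial i V1 x).
  rewrite /sqnorm mulr_sumr -big_split/= mulr_sumr; apply: eq_bigr => i _.
  by rewrite /gW; ring.
rewrite -mulrA -mulrBr ler_pM2l//.
have h1 : jap x `^ (alpha - 2) * sqnorm x = jap x `^ alpha - jap x `^ (alpha - 2).
  rewrite (_ : sqnorm x = jap x ^+ 2 - 1); last by rewrite jap_sqr; ring.
  rewrite mulrBr mulr1; congr (_ - _).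
  rewrite -powR_mulrn ?ltW ?jap_gt0// -powRD; first by congr (_ `^ _); ring.
  by rewrite (gt_eqF (jap_gt0 x)) implybT.
have h2 : jap x `^ (alpha - 2) <= 1.
  by rewrite -[leRHS](powRr0 (jap x)) jap_powR_le//; lra.
have h3 := radial_le x x.
have h4 : enorm x * enorm x `^ (alpha - 1) <= jap x `^ alpha.
  by rewrite mulr_powRB1 ?enorm_ge0// enorm_powR_le// ltW.
have h5 := enorm_le_jap x.
have h6 := KP (jap x) (ltW (jap_gt0 x)).
rewrite powRr1 in h6; last by rewrite ltW ?jap_gt0.
have h7 : C * jap x <= (1 - delta) / 2 * jap x `^ alpha + C * K.
  have := ler_wpM2l (ltW C_gt0) h6.
  have -> : C * ((1 - delta) / 2 / C * jap x `^ alpha + K) =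
    (1 - delta) / 2 * jap x `^ alpha + C * K by field; rewrite gt_eqF.
  by [].
have h8 := ler_wpM2l delta0 h4.
have h9 := ler_wpM2l (ltW C_gt0) h5.
move: h3; rewrite ler_norml => /andP[h3 _].
by rewrite h1; lra.
Qed.

(** The power [alpha / 2 <= 1] is subadditive, so smoothing raises the potential by at most
    [N / alpha <= N]. Hence the factor [expR N] between the two densities. *)
Lemma smoothed_le (V : 'rV[R]_n -> R) :
  (forall x, V x = N * (enorm x `^ alpha / alpha + V1 x)) ->
  forall x, V x <= W x /\ W x <= V x + N.
Proof.
have [a1 a2 hN hC /andP[d0 d1]] := facts.
move=> VE x; rewrite VE /W.
have a20 : 0 <= alpha / 2 by lra.
have e1 : enorm x `^ alpha = sqnorm x `^ (alpha / 2).
  by rewrite -enorm_sqr -powR_mulrn ?enorm_ge0// -powRrM; congr (_ `^ _); field.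
have h1 : sqnorm x `^ (alpha / 2) <= (1 + sqnorm x) `^ (alpha / 2).
  by apply: ge0_le_powR => //; [exact: sqnorm_ge0|rewrite lerDr].
have h2 : (1 + sqnorm x) `^ (alpha / 2) <= 1 + sqnorm x `^ (alpha / 2).
  apply: (le_trans (powR_subadditive _ _ _ _)) => //; [lra|exact: sqnorm_ge0|].
  by rewrite powR1.
have ai : 0 < alpha^-1 by rewrite invr_gt0.
have ai1 : alpha^-1 <= 1 by rewrite invf_le1// ltW.
rewrite e1; split.
  by rewrite ler_pM2l// lerD2r ler_pM2r.
rewrite -[X in _ <= _ + X](mulr1 N) -mulrDr ler_pM2l//.
by have := ler_wpM2r (ltW ai) h2; rewrite mulrDl; lra.
Qed.

End potential.

Section nonneg_integrals.
Context d (T : measurableType d) (R : realType) (mu : {measure set T -> \bar R}).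
Implicit Types F G H : T -> R.
Local Open Scope ereal_scope.

Lemma le_integral_ge0 (D : set T) F G : measurable D ->
  measurable_fun setT F -> measurable_fun setT G ->
  (forall x, D x -> 0 <= F x)%R -> (forall x, D x -> F x <= G x)%R ->
  \int[mu]_(x in D) (F x)%:E <= \int[mu]_(x in D) (G x)%:E.
Proof.
move=> mD mF mG F0 FG; apply: ge0_le_integral => //.
- by apply/measurable_EFinP; exact: measurable_funTS.
- by apply/measurable_EFinP; exact: measurable_funTS.
Qed.

Lemma integralZ_ge0 (D : set T) (a : R) F : measurable D -> measurable_fun setT F ->
  (forall x, 0 <= F x)%R -> (0 <= a)%R ->
  \int[mu]_(x in D) (a * F x)%:E = a%:E * \int[mu]_(x in D) (F x)%:E.
Proof.
move=> mD mF F0 a0; under eq_integral do rewrite EFinM.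
rewrite ge0_integralZl//.
- by apply/measurable_EFinP; exact: measurable_funTS.
- by move=> x _; rewrite lee_fin.
Qed.

Lemma integralD_ge0 F G : measurable_fun setT F -> measurable_fun setT G ->
  (forall x, 0 <= F x)%R -> (forall x, 0 <= G x)%R ->
  \int[mu]_x (F x + G x)%:E = \int[mu]_x (F x)%:E + \int[mu]_x (G x)%:E.
Proof.
move=> mF mG F0 G0; under eq_integral do rewrite EFinD.
rewrite ge0_integralD//.
- by move=> x _; rewrite lee_fin.
- exact/measurable_EFinP.
- by move=> x _; rewrite lee_fin.
- exact/measurable_EFinP.
Qed.

Lemma integral_indic_ge0 (D : set T) F : measurable D ->
  \int[mu]_x (F x * \1_D x)%:E = \int[mu]_(x in D) (F x)%:E.
Proof.
move=> mD; rewrite [RHS]integral_mkcond; apply: eq_integral => x _.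
by rewrite patchE indicE; case: ifPn => _; rewrite ?mulr1 ?mulr0.
Qed.

Lemma integral_lin_le (a b u v : R) F G H :
  measurable_fun setT F -> measurable_fun setT G -> measurable_fun setT H ->
  (forall x, 0 <= F x)%R -> (forall x, 0 <= G x)%R -> (forall x, 0 <= H x)%R ->
  (0 <= a)%R -> (0 <= b)%R -> (forall x, H x <= a * F x + b * G x)%R ->
  \int[mu]_x (F x)%:E <= u%:E -> \int[mu]_x (G x)%:E <= v%:E ->
  \int[mu]_x (H x)%:E <= (a * u + b * v)%:E.
Proof.
move=> mF mG mH F0 G0 H0 a0 b0 HFG Fu Gv.
have maF : measurable_fun setT (fun x => a * F x)%R by exact: measurable_funM.
have mbG : measurable_fun setT (fun x => b * G x)%R by exact: measurable_funM.
apply: (@le_trans _ _ (\int[mu]_x (a * F x + b * G x)%:E)).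
  by apply: le_integral_ge0 => //; exact: measurable_funD.
rewrite integralD_ge0//; last 2 first.
- by move=> x; rewrite mulr_ge0.
- by move=> x; rewrite mulr_ge0.
rewrite !integralZ_ge0// EFinD; apply: leeD.
- by rewrite EFinM lee_wpmul2l// lee_fin.
- by rewrite EFinM lee_wpmul2l// lee_fin.
Qed.

End nonneg_integrals.

(** * Inequalities for the weighted measure *)

Section weighted_measure.
Context {R : realType} {n : nat}.
Local Notation lebn := (@lebesgue_rV R n).
Variables (mu : {measure set 'rV[R]_n -> \bar R}).
Variables (W : 'rV[R]_n -> R) (gW : 'I_n -> 'rV[R]_n -> R) (KN : R).
Hypothesis hW : has_gradient W gW.
Hypothesis KN0 : 0 < KN.
Local Open Scope ereal_scope.
Local Notation U F := (\int[mu]_x (F x)%:E).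
Hypothesis mu_ge : forall F : 'rV[R]_n -> R, measurable_fun setT F -> (forall x, 0 <= F x)%R ->
  \int[lebn]_x (F x * expR (- W x))%:E <= U F.
Hypothesis mu_le : forall F : 'rV[R]_n -> R, measurable_fun setT F -> (forall x, 0 <= F x)%R ->
  U F <= KN%:E * \int[lebn]_x (F x * expR (- W x))%:E.

Let mew : measurable_fun setT (fun x => expR (- W x)).
Proof. exact: has_gradient_measurable (has_gradient_expRN hW). Qed.

Lemma divergence_mu (w A B : 'rV[R]_n -> R) gw (b : R) : has_gradient w gw ->
  (forall x, 0 <= w x)%R -> measurable_fun setT A -> measurable_fun setT B ->
  (forall x, 0 <= A x)%R -> (forall x, 0 <= B x)%R -> (b <= 0)%R ->
  (forall x, A x + (1 + sqnorm x) `^ b *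
    (n%:R * w x + \sum_i x ord0 i * gw i x - w x * \sum_i x ord0 i * gW i x) <= B x)%R ->
  U A <= KN%:E * U B.
Proof.
move=> hw w0 mA mB A0 B0 b0 AB.
apply: (le_trans (mu_le mA A0)); rewrite lee_wpmul2l ?lee_fin ?(ltW KN0)//.
apply: (le_trans _ (mu_ge mB B0)).
exact: (@integral_divergence_le _ _ W w gW gw A B b).
Qed.

(** The entropy bound for [u = w e^-W] with [m = 1], for which [m * lnp m] vanishes: normalizing the
    mass is what removes the zero-order term. *)
Lemma entropy_mu (w : 'rV[R]_n -> R) gw : has_gradient w gw ->
  (forall x, 0 <= w x)%R -> U w <= 1 ->
  U (fun x => w x * lnp (w x * expR (- W x)))%R <=
  KN%:E * U (fun x => \sum_i (`|gw i x| + w x * `|gW i x|))%R.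
Proof.
move=> hw w0 w1.
have mw := has_gradient_measurable hw.
have hu := has_gradientM hw (has_gradient_expRN hW).
have mu' := has_gradient_measurable hu.
have msum : measurable_fun setT (fun x => \sum_i (`|gw i x| + w x * `|gW i x|))%R.
  apply: measurable_sum => i; apply: measurable_funD.
    by apply: measurableT_comp => //; exact: has_gradient_measurable_grad hw.
  apply: measurable_funM => //; apply: measurableT_comp => //.
  exact: has_gradient_measurable_grad hW.
have sum0 x : (0 <= \sum_i (`|gw i x| + w x * `|gW i x|))%R.
  by apply: sumr_ge0 => i _; rewrite addr_ge0// mulr_ge0.
apply: (le_trans (mu_le _ _)).
- by apply: measurable_funM => //; exact: (measurableT_comp measurable_lnp).
- by move=> x; rewrite mulr_ge0// lnp_ge0.
rewrite lee_wpmul2l ?lee_fin ?(ltW KN0)//.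
apply: (le_trans _ (mu_ge msum sum0)).
have u0 x : (0 <= w x * expR (- W x))%R by rewrite mulr_ge0// expR_ge0.
have u1 : \int[lebn]_x (w x * expR (- W x))%:E <= 1%:E.
  exact: le_trans (mu_ge mw w0) w1.
have := integral_lnp_le hu u0 ler01 u1.
rewrite lnp_le1// mulr0 add0e => h.
apply: (le_trans _ (le_trans h _)).
  rewrite le_eqVlt; apply/orP; left; apply/eqP; apply: eq_integral => x _.
  by congr (_%:E); ring.
have mgi i : measurable_fun setT (fun x : 'rV[R]_n =>
   `|w x * - (expR (- W x) * gW i x) + expR (- W x) * gw i x|%:E).
  apply/measurable_EFinP; apply: measurableT_comp => //.
  exact: (has_gradient_measurable_grad i hu).
rewrite -ge0_integral_sum//.
apply: ge0_le_integral => //.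
- by move=> x _; apply: sume_ge0.
- exact: emeasurable_sum.
- by apply/measurable_EFinP; exact: measurable_funM.
- move=> x _; rewrite sumEFin lee_fin mulr_suml; apply: ler_sum => i _.
  apply: (le_trans (ler_normD _ _)).
  by rewrite mulrN normrN !normrM !(ger0_norm (expR_ge0 _)) (ger0_norm (w0 x)); lra.
Qed.

(** The weight [r^(alpha - 2)] is chosen so that the radial term becomes [r^(2 alpha - 2)] and
    completing the square leaves the gradient unweighted. Since [r^(2 alpha - 2)] tends to infinity,
    the mass of [(f - c)^2] outside a large cube is controlled by the mass inside. There [e^-W] is
    bounded from both sides, and the cube supplies [c]. *)
Lemma poincare_mu (a0 b0 alpha : R) : (1 < alpha)%R -> (alpha <= 2)%R ->
  (0 < a0)%R -> (0 <= b0)%R ->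
  (forall x, a0 * jap x `^ alpha - b0 <= \sum_i x ord0 i * gW i x)%R ->
  exists2 K, (0 < K)%R & forall f g (eps : R), has_gradient f g -> (0 < eps)%R ->
  exists c : R, U (fun x => (f x - c) ^+ 2)%R <=
    K%:E * U (fun x => \sum_i g i x ^+ 2)%R + eps%:E.
Proof.
move=> al1 al2 a00 b00 rad.
(* Once [r^(2 alpha - 2)] is at least [M], half of the radial coefficient exceeds [n + b0] by at
   least 1. *)
pose M := ((1 + n%:R + b0) * 2 / a0)%R.
have M0 : (0 <= M)%R by rewrite /M divr_ge0 ?(ltW a00)// mulr_ge0// !addr_ge0.
have [r1 r1P] := @powR_large R (2 * alpha - 2) M ltac:(lra) M0.
pose r0 := Num.max 1%R r1.
have r00 : (0 < r0)%R by rewrite lt_max ltr01.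
have [KQ [KQ0 KQP]] := @cube_poincare R n r0 r00.
have [Mb [Mb0 MbP]] := bounded_cube r0 (let: And3 h _ _ := hW in h).
have mQ := @measurable_cube R n r0.
pose e := expR Mb; have e0 : (0 < e)%R by exact: expR_gt0.
have We x : cube r0 x -> (e^-1 <= expR (- W x) <= e)%R.
  move=> /MbP; rewrite ler_norml => /andP[h1 h2].
  by rewrite -expRN !ler_expR; apply/andP; split; lra.
(* [L] counts the mass in the cube, once for itself and [KN * (n%:R + b0)] times for the outer mass
   it controls; [eps'] is scaled so that the final error is [eps]. *)
pose L := (KN * (n%:R + b0) + 1)%R.
have L0 : (0 < L)%R.
  by apply: ltr_wpDl => //; rewrite mulr_ge0 ?(ltW KN0)// addr_ge0.
pose K := (L * (KN * e * KQ * e) + KN * (2 / a0))%R.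
have K0 : (0 < K)%R.
  apply: ltr_wpDl; last by rewrite mulr_gt0 ?divr_gt0.
  by apply/ltW; rewrite !mulr_gt0.
exists K => //.
move=> f g eps fg eps0.
pose eps' := (eps / (L * (KN * e)))%R.
have eps'0 : (0 < eps')%R by rewrite divr_gt0// !mulr_gt0.
have [c cP] := KQP f g eps' fg eps'0; exists c.
pose G x := (\sum_i g i x ^+ 2)%R; rewrite -/G.
have G0 x : (0 <= G x)%R by apply: sumr_ge0 => i _; exact: sqr_ge0.
have mG : measurable_fun setT G.
  by apply: measurable_sum => i; apply: measurable_funX; exact: has_gradient_measurable_grad fg.
have [Uoo|Uoo] := eqVneq (U G) +oo.
  by rewrite Uoo gt0_muley ?addye ?leey.
pose u := fine (U G).
have UG0 : 0 <= U G by apply: integral_ge0 => x _; rewrite lee_fin.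
have uE : U G = u%:E by rewrite fineK// ge0_fin_numE// lt_neqAle Uoo leey.
have u0 : (0 <= u)%R by exact: fine_ge0.
have hh : has_gradient (fun x => f x - c)%R g.
  apply: has_gradient_ext (has_gradientD fg (has_gradient_cst (- c)%R)) => i x.
  by rewrite addr0.
pose h x := (f x - c)%R.
have mh : measurable_fun setT h := has_gradient_measurable hh.
have mh2 : measurable_fun setT (fun x => h x ^+ 2)%R by exact: measurable_funX.
have h20 x : (0 <= h x ^+ 2)%R by exact: sqr_ge0.
have m1Q : measurable_fun setT (\1_(cube r0) : 'rV[R]_n -> R) by exact: measurable_indic.
have ind0 (D : set 'rV[R]_n) x : (0 <= \1_D x :> R)%R by rewrite indicE.
have QG : \int[lebn]_(x in cube r0) (G x)%:E <= (e * u)%:E.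
  rewrite -integral_indic_ge0//.
  apply: (@le_trans _ _ (\int[lebn]_x (e * (G x * expR (- W x)))%:E)).
    apply: le_integral_ge0 => //.
    - exact: measurable_funM.
    - by apply: measurable_funM => //; exact: measurable_funM.
    - by move=> x _; rewrite mulr_ge0.
    - move=> x _; rewrite indicE; case: (boolP (x \in _)) => [/[!inE] xQ|_].
        have /andP[ex _] := We _ xQ; rewrite mulr1 mulrCA ler_peMr//.
        by rewrite -(mulfV (lt0r_neq0 e0)) ler_wpM2l// ltW.
      by rewrite mulr0 !mulr_ge0 ?expR_ge0// ltW.
  rewrite integralZ_ge0//; last 3 first.
  - exact: measurable_funM.
  - by move=> x; rewrite mulr_ge0 ?expR_ge0.
  - exact: ltW.
  by rewrite EFinM -uE lee_wpmul2l ?lee_fin ?(ltW e0)// mu_ge.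
pose q := (KN * (e * (KQ * (e * u) + eps')))%R.
have q0 : (0 <= q)%R.
  apply: mulr_ge0; first exact: ltW.
  apply: mulr_ge0; first exact: ltW.
  apply: addr_ge0; last exact: ltW.
  by apply: mulr_ge0; [exact: ltW|rewrite mulr_ge0// ltW].
have Qh : U (fun x => h x ^+ 2 * \1_(cube r0) x)%R <= q%:E.
  apply: (le_trans (mu_le _ _)).
  - exact: measurable_funM.
  - by move=> x; rewrite mulr_ge0.
  rewrite /q EFinM lee_wpmul2l ?lee_fin ?(ltW KN0)//.
  apply: (@le_trans _ _ (\int[lebn]_x (e * (h x ^+ 2 * \1_(cube r0) x))%:E)).
    apply: le_integral_ge0 => //.
    - by apply: measurable_funM => //; exact: measurable_funM.
    - by apply: measurable_funM => //; exact: measurable_funM.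
    - by move=> x _; rewrite mulr_ge0 ?expR_ge0// mulr_ge0.
    - move=> x _; rewrite indicE; case: (boolP (x \in _)) => [/[!inE] xQ|_].
        have /andP[_ ex] := We _ xQ; rewrite mulr1 mulrC.
        by rewrite ler_wpM2r.
      by rewrite !(mulr0, mul0r).
  rewrite integralZ_ge0//; last 3 first.
  - exact: measurable_funM.
  - by move=> x; rewrite mulr_ge0.
  - exact: ltW.
  rewrite EFinM lee_wpmul2l ?lee_fin ?(ltW e0)// integral_indic_ge0//.
  apply: (le_trans cP); rewrite EFinD leeD2r// EFinM lee_wpmul2l// lee_fin.
  exact: ltW.
pose A x := (h x ^+ 2 * \1_(~` cube r0) x)%R.
have mA : measurable_fun setT A.
  by apply: measurable_funM => //; apply: measurable_indic; exact: measurableC.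
have A0 x : (0 <= A x)%R by rewrite mulr_ge0.
pose B x := ((n%:R + b0) * (h x ^+ 2 * \1_(cube r0) x) + 2 / a0 * G x)%R.
have mB : measurable_fun setT B.
  by apply: measurable_funD; apply: measurable_funM => //; exact: measurable_funM.
have B0 x : (0 <= B x)%R.
  by rewrite addr_ge0// mulr_ge0// ?divr_ge0 ?(ltW a00)// ?addr_ge0// mulr_ge0.
have UB : U B <= ((n%:R + b0) * q + 2 / a0 * u)%:E.
  apply: (@integral_lin_le _ _ _ mu _ _ _ _ (fun x => h x ^+ 2 * \1_(cube r0) x)%R G) => //.
  - exact: measurable_funM.
  - by move=> x; rewrite mulr_ge0.
  - by rewrite addr_ge0.
  - by rewrite divr_ge0// ltW.
  - by rewrite uE.
have AB x : (A x + (1 + sqnorm x) `^ ((alpha - 2) / 2) *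
    (n%:R * (h x * h x) + \sum_i x ord0 i * (h x * g i x + h x * g i x) -
     h x * h x * \sum_i x ord0 i * gW i x) <= B x)%R.
  rewrite powR_jap (_ : 2 * ((alpha - 2) / 2) = alpha - 2)%R; last by field.
  set J := (jap x `^ (alpha - 2))%R.
  have J0 : (0 <= J)%R by exact: powR_ge0.
  have J1 : (J <= 1)%R by rewrite -(powRr0 (jap x)) jap_powR_le//; lra.
  have jx := jap_gt0 x.
  pose r := (jap x `^ (alpha - 1))%R.
  have r0' : (0 <= r)%R by exact: powR_ge0.
  have rE : (J * jap x = r)%R.
    rewrite /J /r -[X in (_ * X)%R](powRr1 (ltW jx)) -powRD ?(gt_eqF jx) ?implybT//.
    by congr (_ `^ _)%R; ring.
  have r2 : (J * jap x `^ alpha = r ^+ 2)%R.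
    rewrite /J /r expr2 -!powRD ?(gt_eqF jx) ?implybT//.
    by congr (_ `^ _)%R; ring.
  have radx := rad x.
  have cs : (`|\sum_i x ord0 i * g i x| <= jap x * Num.sqrt (G x))%R.
    apply: (le_trans (norm_sum_le (fun i => x ord0 i) (fun i => g i x))).
    by rewrite ler_wpM2r ?sqrtr_ge0//; exact: enorm_le_jap.
  have sG : (Num.sqrt (G x) ^+ 2 = G x)%R by rewrite sqr_sqrtr.
  have := sqrtr_ge0 (G x); move: cs sG; set s := Num.sqrt (G x) => cs sG s0.
  have -> : (\sum_i x ord0 i * (h x * g i x + h x * g i x) =
      2 * h x * \sum_i x ord0 i * g i x)%R.
    by rewrite mulr_sumr; apply: eq_bigr => i _; ring.
  set sg := (\sum_i x ord0 i * g i x)%R in cs *.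
  set sW := (\sum_i x ord0 i * gW i x)%R in radx *.
  have hsg : (J * (2 * h x * sg) <= a0 / 2 * (h x ^+ 2 * r ^+ 2) + 2 / a0 * G x)%R.
    apply: (le_trans (ler_norm _)); rewrite !normrM (ger0_norm J0) (ger0_norm (ler0n _ 2)).
    apply: (@le_trans _ _ (2 * `|h x| * (r * s))%R).
      rewrite -rE -mulrA mulrCA [leRHS](_ : _ = 2 * `|h x| * (J * (jap x * s)))%R; last by ring.
      by rewrite [leLHS](_ : _ = 2 * `|h x| * (J * `|sg|))%R ?ler_wpM2l ?mulr_ge0//; ring.
    rewrite -(real_normK (num_real (h x))) -sG -subr_ge0.
    rewrite (_ : _ - _ = a0 / 2 * (`|h x| * r - 2 / a0 * s) ^+ 2)%R; last first.
      by field; rewrite gt_eqF.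
    by rewrite mulr_ge0 ?sqr_ge0// divr_ge0// ltW.
  have hW' : (J * (h x * h x * sW) >= h x ^+ 2 * (a0 * r ^+ 2 - b0))%R.
    have := ler_wpM2l (mulr_ge0 J0 (h20 x)) radx.
    have : (J * (h x ^+ 2 * b0) <= 1 * (h x ^+ 2 * b0))%R by rewrite ler_wpM2r// mulr_ge0.
    by rewrite -r2 -expr2; lra.
  have hn : (J * (n%:R * (h x * h x)) <= n%:R * h x ^+ 2)%R.
    by rewrite -expr2 ler_piMl// mulr_ge0.
  (* Outside the cube the choice of [M] makes the coefficient of [h x ^+ 2] at least 1; inside, [A]
     vanishes and the first term compensates a negative coefficient. *)
  have rQ : (A x <= (n%:R + b0) * (h x ^+ 2 * \1_(cube r0) x) +
     (a0 / 2 * r ^+ 2 - n%:R - b0) * h x ^+ 2)%R.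
    rewrite /A !indicE in_setC; case: (boolP (x \in cube r0)) => /= xQ.
      rewrite mulr0 mulr1.
      have : (0 <= a0 / 2 * (r ^+ 2 * h x ^+ 2))%R.
        by rewrite mulr_ge0 ?divr_ge0 ?(ltW a00)// mulr_ge0// sqr_ge0.
      by lra.
    rewrite mulr0 mulr1 mulr0 add0r ler_peMl//.
    move: xQ; rewrite notin_setE => /not_cube_jap.
    rewrite /r0 ge_max => /andP[_ /r1P].
    have -> : (jap x `^ (2 * alpha - 2) = r ^+ 2)%R.
      rewrite /r expr2 -!powRD ?(gt_eqF jx) ?implybT//.
      by congr (_ `^ _)%R; ring.
    rewrite /M ler_pdivrMr//; lra.
  by rewrite /B; lra.
have UA : U A <= (KN * ((n%:R + b0) * q + 2 / a0 * u))%:E.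
  apply: (le_trans (@divergence_mu (fun x => h x * h x)%R A B _ _
    (has_gradientM hh hh) _ mA mB A0 B0 _ AB)).
  - by move=> x; rewrite -expr2.
  - by lra.
  - by rewrite EFinM lee_wpmul2l// lee_fin ltW.
have := @integral_lin_le _ _ _ mu 1 1 _ _ A (fun x => h x ^+ 2 * \1_(cube r0) x)%R
   (fun x => h x ^+ 2)%R mA _ mh2 A0 _ h20 ler01 ler01 _ UA Qh.
rewrite !mul1r uE -EFinM -EFinD => H; apply: (le_trans (H _ _ _)).
- exact: measurable_funM.
- by move=> x; rewrite mulr_ge0.
- move=> x; rewrite /A !indicE in_setC !mul1r; case: (x \in cube r0) => /=.
    by rewrite mulr0 mulr1 add0r.
  by rewrite mulr1 mulr0 addr0.
rewrite lee_fin le_eqVlt; apply/orP; left; apply/eqP.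
by rewrite /q /K /eps' /L; field; rewrite !lt0r_neq0.
Qed.

End weighted_measure.

(** * Normalized functions and tails *)

Section uniform_bounds.
Context d (T : measurableType d) (R : realType) (mu : {measure set T -> \bar R}).
Context (J : Type) (E : J -> \bar R).
Implicit Types F G : J -> T -> R.

(** The constant is quantified before [j], so that it is the same for all test functions; [E j] is
    the energy on the right-hand side. Measurability and positivity are bundled so that such bounds
    can be added, scaled and compared. *)
Definition uniformly_bounded F : Prop :=
  [/\ forall j, measurable_fun setT (F j), forall j x, 0 <= F j x &
      exists2 c, 0 <= c & forall j, (\int[mu]_x (F j x)%:E <= c%:E * E j)%E].

Lemma uniformly_bounded_le F G : (forall j, measurable_fun setT (F j)) ->
  (forall j x, 0 <= F j x) -> (forall j x, F j x <= G j x) ->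
  uniformly_bounded G -> uniformly_bounded F.
Proof.
move=> mF F0 FG [mG G0 [c c0 cG]]; split => //; exists c => // j.
by apply: le_trans (cG j); exact: le_integral_ge0.
Qed.

Lemma uniformly_boundedD F G : uniformly_bounded F -> uniformly_bounded G ->
  uniformly_bounded (fun j x => F j x + G j x).
Proof.
move=> [mF F0 [a a0 aF]] [mG G0 [b b0 bG]]; split.
- by move=> j; exact: measurable_funD.
- by move=> j x; rewrite addr_ge0.
exists (a + b) => [|j]; first by rewrite addr_ge0.
rewrite integralD_ge0// EFinD ge0_muleDl ?lee_fin//.
exact: leeD.
Qed.

Lemma uniformly_boundedZ (k : R) F : 0 <= k -> uniformly_bounded F ->
  uniformly_bounded (fun j x => k * F j x).
Proof.
move=> k0 [mF F0 [a a0 aF]]; split.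
- by move=> j; exact: measurable_funM.
- by move=> j x; rewrite mulr_ge0.
exists (k * a) => [|j]; first by rewrite mulr_ge0.
by rewrite integralZ_ge0// EFinM -muleA lee_wpmul2l// lee_fin.
Qed.

Lemma uniformly_bounded_trans F G (k : R) : (forall j, measurable_fun setT (F j)) ->
  (forall j x, 0 <= F j x) -> 0 <= k ->
  (forall j, \int[mu]_x (F j x)%:E <= k%:E * \int[mu]_x (G j x)%:E)%E ->
  uniformly_bounded G -> uniformly_bounded F.
Proof.
move=> mF F0 k0 FG [mG G0 [c c0 cG]]; split => //; exists (k * c).
  by rewrite mulr_ge0.
move=> j; apply: (le_trans (FG j)); rewrite EFinM -muleA lee_wpmul2l//.
Qed.

End uniform_bounds.

Section normalized_functions.
Context {R : realType} {n : nat}.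
Local Notation lebn := (@lebesgue_rV R n).
Variables (mu : probability 'rV[R]_n R).

Record normalized := Normalized {
  nfun : 'rV[R]_n -> R ;
  ngrad : 'I_n -> 'rV[R]_n -> R ;
  normalized_grad : has_gradient nfun ngrad ;
  normalized_mass : (\int[mu]_x (nfun x ^+ 2)%:E = 1)%E }.

Implicit Types (j : normalized) (x : 'rV[R]_n).

Definition nsq j x : R := nfun j x ^+ 2.

Definition ngrad_norm j x : R := Num.sqrt (\sum_i ngrad j i x ^+ 2).

(* With [`^ (-1)] rather than [^-1] measurability is immediate; both are 0
   at 0. *)
Definition log_slope j x : R := ngrad_norm j x * `|nfun j x| `^ (-1).

Lemma nsq_ge0 j x : 0 <= nsq j x. Proof. exact: sqr_ge0. Qed.

Lemma nsqE j x : nsq j x = `|nfun j x| ^+ 2.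
Proof. by rewrite /nsq real_normK ?num_real. Qed.

Lemma log_slope_ge0 j x : 0 <= log_slope j x.
Proof. by rewrite mulr_ge0 ?powR_ge0// sqrtr_ge0. Qed.

Lemma measurable_nfun j : measurable_fun setT (nfun j).
Proof. exact: has_gradient_measurable (normalized_grad j). Qed.

Lemma measurable_nsq j : measurable_fun setT (nsq j).
Proof. by apply: measurable_funX; exact: measurable_nfun. Qed.

Lemma measurable_sqrt : measurable_fun [set: R] Num.sqrt.
Proof. by apply: continuous_measurable_fun; exact: sqrt_continuous. Qed.

Lemma measurable_ngrad_norm j : measurable_fun setT (ngrad_norm j).
Proof.
apply: (measurableT_comp measurable_sqrt); apply: measurable_sum => i.
by apply: measurable_funX; exact: has_gradient_measurable_grad (normalized_grad j).
Qed.

Lemma measurable_log_slope j : measurable_fun setT (log_slope j).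
Proof.
apply: measurable_funM; first exact: measurable_ngrad_norm.
apply: (measurableT_comp (measurable_powR _)).
by apply: measurableT_comp => //; exact: measurable_nfun.
Qed.

Lemma ngrad_normE j x : nfun j x != 0 ->
  ngrad_norm j x = `|nfun j x| * log_slope j x.
Proof.
move=> f0; rewrite /log_slope mulrCA powR_inv1// divff ?mulr1//.
by rewrite normr_eq0.
Qed.

Lemma nsq_log_slope j x : nfun j x != 0 ->
  nsq j x * log_slope j x ^+ 2 = ngrad_norm j x ^+ 2.
Proof. by move=> f0; rewrite nsqE -exprMn -ngrad_normE. Qed.

Lemma nsq_log_slope_le j x : nsq j x * log_slope j x ^+ 2 <= ngrad_norm j x ^+ 2.
Proof.
have [f0|f0] := eqVneq (nfun j x) 0; last by rewrite nsq_log_slope.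
by rewrite /nsq f0 expr0n mul0r sqr_ge0.
Qed.

Section poincare_normalized.
Variable K : R.
Hypothesis K0 : 0 < K.
Hypothesis poincare : forall (f : 'rV[R]_n -> R) g (eps : R), has_gradient f g -> 0 < eps ->
  exists c : R, (\int[mu]_x ((f x - c) ^+ 2)%:E <=
    K%:E * \int[mu]_x (\sum_i g i x ^+ 2)%:E + eps%:E)%E.
Local Open Scope ereal_scope.
Local Notation U F := (\int[mu]_x (F x)%:E).

(* Poincare for the smooth functions sqrt(f^2 + eps^2), whose gradients vanish
   where f does; then eps tends to 0. *)
Lemma poincare_normalized j :
  U (fun x => (`|nfun j x| - 1) ^+ 2)%R <=
  (4 * K)%:E * U (fun x => nsq j x * log_slope j x ^+ 2)%R.
Proof.
have mts : measurable_fun setT (fun x => nsq j x * log_slope j x ^+ 2)%R.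
  apply: measurable_funM; first exact: measurable_nsq.
  by apply: measurable_funX; exact: measurable_log_slope.
have ts0 x : (0 <= nsq j x * log_slope j x ^+ 2)%R by rewrite mulr_ge0 ?nsq_ge0 ?sqr_ge0.
have mf := measurable_nfun j.
have mnf : measurable_fun setT (fun x => `|nfun j x|)%R by exact: measurableT_comp.
apply/lee_addgt0Pr => e e0.
pose eps := Num.min 1%R (e / 8)%R.
have eps0 : (0 < eps)%R by rewrite lt_min ltr01 divr_gt0.
have epsle : (4 * eps + 4 * eps ^+ 2 <= e)%R.
  have h1 : (eps <= 1)%R by rewrite ge_min lexx.
  have h2 : (eps <= e / 8)%R by rewrite ge_min lexx orbT.
  by nra.
have pos x : (0 < eps ^+ 2 + nsq j x)%R by rewrite ltr_pwDl ?nsq_ge0// exprn_gt0.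
pose fe x := ((eps ^+ 2 + nsq j x) `^ (1 / 2))%R.
have fe0 x : (0 <= fe x)%R by exact: powR_ge0.
have fe2 x : (fe x ^+ 2 = eps ^+ 2 + nsq j x)%R.
  by rewrite /fe -powR_mulrn ?powR_ge0// -powRrM mul1r mulVf// powRr1// ltW.
pose ge (i : 'I_n) x := ((1 / 2) * (eps ^+ 2 + nsq j x) `^ (1 / 2 - 1)
  * (2 * (nfun j x * ngrad j i x)))%R.
have hfe : has_gradient fe ge.
  have h : has_gradient (fun x => eps ^+ 2 + nsq j x)%R (fun i x => 2 * (nfun j x * ngrad j i x))%R.
    have := has_gradientD (has_gradient_cst (eps ^+ 2)%R)
      (has_gradientM (normalized_grad j) (normalized_grad j)).
    by apply: has_gradient_ext => i x; ring.
  apply: (has_gradient_comp (phi := (fun s => s `^ (1 / 2))%R)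
    (dphi := (fun s => (1 / 2) * s `^ (1 / 2 - 1))%R) h).
    by move=> x; exact: is_derive1_powR.
  move=> x; apply: continuousM; first exact: cvg_cst.
  exact: continuous_powR_gt0.
have ge_le x : (\sum_i ge i x ^+ 2 <= nsq j x * log_slope j x ^+ 2)%R.
  have [f0|f0] := eqVneq (nfun j x) 0%R.
    rewrite big1 ?ts0// => i _.
    by rewrite /ge f0 mul0r !mulr0 expr0n.
  rewrite nsq_log_slope// sqr_sqrtr; last by apply: sumr_ge0 => i _; exact: sqr_ge0.
  rewrite ler_sum// => i _; rewrite /ge.
  have -> : ((1 / 2) * (eps ^+ 2 + nsq j x) `^ (1 / 2 - 1) * (2 * (nfun j x * ngrad j i x)) =
    (eps ^+ 2 + nsq j x) `^ (1 / 2 - 1) * nfun j x * ngrad j i x)%R by field.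
  rewrite exprMn ler_piMl ?sqr_ge0// exprMn -powR_mulrn ?powR_ge0// -powRrM.
  rewrite (_ : (1 / 2 - 1) * 2%:R = -1)%R; last by field.
  rewrite powR_inv1 ?(ltW (pos x))// mulrC ler_pdivrMr// mul1r -/(nsq j x).
  by rewrite lerDr sqr_ge0.
have [c cP] := poincare hfe eps0.
have [z z0 zP] := sub_one_bound c.
set X := U (fun x => nsq j x * log_slope j x ^+ 2)%R.
have X0 : 0 <= X by apply: integral_ge0 => x _; rewrite lee_fin.
have [Xoo|Xoo] := eqVneq X +oo.
  by rewrite Xoo gt0_muley ?addye ?leey// lte_fin mulr_gt0.
have Xfin : X \is a fin_num by rewrite ge0_fin_numE// lt_neqAle Xoo leey.
pose u := fine X; have uE : X = u%:E by rewrite fineK.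
have mge : measurable_fun setT (fun x => \sum_i ge i x ^+ 2)%R.
  apply: measurable_sum => i; apply: measurable_funX.
  exact: has_gradient_measurable_grad hfe.
have mfe := has_gradient_measurable hfe.
have Ufe : U (fun x => (fe x - c) ^+ 2)%R <= (K * u + eps)%:E.
  apply: (le_trans cP); rewrite EFinD leeD2r// EFinM -uE lee_wpmul2l ?lee_fin ?(ltW K0)//.
  by apply: le_integral_ge0 => // x _; apply: sumr_ge0 => i _; exact: sqr_ge0.
pose S x := ((`|nfun j x| - 1) ^+ 2)%R.
have mS : measurable_fun setT S.
  by apply: measurable_funX; exact: measurable_funB.
(* The mass terms of [sub_one_bound] integrate to [1 + z] on both sides. They are kept until the end
   so that only nonnegative functions are integrated. *)
have key : U S + (1 + z)%:E <= ((4 * (K * u + eps) + 4 * eps ^+ 2) + (1 + z))%:E.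
  have Ucst (k : R) : (0 <= k)%R -> U (fun=> k) = k%:E.
    move=> k0; rewrite integral_cst// [X in _ * X](_ : _ = 1) ?mule1//.
    exact: probability_setT.
  have U1 : U (nsq j) = 1 by exact: normalized_mass.
  have mnsq := measurable_nsq j; have nsq0 := nsq_ge0 j.
  have -> : U S + (1 + z)%:E = U (fun x => S x + (nsq j x + z))%R.
    rewrite integralD_ge0//.
    - by rewrite integralD_ge0// U1 Ucst// EFinD.
    - exact: measurable_funD.
    - by move=> x; exact: sqr_ge0.
    - by move=> x; rewrite addr_ge0.
  have mB1 : measurable_fun setT (fun x => (fe x - c) ^+ 2)%R.
    by apply: measurable_funX; exact: measurable_funB.
  have mB2 : measurable_fun setT (fun x => 4 * eps ^+ 2 + 1 + z * nsq j x)%R.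
    by apply: measurable_funD => //; exact: measurable_funM.
  have e20 : (0 <= 4 * eps ^+ 2)%R by rewrite mulr_ge0// sqr_ge0.
  have B20 x : (0 <= 4 * eps ^+ 2 + 1 + z * nsq j x)%R.
    by apply: addr_ge0; [exact: addr_ge0|exact: mulr_ge0].
  have UB2 : U (fun x => 4 * eps ^+ 2 + 1 + z * nsq j x)%R = (4 * eps ^+ 2 + 1 + z)%:E.
    rewrite integralD_ge0//.
    - by rewrite Ucst ?addr_ge0// integralZ_ge0// U1 mule1 -EFinD.
    - exact: measurable_funM.
    - by move=> x; rewrite addr_ge0.
    - by move=> x; rewrite mulr_ge0.
  have -> : ((4 * (K * u + eps) + 4 * eps ^+ 2) + (1 + z))%:E =
      (4 * (K * u + eps) + 1 * (4 * eps ^+ 2 + 1 + z))%:E by congr (_%:E); ring.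
  apply: (integral_lin_le mB1 mB2) => //.
  - by apply: measurable_funD => //; exact: measurable_funD.
  - by move=> x; exact: sqr_ge0.
  - by move=> x; rewrite addr_ge0 ?addr_ge0 ?sqr_ge0.
  - move=> x; have := zP _ (normr_ge0 (nfun j x)); rewrite /S -nsqE.
    have p0 : (0 <= `|nfun j x|)%R by [].
    have := fe2 x; rewrite nsqE; have := fe0 x.
    move: (fe x) `|nfun j x|%R p0 => y p p0 y0 yE.
    have py : (p <= y)%R.
      by rewrite -(@ler_pXn2r _ 2)// ?nnegrE// yE lerDr sqr_ge0.
    (* As [fe] and [|f|] differ by at most [eps], [2 (|f| - c)^2 <= 4 (fe - c)^2 + 4 eps^2]; this is
       the origin of the factor 4. *)
    have : ((y - p) ^+ 2 <= eps ^+ 2)%R.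
      have -> : (eps ^+ 2 = (y - p) * (y + p))%R by rewrite -[LHS](addrK (p ^+ 2)%R) -yE; ring.
      by rewrite expr2 ler_wpM2l ?subr_ge0// lerD2l; lra.
    have := sqr_ge0 (y - c - (p - y)).
    by lra.
  - by rewrite UB2.
rewrite (EFinD (4 * (K * u + eps) + 4 * eps ^+ 2)%R) leeD2rE// in key; apply: (le_trans key).
rewrite uE -EFinM -EFinD lee_fin; lra.
Qed.

End poincare_normalized.
End normalized_functions.

(** * Smooth truncation of the squared function *)

Section truncation.
Context {R : realType} {n : nat}.
Variables (mu : probability 'rV[R]_n R) (m : nat).
(** Even, so that the [k]-th power of the cut-off is a square and its power [k - 1] splits into
    powers [m + 1] and [m]; at least 2, so that the truncation is C^1. *)
Local Notation k := (m.*2.+2).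
Implicit Types (j : normalized mu) (x : 'rV[R]_n).

(* A smooth substitute for f^2 restricted to {f^2 > 4}; it vanishes to order k
   at f^2 = 4, so that |grad w|^a' / w^(a' - 1) stays bounded for a' <= k. *)
Definition tfrac j x : R := pospart (1 - 5 * (1 + nsq j x) `^ (-1)).

Definition tsq j x : R := (1 + nsq j x) * tfrac j x ^+ k.

(** The derivative of the truncation with respect to [t = f^2]: where positive, [tfrac] is
    [1 - 5 / (1 + t)], with derivative [5 / (1 + t)^2]. *)
Definition dtsq j x : R :=
  tfrac j x ^+ k + 5 * k%:R * tfrac j x ^+ k.-1 * (1 + nsq j x) `^ (-1).

Definition tconst : R := 1 + 5 * k%:R.

Lemma nsq1_gt0 j x : 0 < 1 + nsq j x. Proof. by have := nsq_ge0 j x; lra. Qed.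

Lemma nsq1_inv j x : (1 + nsq j x) `^ (-1) = (1 + nsq j x)^-1.
Proof. by rewrite powR_inv1// ltW// nsq1_gt0. Qed.

Lemma has_gradient_tsq j :
  has_gradient (tsq j) (fun i x => dtsq j x * (2 * (nfun j x * ngrad j i x))).
Proof.
have h1 : has_gradient (fun x => 1 + nsq j x) (fun i x => 2 * (nfun j x * ngrad j i x)).
  apply: has_gradient_ext (has_gradientD (has_gradient_cst 1)
      (has_gradientM (normalized_grad j) (normalized_grad j))) => i x; ring.
have h2 := has_gradient_comp (phi := fun s => s `^ (-1))
  (dphi := fun s => -1 * s `^ (-1 - 1)) h1 (fun x => is_derive1_powR (-1) (nsq1_gt0 j x)).
have h3 : has_gradient (fun x => 1 + (-5) * (1 + nsq j x) `^ (-1))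
    (fun i x => 5 * ((1 + nsq j x)^-1 ^+ 2 * (2 * (nfun j x * ngrad j i x)))).
  have := has_gradientD (has_gradient_cst 1) (has_gradientM (has_gradient_cst (-5)) (h2 _)).
  move=> H; apply: has_gradient_ext (H _) => [i x|x].
    rewrite powRD ?(gt_eqF (nsq1_gt0 _ _)) ?implybT// nsq1_inv; ring.
  apply: continuousM; first exact: cvg_cst.
  exact: continuous_powR_gt0 (nsq1_gt0 j x).
have h4 := has_gradient_comp (phi := fun s => pospart s ^+ k)
  (dphi := fun s => k%:R * pospart s ^+ k.-1) h3 (fun x => @is_derive_pospartX R m.*2 _).
have h5 := has_gradientM h1 (h4 _).
have e : tsq j = fun x => (1 + nsq j x) * pospart (1 + (-5) * (1 + nsq j x) `^ (-1)) ^+ k.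
  by apply/funext => x; rewrite /tsq /tfrac mulNr.
rewrite e; apply: has_gradient_ext (h5 _) => [i x|x].
  rewrite /dtsq /tfrac !mulNr nsq1_inv.
  by field; rewrite gt_eqF// nsq1_gt0.
apply: continuousM; first exact: cvg_cst.
exact: continuous_pospartX.
Qed.

Lemma tfrac_ge0 j x : 0 <= tfrac j x. Proof. exact: pospart_ge0. Qed.

Lemma tfrac_le1 j x : tfrac j x <= 1.
Proof.
rewrite /tfrac /pospart ge_max ler01/= lerBlDr lerDl.
by rewrite mulr_ge0// powR_ge0.
Qed.

Lemma tfracE j x : (1 + nsq j x) * tfrac j x = pospart (nsq j x - 4).
Proof.
have h := nsq1_gt0 j x.
rewrite /tfrac nsq1_inv /pospart maxr_pMr ?(ltW h)// mulr0.
by congr (Num.max 0 _); field; rewrite gt_eqF.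
Qed.

Lemma tfrac_eq0 j x : nsq j x <= 4 -> tfrac j x = 0.
Proof.
move=> t4; have := tfracE j x; rewrite pospart_eq0; last lra.
by move/eqP; rewrite mulf_eq0 (gt_eqF (nsq1_gt0 j x)) => /eqP.
Qed.

Lemma tsq_ge0 j x : 0 <= tsq j x.
Proof. by rewrite mulr_ge0 ?exprn_ge0 ?tfrac_ge0// ltW// nsq1_gt0. Qed.

Lemma tsq_le j x : tsq j x <= nsq j x.
Proof.
rewrite /tsq exprS mulrA tfracE.
apply: (@le_trans _ _ (pospart (nsq j x - 4))).
  by rewrite ler_piMr ?pospart_ge0// exprn_ile1 ?tfrac_ge0 ?tfrac_le1.
by rewrite /pospart ge_max nsq_ge0/=; lra.
Qed.

Lemma tsq_ge j x : nsq j x * tfrac j x ^+ k <= tsq j x.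
Proof. by rewrite ler_wpM2r ?exprn_ge0 ?tfrac_ge0// lerDr. Qed.

(** The value of [1 - 5 / (1 + t)] reaches 1/2 exactly at [t = 9], whence this threshold. *)
Lemma nsq_le_tsq j x : 9 <= nsq j x -> nsq j x <= 2 ^+ k * tsq j x.
Proof.
move=> t9.
have q2 : 1 / 2 <= tfrac j x.
  have h := nsq1_gt0 j x; rewrite -(ler_pM2l h) tfracE pospart_id; lra.
have : (1 / 2) ^+ k <= tfrac j x ^+ k by rewrite ler_pXn2r ?nnegrE ?tfrac_ge0//; lra.
move=> /(ler_wpM2l (nsq_ge0 j x)) /le_trans /(_ (tsq_ge j x)).
move=> /(ler_wpM2l (exprn_ge0 k (ler0n R 2))); apply: le_trans.
by rewrite mulrCA -exprMn (_ : 2 * (1 / 2) = 1) ?expr1n ?mulr1//; field.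
Qed.

(** For [|f| > 2] one has [|f| <= 2 (|f| - 1)]. This is the reason for truncating at 4: the mass of
    the truncation is then paid for by the deviation from 1. *)
Lemma nsq_le_deviation j x : 4 < nsq j x -> nsq j x <= 4 * (`|nfun j x| - 1) ^+ 2.
Proof.
rewrite nsqE; move: `|_| (normr_ge0 (nfun j x)) => p p0 p4.
have p2 : 2 < p.
  by rewrite -(@ltr_pXn2r _ 2) ?nnegrE//; lra.
have : 0 <= (p - 2) * (3 * p - 2) by rewrite mulr_ge0//; lra.
lra.
Qed.

Lemma tsq_le_deviation j x : tsq j x <= 4 * (`|nfun j x| - 1) ^+ 2.
Proof.
have [t4|t4] := leP (nsq j x) 4.
  by rewrite /tsq tfrac_eq0// expr0n/= mulr0 mulr_ge0 ?sqr_ge0.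
exact: le_trans (tsq_le _ _) (nsq_le_deviation t4).
Qed.

Lemma dtsq_ge0 j x : 0 <= dtsq j x.
Proof.
rewrite /dtsq addr_ge0 ?exprn_ge0 ?tfrac_ge0//.
by rewrite mulr_ge0 ?powR_ge0// mulr_ge0 ?exprn_ge0 ?tfrac_ge0// mulr_ge0.
Qed.

Lemma dtsq_le j x : dtsq j x <= tconst * tfrac j x ^+ k.-1.
Proof.
have q0 := tfrac_ge0 j x; have q1 := tfrac_le1 j x.
have -> : tconst * tfrac j x ^+ k.-1 = tfrac j x ^+ k.-1 + 5 * k%:R * tfrac j x ^+ k.-1.
  by rewrite /tconst; ring.
apply: lerD.
  by rewrite exprS ler_piMl// exprn_ge0.
rewrite ler_piMr//; first by rewrite mulr_ge0 ?exprn_ge0// mulr_ge0.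
rewrite nsq1_inv invf_le1 ?nsq1_gt0// lerDl; exact: nsq_ge0.
Qed.

Lemma tfrac_neq0 j x : tfrac j x != 0 -> 4 < nsq j x /\ nfun j x != 0.
Proof.
move=> q0; have t4 : 4 < nsq j x.
  by rewrite ltNge; apply: contra_neqN q0 => /tfrac_eq0.
split=> //; apply: contraTneq t4 => f0; rewrite /nsq f0 expr0n/= -leNgt; lra.
Qed.

Lemma grad_tsq_le j i x : `|dtsq j x * (2 * (nfun j x * ngrad j i x))| <=
  2 * tconst * tfrac j x ^+ k.-1 * (`|nfun j x| * ngrad_norm j x).
Proof.
have := dtsq_le j x; have := dtsq_ge0 j x.
rewrite !normrM => d0; rewrite (ger0_norm d0) (ger0_norm (ler0n _ 2)) => dle.
have h := le_norm_sqrt (fun i => ngrad j i x) i.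
rewrite [leRHS](_ : _ = tconst * tfrac j x ^+ k.-1 * (2 * (`|nfun j x| * ngrad_norm j x)));
  last by ring.
by apply: ler_pM => //; rewrite ?mulr_ge0// ler_wpM2l// ler_wpM2l.
Qed.

Lemma radial_grad_tsq_le j x :
  `|\sum_i x ord0 i * (dtsq j x * (2 * (nfun j x * ngrad j i x)))| <=
  jap x * (2 * tconst * tfrac j x ^+ k.-1 * (`|nfun j x| * ngrad_norm j x)).
Proof.
have -> : \sum_i x ord0 i * (dtsq j x * (2 * (nfun j x * ngrad j i x))) =
    dtsq j x * (2 * nfun j x) * \sum_i x ord0 i * ngrad j i x.
  by rewrite mulr_sumr; apply: eq_bigr => i _; ring.
have := dtsq_le j x; have := dtsq_ge0 j x.
rewrite !normrM => d0; rewrite (ger0_norm d0) (ger0_norm (ler0n _ 2)) => dle.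
have h : `|\sum_i x ord0 i * ngrad j i x| <= jap x * ngrad_norm j x.
  apply: (le_trans (norm_sum_le (fun i => x ord0 i) (fun i => ngrad j i x))).
  by rewrite ler_wpM2r ?sqrtr_ge0//; exact: enorm_le_jap.
rewrite [leRHS](_ : _ = (tconst * tfrac j x ^+ k.-1 * (2 * `|nfun j x|)) * (jap x * ngrad_norm j x));
  last by ring.
apply: ler_pM => //; first by rewrite !mulr_ge0.
by rewrite ler_wpM2r// mulr_ge0.
Qed.

End truncation.

(** * Moments and entropy of the truncation *)

Section tail_bounds.
Context {R : realType} {n : nat}.
Local Notation lebn := (@lebesgue_rV R n).
Variables (mu : probability 'rV[R]_n R) (m : nat).
Local Notation k := (m.*2.+2).
Variables (W : 'rV[R]_n -> R) (gW : 'I_n -> 'rV[R]_n -> R).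
Variables (KN a0 b0 CW Cg alpha alphas : R).
Hypothesis hW : has_gradient W gW.
Hypothesis KN0 : 0 < KN.
Hypothesis mu_ge : forall F : 'rV[R]_n -> R, measurable_fun setT F -> (forall x, 0 <= F x) ->
  (\int[lebn]_x (F x * expR (- W x))%:E <= \int[mu]_x (F x)%:E)%E.
Hypothesis mu_le : forall F : 'rV[R]_n -> R, measurable_fun setT F -> (forall x, 0 <= F x) ->
  (\int[mu]_x (F x)%:E <= KN%:E * \int[lebn]_x (F x * expR (- W x))%:E)%E.
Hypotheses (alpha_gt1 : 1 < alpha) (alpha_le2 : alpha <= 2).
Hypothesis alphas_conj : alpha^-1 + alphas^-1 = 1.
Hypothesis k_large : alphas <= k%:R.
Hypotheses (a0_gt0 : 0 < a0) (b0_ge0 : 0 <= b0).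
Hypothesis radial : forall x, a0 * jap x `^ alpha - b0 <= \sum_i x ord0 i * gW i x.
Hypotheses (CW0 : 0 <= CW) (Cg0 : 0 <= Cg).
Hypothesis W_growth : forall x, `|W x| <= CW * jap x `^ alpha.
Hypothesis gW_growth : forall i x, `|gW i x| <= Cg * jap x `^ (alpha - 1).
Variable E : normalized mu -> \bar R.
Local Notation ub := (uniformly_bounded mu E).
Hypothesis ub_slope2 : ub (fun j x => nsq j x * log_slope j x ^+ 2).
Hypothesis ub_dev : ub (fun j x => (`|nfun j x| - 1) ^+ 2).
Implicit Types (j : normalized mu) (x : 'rV[R]_n).
Local Notation w := (tsq m).
Local Notation q := tfrac.

Lemma measurable_jap : measurable_fun setT (@jap R n).
Proof. by apply: continuous_measurable_rV; exact: continuous_jap. Qed.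

Lemma measurable_jap_powR (p : R) : measurable_fun setT (fun x : 'rV[R]_n => jap x `^ p).
Proof. exact: (measurableT_comp (measurable_powR _) measurable_jap). Qed.

Lemma measurable_tsq j : measurable_fun setT (w j).
Proof. exact: has_gradient_measurable (has_gradient_tsq m j). Qed.

Lemma ub_tsq : ub w.
Proof.
apply: uniformly_bounded_le (uniformly_boundedZ (ler0n R 4) ub_dev).
- exact: measurable_tsq.
- by move=> j x; exact: tsq_ge0.
- by move=> j x; exact: tsq_le_deviation.
Qed.

(** The divergence estimate for [w]. By [hg] half of the radial term absorbs a piece of the gradient
    term; the other half controls the moment, and only [g] and a multiple of [w] remain. *)
Lemma ub_tsq_weight (gam : R) (g : normalized mu -> 'rV[R]_n -> R) : gam <= 0 ->
  ub g ->
  (forall j x, jap x `^ (gam + 1) * (2 * tconst m * q j x ^+ k.-1 * (`|nfun j x| * ngrad_norm j x))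
     <= a0 / 2 * (w j x * jap x `^ (alpha + gam)) + g j x) ->
  ub (fun j x => w j x * jap x `^ (alpha + gam)).
Proof.
move=> gam0 ubg hg; have a00 := a0_gt0; have b00 := b0_ge0; have K0 := KN0.
have [mg g0 _] := ubg.
have ubB : ub (fun j x => (n%:R + b0) * w j x + g j x).
  by apply: uniformly_boundedD => //; apply: uniformly_boundedZ => //;
    [rewrite addr_ge0|exact: ub_tsq].
have mF j : measurable_fun setT (fun x => w j x * jap x `^ (alpha + gam)).
  by apply: measurable_funM; [exact: measurable_tsq|exact: measurable_jap_powR].
have F0 j x : 0 <= w j x * jap x `^ (alpha + gam) by rewrite mulr_ge0 ?tsq_ge0 ?powR_ge0.
have a20 : 0 <= a0 / 2 by lra.
suff H : ub (fun j x => a0 / 2 * (w j x * jap x `^ (alpha + gam))).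
  have a20i : 0 <= 2 / a0 by rewrite divr_ge0// ltW.
  apply: uniformly_bounded_le (uniformly_boundedZ a20i H) => // j x.
  by rewrite mulrA (_ : 2 / a0 * (a0 / 2) = 1) ?mul1r//; field; rewrite gt_eqF.
apply: (uniformly_bounded_trans _ _ (ltW KN0) _ ubB) => //.
- by move=> j; exact: measurable_funM.
- by move=> j x; rewrite mulr_ge0.
move=> j; have [mB B0 _] := ubB.
apply: (divergence_mu hW KN0 mu_ge mu_le (b := gam / 2) (has_gradient_tsq m j)) => //.
- exact: tsq_ge0.
- exact: measurable_funM.
- by move=> x; rewrite mulr_ge0.
- by lra.
move=> x; rewrite powR_jap (_ : 2 * (gam / 2) = gam); last by field.
have w0 := tsq_ge0 m j x.
have J0 : 0 <= jap x `^ gam by exact: powR_ge0.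
have J1 : jap x `^ gam <= 1 by rewrite -[leRHS](powRr0 (jap x)) jap_powR_le.
have jx := jap_gt0 x.
have hgx := hg j x.
have := radial_grad_tsq_le m j x; move/(le_trans (ler_norm _))/(ler_wpM2l J0).
set P := 2 * tconst m * _ * _ in hgx *.
have -> : jap x `^ gam * (jap x * P) = jap x `^ (gam + 1) * P.
  by rewrite powRD ?(gt_eqF jx) ?implybT// powRr1 ?(ltW jx)// mulrA.
have h1 : w j x * jap x `^ gam * (a0 * jap x `^ alpha - b0) <=
    w j x * jap x `^ gam * \sum_i x ord0 i * gW i x.
  by rewrite ler_wpM2l ?radial// mulr_ge0.
have h2 : jap x `^ (alpha + gam) = jap x `^ alpha * jap x `^ gam.
  by rewrite powRD ?(gt_eqF jx) ?implybT.
have h3 : jap x `^ gam * ((n%:R + b0) * w j x) <= 1 * ((n%:R + b0) * w j x).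
  by rewrite ler_wpM2r// mulr_ge0// addr_ge0.
move: h1 hgx h3; rewrite h2; set S1 := \sum_i _; set S2 := \sum_i _.
lra.
Qed.

(** Quadratic Young inequality with weight exponent [alpha - 2]. Of [q^(k-1) = q^(m+1) q^m], the
    first factor goes with [r^(alpha - 1)] and squares to the [q^k] of [w]; the second goes with the
    slope and is dropped. *)
Lemma ub_tsq_weight2 : ub (fun j x => w j x * jap x `^ (2 * alpha - 2)).
Proof.
have a1 := alpha_gt1; have a2 := alpha_le2; have a00 := a0_gt0.
have cc : 0 <= 2 / a0 * tconst m ^+ 2 :> R by rewrite mulr_ge0 ?sqr_ge0 ?divr_ge0// ltW.
have := @ub_tsq_weight (alpha - 2) _ _ (uniformly_boundedZ cc ub_slope2).
rewrite (_ : alpha + (alpha - 2) = 2 * alpha - 2); last by ring.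
rewrite (_ : alpha - 2 + 1 = alpha - 1); last by ring.
apply; first by lra.
move=> j x; have w0 := tsq_ge0 m j x.
have s0 : 0 <= nsq j x * log_slope j x ^+ 2 by rewrite mulr_ge0 ?nsq_ge0 ?sqr_ge0.
have [q0|q0] := eqVneq (q j x) 0.
  have a02' : 0 <= a0 / 2 by lra.
  rewrite q0 expr0n/= mulr0 !mul0r mulr0; apply: addr_ge0; last exact: mulr_ge0.
  by rewrite mulr_ge0// mulr_ge0// powR_ge0.
have [_ f0] := tfrac_neq0 q0.
rewrite ngrad_normE//.
set r := jap x `^ (alpha - 1); set z := log_slope j x in s0 *.
have r2 : jap x `^ (2 * alpha - 2) = r ^+ 2.
  rewrite /r expr2 -powRD; first by congr (_ `^ _); ring.
  by rewrite (gt_eqF (jap_gt0 x)) implybT.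
rewrite r2.
have qs0 := tfrac_ge0 j x; have qs1 := tfrac_le1 j x.
have wt := tsq_ge m j x.
have z0 : 0 <= z by exact: log_slope_ge0.
have r0 : 0 <= r by exact: powR_ge0.
have t0 := nsq_ge0 j x.
pose X := q j x ^+ m.+1 * r; pose Y := q j x ^+ m * z.
have e1 : r * (2 * tconst m * q j x ^+ k.-1 * (`|nfun j x| * (`|nfun j x| * z))) =
    2 * tconst m * nsq j x * (X * Y).
  have -> : q j x ^+ k.-1 = q j x ^+ m.+1 * q j x ^+ m.
    by rewrite -exprD addSn addnn.
  by rewrite nsqE /X /Y; ring.
rewrite e1.
have e2 : nsq j x * X ^+ 2 <= w j x * r ^+ 2.
  rewrite /X exprMn mulrA ler_wpM2r ?sqr_ge0//.
  by rewrite -exprM muln2 doubleS.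
have e3 : nsq j x * Y ^+ 2 <= nsq j x * z ^+ 2.
  rewrite ler_wpM2l// /Y exprMn ler_piMl ?sqr_ge0//.
  by rewrite exprn_ile1 ?exprn_ge0// exprn_ile1.
have e4 : 2 * tconst m * (X * Y) <= a0 / 2 * X ^+ 2 + 2 / a0 * tconst m ^+ 2 * Y ^+ 2 :> R.
  rewrite -subr_ge0 (_ : _ - _ = a0 / 2 * (X - 2 / a0 * tconst m * Y) ^+ 2); last first.
    by field; rewrite gt_eqF.
  by rewrite mulr_ge0 ?sqr_ge0// divr_ge0// ltW.
have h1 := ler_wpM2l t0 e4.
have h2 := ler_wpM2l cc e3.
have a02 : 0 <= a0 / 2 by lra.
have h3 := ler_wpM2l a02 e2.
by lra.
Qed.

(** Young with exponents [alpha] and [alphas], applied to [jap x] and to the slope divided by [q],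
    under the common factor [nsq j x * q^k]. The resulting [q^(k - alphas)] is at most 1 by
    [k_large]. *)
Lemma ub_tsq_weight1 : ub (fun j x => nsq j x * log_slope j x `^ alphas) ->
  ub (fun j x => w j x * jap x `^ alpha).
Proof.
move=> ubs; have a1 := alpha_gt1; have a2 := alpha_le2; have a00 := a0_gt0.
have al0 : 0 < alpha by lra.
have as0 : 0 < alphas.
  rewrite -invr_gt0; have := alphas_conj; have := invf_lt1 al0; rewrite a1; lra.
have a02 : 0 < a0 / 2 by lra.
have [K K0 KP] := young_eps al0 as0 alphas_conj a02.
have tc0 : 0 <= tconst m :> R by rewrite /tconst addr_ge0// mulr_ge0.
have cc : 0 <= K * (2 * tconst m) `^ alphas by rewrite mulr_ge0 ?powR_ge0.
have := @ub_tsq_weight 0 _ _ (uniformly_boundedZ cc ubs).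
rewrite addr0 add0r; apply => // j x; have w0 := tsq_ge0 m j x.
have s0 : 0 <= nsq j x * log_slope j x `^ alphas by rewrite mulr_ge0 ?nsq_ge0 ?powR_ge0.
have jx := jap_gt0 x.
rewrite powRr1 ?(ltW jx)//.
have [q0|q0] := eqVneq (q j x) 0.
  rewrite q0 expr0n/= mulr0 !mul0r mulr0; apply: addr_ge0; last exact: mulr_ge0.
  by rewrite mulr_ge0 ?(ltW a02)// mulr_ge0// powR_ge0.
have [_ f0] := tfrac_neq0 q0.
rewrite ngrad_normE//; set z := log_slope j x in s0 *.
have qs0 := tfrac_ge0 j x; have qs1 := tfrac_le1 j x.
have qgt : 0 < q j x by rewrite lt_neqAle eq_sym q0.
have wt := tsq_ge m j x.
have z0 : 0 <= z by exact: log_slope_ge0.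
clearbody z.
have t0 := nsq_ge0 j x.
have qk0 : 0 <= q j x ^+ k by rewrite exprn_ge0.
have e1 : jap x * (2 * tconst m * q j x ^+ k.-1 * (`|nfun j x| * (`|nfun j x| * z))) =
    nsq j x * q j x ^+ k * (jap x * ((2 * tconst m) * z * (q j x)^-1)).
  by rewrite nsqE [q j x ^+ k]exprS; field.
rewrite e1.
have zc0 : 0 <= (2 * tconst m) * z * (q j x)^-1.
  by rewrite mulr_ge0 ?invr_ge0// mulr_ge0// mulr_ge0.
have := KP _ _ (ltW jx) zc0.
have A0 : 0 <= 2 * tconst m :> R by rewrite mulr_ge0.
rewrite (@powRM _ (2 * tconst m * z)) ?invr_ge0 ?(mulr_ge0 A0)//.
rewrite (@powRM _ (2 * tconst m) z)// => e2.
have e3 : q j x ^+ k * (q j x)^-1 `^ alphas <= 1.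
  apply: (@le_trans _ _ (q j x ^+ k * (q j x)^-1 `^ k%:R)).
    by rewrite ler_wpM2l// ler_powR// invf_ge1.
  by rewrite powR_mulrn ?invr_ge0// -exprMn divff// expr1n.
have h1 := ler_wpM2l (mulr_ge0 t0 qk0) e2.
have h2 := ler_wpM2l (mulr_ge0 (mulr_ge0 t0 cc) (powR_ge0 z alphas)) e3.
have h3 : a0 / 2 * jap x `^ alpha * (nsq j x * q j x ^+ k) <= a0 / 2 * jap x `^ alpha * w j x.
  by rewrite ler_wpM2l// mulr_ge0 ?powR_ge0// ltW.
move: h1 h2 h3; set T1 := (2 * tconst m) `^ alphas in cc *.
set T2 := z `^ alphas; set T3 := (q j x)^-1 `^ alphas.
by lra.
Qed.

(** [entropy_mu] applies because [w <= f^2] has mass at most 1. On the support of [w],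
    [|f| |grad f| <= f^2 + |grad f|^2], where [f^2] is bounded by the deviation; the potential
    contributes [w |gW|], hence the moment of order [alpha - 1]. *)
Lemma ub_tsq_entropy : ub (fun j x => w j x * jap x `^ (alpha - 1)) ->
  ub (fun j x => w j x * lnp (w j x * expR (- W x))).
Proof.
move=> ubw; have K0 := KN0.
have tc0 : 0 <= tconst m :> R by rewrite /tconst addr_ge0// mulr_ge0.
have [mdev dev0 _] := ub_dev; have [msl sl0 _] := ub_slope2; have [mw1 w10 _] := ubw.
have H : ub (fun j x => n%:R * (tconst m *
    (4 * (`|nfun j x| - 1) ^+ 2 + nsq j x * log_slope j x ^+ 2)
    + Cg * (w j x * jap x `^ (alpha - 1)))).
  apply: uniformly_boundedZ => //; apply: uniformly_boundedD => //.
    apply: uniformly_boundedZ => //; apply: uniformly_boundedD => //.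
    exact: uniformly_boundedZ.
  exact: uniformly_boundedZ.
pose D j x := \sum_i (`|dtsq m j x * (2 * (nfun j x * ngrad j i x))| + w j x * `|gW i x|).
have ubD : ub D.
  apply: uniformly_bounded_le H.
  - move=> j; apply: measurable_sum => i; apply: measurable_funD.
      apply: measurableT_comp => //.
      exact: has_gradient_measurable_grad (has_gradient_tsq m j).
    apply: measurable_funM; first exact: measurable_tsq.
    by apply: measurableT_comp => //; exact: has_gradient_measurable_grad hW.
  - by move=> j x; apply: sumr_ge0 => i _; rewrite addr_ge0// mulr_ge0// tsq_ge0.
  have nsum (c : R) : n%:R * c = \sum_(i < n) c by rewrite sumr_const card_ord mulr_natl.
  move=> j x; rewrite nsum.
  apply: ler_sum => i _; apply: lerD; last first.
    by rewrite mulrCA ler_wpM2l ?tsq_ge0.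
  apply: (le_trans (grad_tsq_le m j i x)).
  rewrite (_ : _ * _ * _ * _ = tconst m * (2 * (tfrac j x ^+ k.-1 * (`|nfun j x| * ngrad_norm j x))));
  last by ring.
  rewrite ler_wpM2l//.
  have [q0|q0] := eqVneq (q j x) 0.
    by rewrite q0 expr0n/= mul0r mulr0 addr_ge0// mulr_ge0.
  have [t4 f0] := tfrac_neq0 q0; rewrite ngrad_normE// mulrA mulrA.
  have qs0 := tfrac_ge0 j x; have qs1 := tfrac_le1 j x.
  have qk1 : q j x ^+ k.-1 <= 1 by rewrite exprn_ile1.
  have qk0 : 0 <= q j x ^+ k.-1 by rewrite exprn_ge0.
  have h := nsq_le_deviation t4.
  have z0 := log_slope_ge0 j x.
  apply: (@le_trans _ _ (nsq j x + nsq j x * log_slope j x ^+ 2)); last by rewrite lerD2r.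
  rewrite nsqE; move: (log_slope j x) z0 => z z0.
  have h2 := sqr_ge0 (`|nfun j x| * (1 - z)).
  have h3 : 0 <= (1 - q j x ^+ k.-1) * (`|nfun j x| * (`|nfun j x| * z)).
    by rewrite mulr_ge0 ?subr_ge0// !mulr_ge0.
  by lra.
apply: (uniformly_bounded_trans _ _ (ltW KN0) _ ubD).
- move=> j; apply: measurable_funM; first exact: measurable_tsq.
  apply: (measurableT_comp measurable_lnp).
  apply: measurable_funM; first exact: measurable_tsq.
  exact: has_gradient_measurable (has_gradient_expRN hW).
- by move=> j x; rewrite mulr_ge0 ?tsq_ge0 ?lnp_ge0.
move=> j; apply: (entropy_mu hW KN0 mu_ge mu_le (has_gradient_tsq m j)).
  exact: tsq_ge0.
rewrite -(normalized_mass j); apply: le_integral_ge0 => //.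
- exact: measurable_tsq.
- exact: measurable_nsq.
- by move=> x _; exact: tsq_ge0.
- by move=> x _; exact: tsq_le.
Qed.

Lemma ub_tsq_weight_half : ub (fun j x => w j x * jap x `^ (alpha - 1)).
Proof.
have a1 := alpha_gt1.
apply: uniformly_bounded_le ub_tsq_weight2.
- by move=> j; apply: measurable_funM; [exact: measurable_tsq|exact: measurable_jap_powR].
- by move=> j x; rewrite mulr_ge0 ?tsq_ge0 ?powR_ge0.
- by move=> j x; rewrite ler_wpM2l ?tsq_ge0// jap_powR_le//; lra.
Qed.

(** From [nsq <= 2^k w] and [ln w = ln (w e^-W) + W]: the density inserted for the entropy bound is
    taken out again at the price of [W]. *)
Lemma ln_nsq_le j x : 9 <= nsq j x ->
  ln (nsq j x) <= k%:R + lnp (w j x * expR (- W x)) + CW * jap x `^ alpha.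
Proof.
move=> t9; have t0 : 0 < nsq j x by lra.
have tw := nsq_le_tsq m t9.
have k2 : 0 < 2 ^+ k :> R by rewrite exprn_gt0.
have w0 : 0 < w j x by rewrite -(pmulr_rgt0 _ k2); exact: lt_le_trans tw.
have h1 : ln (nsq j x) <= ln (2 ^+ k * w j x) by rewrite ler_ln ?posrE ?(mulr_gt0 k2).
rewrite lnM ?posrE// lnXn// in h1.
have h2 : ln 2 <= 1 :> R by have := @le_ln1Dx R 1; rewrite (_ : 1 + 1 = 2)//; apply; lra.
have h3 : ln (w j x) = ln (w j x * expR (- W x)) + W x.
  by rewrite lnM ?posrE ?expR_gt0// expRK addrNK.
have h4 := lnp_ge (w j x * expR (- W x)).
have h5 := le_trans (ler_norm _) (W_growth x).
have h6 : ln 2 *+ k <= k%:R :> R by rewrite lerMn2r h2 orbT.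
lra.
Qed.

Lemma ub_log_tail : ub (fun j x => nsq j x * log_slope j x `^ alphas) ->
  exists2 H, ub H & forall j x, nsq j x * ln (nsq j x) <= (nsq j x - 1) + H j x.
Proof.
move=> ubs; have [mdev dev0 _] := ub_dev.
have U1 := ub_tsq_weight1 ubs; have U2 := ub_tsq_entropy ub_tsq_weight_half.
pose T j x := k%:R * w j x + w j x * lnp (w j x * expR (- W x)) +
  CW * (w j x * jap x `^ alpha).
have ubT : ub T.
  apply: uniformly_boundedD; last exact: uniformly_boundedZ.
  by apply: uniformly_boundedD => //; apply: uniformly_boundedZ => //; exact: ub_tsq.
exists (fun j x => 16 * (`|nfun j x| - 1) ^+ 2 + 2 ^+ k * T j x).
  by apply: uniformly_boundedD; apply: uniformly_boundedZ.
move=> j x; have t0 := nsq_ge0 j x; have := mul_ln_le t0.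
have [_ T0 _] := ubT; have Tx : 0 <= 2 ^+ k * T j x by rewrite mulr_ge0.
have S0 := sqr_ge0 (`|nfun j x| - 1).
have [t9|t9] := leP 9 (nsq j x).
  move=> _; have := ler_wpM2l t0 (ln_nsq_le t9).
  set B := _ + _ + _ => h.
  suff : nsq j x * B <= 2 ^+ k * T j x by lra.
  have B0 : 0 <= B.
    apply: addr_ge0; last by rewrite mulr_ge0// powR_ge0.
    by apply: addr_ge0 => //; exact: lnp_ge0.
  have := ler_wpM2r B0 (nsq_le_tsq m t9).
  by rewrite /T /B; lra.
(* Below 9 the deviation suffices: [t (t - 1) = (t - 1) + (t - 1)^2], and with [t = p^2], [p <= 3],
   one has [(t - 1)^2 = (p + 1)^2 (p - 1)^2 <= 16 (p - 1)^2]. *)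
have := nsqE j x; move: (nsq j x) `|nfun j x| (normr_ge0 (nfun j x)) t0 t9 S0 => t p p0 t0 t9 S0 tE.
have p3 : p <= 3 by rewrite -(@ler_pXn2r _ 2) ?nnegrE//; lra.
have : 0 <= (16 - (p + 1) ^+ 2) * (p - 1) ^+ 2.
  rewrite mulr_ge0// subr_ge0; nra.
by rewrite tE; lra.
Qed.

Lemma ub_log_power_tail (tau : R) : 0 < tau -> tau <= 1 -> alpha * tau = 2 * alpha - 2 ->
  exists2 H, ub H & exists2 kap, 0 <= kap &
    forall j x, nsq j x * F_tau tau (nsq j x) <= kap * (nsq j x - 1) + H j x.
Proof.
move=> tau0 tau1 tauE; have [mdev dev0 _] := ub_dev.
have U1 := ub_tsq_weight2; have U2 := ub_tsq_entropy ub_tsq_weight_half.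
have CWt : 0 <= CW `^ tau by exact: powR_ge0.
(* To the [k] of [ln_nsq_le] are added 1 from [ln (1 + t) <= ln 2 + ln t] and 1 from
   [L^tau <= 1 + L]. *)
pose T j x := (k.+2)%:R * w j x + w j x * lnp (w j x * expR (- W x)) +
  CW `^ tau * (w j x * jap x `^ (2 * alpha - 2)).
have ubT : ub T.
  apply: uniformly_boundedD; last exact: uniformly_boundedZ.
  by apply: uniformly_boundedD => //; apply: uniformly_boundedZ => //; exact: ub_tsq.
pose kap : R := tau * ln 2 `^ (tau - 1) / 2.
have kap0 : 0 <= kap by rewrite divr_ge0// mulr_ge0 ?powR_ge0// ltW.
have kap16 : 0 <= 16 * kap by rewrite mulr_ge0.
exists (fun j x => 16 * kap * (`|nfun j x| - 1) ^+ 2 + 2 ^+ k * T j x).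
  by apply: uniformly_boundedD; apply: uniformly_boundedZ.
exists kap => // j x; have t0 := nsq_ge0 j x.
have := ler_wpM2l t0 (F_tau_le tau0 tau1 t0); rewrite -/kap.
have [_ T0 _] := ubT; have Tx : 0 <= 2 ^+ k * T j x by rewrite mulr_ge0.
have S0 := sqr_ge0 (`|nfun j x| - 1).
have [t9|t9] := leP 9 (nsq j x).
  move=> _; have lt := ln_nsq_le t9.
  set L := lnp _ in lt.
  have L0 : 0 <= L by exact: lnp_ge0.
  have J0 : 0 <= CW * jap x `^ alpha by rewrite mulr_ge0 ?powR_ge0.
  pose B := (k.+2)%:R + L + CW `^ tau * jap x `^ (2 * alpha - 2).
  have hB : F_tau tau (nsq j x) <= B.
    rewrite /F_tau; have l2 := powR_ge0 (ln 2 : R) tau.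
    suff : ln (1 + nsq j x) `^ tau <= B by lra.
    have hl : ln (1 + nsq j x) <= k.+1%:R + (L + CW * jap x `^ alpha).
      have h1 : ln (1 + nsq j x) <= ln (2 * nsq j x) by rewrite ler_ln ?posrE; lra.
      have h2 : ln 2 <= 1 :> R by have := @le_ln1Dx R 1; rewrite (_ : 1 + 1 = 2)//; apply; lra.
      move: h1; rewrite lnM ?posrE//; last lra.
      by rewrite -(natr1 k); lra.
    have l0 : 0 <= ln (1 + nsq j x) by rewrite ln_ge0//; lra.
    apply: (le_trans (ge0_le_powR (ltW tau0) l0 hl)).
    have LJ : 0 <= L + CW * jap x `^ alpha by rewrite addr_ge0.
    apply: (le_trans (powR_subadditive (ltW tau0) tau1 (ler0n R _) LJ)).
    have := powR_subadditive (ltW tau0) tau1 L0 J0.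
    have -> : (CW * jap x `^ alpha) `^ tau = CW `^ tau * jap x `^ (2 * alpha - 2).
      by rewrite powRM ?powR_ge0// -powRrM tauE.
    have h1 : k.+1%:R `^ tau <= k.+1%:R :> R by apply: ler1_powR; rewrite ?ler1n.
    have h2 : L `^ tau <= 1 + L.
      apply: (le_trans (powR_tangent tau0 tau1 L0)).
      have : 0 <= (1 - tau) * L by rewrite mulr_ge0// subr_ge0.
      have : 0 <= tau by exact: ltW.
      lra.
    by rewrite /B -(natr1 k.+1); lra.
  have B0 : 0 <= B.
    apply: addr_ge0; last by rewrite mulr_ge0// powR_ge0.
    exact: addr_ge0.
  have h1 := ler_wpM2l t0 hB.
  have h2 := ler_wpM2r B0 (nsq_le_tsq m t9).
  have e : 2 ^+ k * w j x * B = 2 ^+ k * T j x by rewrite /B /T -/L; ring.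
  have h3 : 0 <= kap * (nsq j x - 1) by rewrite mulr_ge0//; lra.
  have h4 : 0 <= 16 * kap * (`|nfun j x| - 1) ^+ 2 by rewrite mulr_ge0.
  by rewrite e in h2; lra.
have := nsqE j x; set F := F_tau tau (nsq j x); clearbody F.
move: (nsq j x) `|nfun j x| (normr_ge0 (nfun j x)) t0 t9 S0 => t p p0 t0 t9 S0 tE.
have p3 : p <= 3 by rewrite -(@ler_pXn2r _ 2) ?nnegrE//; lra.
have h : 0 <= (16 - (p + 1) ^+ 2) * (p - 1) ^+ 2.
  rewrite mulr_ge0// subr_ge0; nra.
have := mulr_ge0 kap0 h.
by rewrite tE; lra.
Qed.

End tail_bounds.

(** * Conclusion *)

Section signed_integrals.
Context d (T : measurableType d) (R : realType).
Local Open Scope ereal_scope.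

(** Only the larger function is integrable; the integral on the left may be -oo, so positive and
    negative parts are compared separately. *)
Lemma le_integral_integrable (mu : {measure set T -> \bar R}) (X Y : T -> R) :
  measurable_fun setT X -> mu.-integrable setT (EFin \o Y) ->
  (forall x, X x <= Y x)%R ->
  \int[mu]_x (X x)%:E <= \int[mu]_x (Y x)%:E.
Proof.
move=> mX iY XY; have mX' : measurable_fun setT (EFin \o X) by exact/measurable_EFinP.
have [mY _] := integrableP _ _ _ iY.
rewrite integralE [leRHS]integralE; apply: leeB.
- apply: ge0_le_integral => //.
  + exact: measurable_funepos.
  + exact: measurable_funepos.
  + by move=> x _; apply: (@funepos_le _ _ setT) => [y _|]; rewrite ?inE// lee_fin.
- apply: ge0_le_integral => //.
  + exact: measurable_funeneg.
  + exact: measurable_funeneg.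
  + by move=> x _; apply: (@funeneg_le _ _ setT) => [y _|]; rewrite ?inE// lee_fin.
Qed.

(** The majorant is treated as the nonnegative function [kap * t + H] minus the constant [kap]; the
    integrals of [kap * t] and [kap] cancel because [t] has mass 1 under a probability. *)
Lemma le_integral_centered (mu : probability T R) (X t H : T -> R) (kap : R) :
  measurable_fun setT X -> measurable_fun setT t -> measurable_fun setT H ->
  (forall x, 0 <= t x)%R -> (forall x, 0 <= H x)%R -> (0 <= kap)%R ->
  \int[mu]_x (t x)%:E = 1 -> (forall x, X x <= kap * (t x - 1) + H x)%R ->
  \int[mu]_x (X x)%:E <= \int[mu]_x (H x)%:E.
Proof.
move=> mX mt mH t0 H0 kap0 t1 XH.
have IH0 : 0 <= \int[mu]_x (H x)%:E by apply: integral_ge0 => x _; rewrite lee_fin.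
have [Hoo|Hoo] := eqVneq (\int[mu]_x (H x)%:E) +oo; first by rewrite Hoo leey.
have Hfin : \int[mu]_x (H x)%:E \is a fin_num by rewrite ge0_fin_numE// lt_neqAle Hoo leey.
have mkt : measurable_fun setT (fun x => kap * t x)%R by exact: measurable_funM.
have mktH : measurable_fun setT (fun x => kap * t x + H x)%R by exact: measurable_funD.
have kt0 x : (0 <= kap * t x)%R by rewrite mulr_ge0.
have ktH0 x : (0 <= kap * t x + H x)%R by rewrite addr_ge0.
have I1 : \int[mu]_x (kap * t x + H x)%:E = kap%:E + \int[mu]_x (H x)%:E.
  by rewrite integralD_ge0// integralZ_ge0// t1 mule1.
have i1 : mu.-integrable setT (EFin \o (fun x => kap * t x + H x)%R).
  apply/integrableP; split; first exact/measurable_EFinP.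
  under eq_integral do rewrite /= ger0_norm//.
  by rewrite I1 -(fineK Hfin) -EFinD ltry.
have i2 : mu.-integrable setT (EFin \o (fun=> kap)).
  exact: finite_measure_integrable_cst.
apply: (@le_trans _ _ (\int[mu]_x (kap * t x + H x - kap)%:E)).
  apply: le_integral_integrable => //.
    rewrite (_ : _ \o _ = (EFin \o (fun x => kap * t x + H x)%R) \- (EFin \o (fun=> kap)))//.
    exact: integrableB.
  by move=> x; have := XH x; lra.
under eq_integral do rewrite EFinB.
rewrite (integralB measurableT i1 i2) /= I1 integral_cst// [X in _ * X](_ : _ = 1).
  by rewrite mule1 addeAC subee// add0e.
exact: probability_setT.
Qed.

End signed_integrals.

Section cost_bounds.
Context {R : realType}.

Lemma cost_abs (a t : R) : cost a `|t| = cost a t.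
Proof. by rewrite /cost normr_id real_normK ?num_real. Qed.

(** In each regime the cost is comparable to the larger of [z^2] and [z^a], so it dominates both;
    the two moment bounds consume exactly these two powers of the slope. *)
Lemma cost_ge (a z : R) : 2 <= a -> 0 <= z ->
  z ^+ 2 <= a * cost a z /\ z `^ a <= a * cost a z.
Proof.
move=> a2 z0; have a0 : 0 < a by lra.
have zz : z ^+ 2 = z `^ 2%:R by rewrite powR_mulrn.
rewrite /cost ger0_norm//; case: ifPn => [z1|].
  have h : z ^+ 2 <= a * (z ^+ 2 / 2) by have := sqr_ge0 z; nra.
  split=> //; apply: le_trans h; move: z0; rewrite le_eqVlt => /orP[/eqP <-|zp].
    by rewrite powR0 ?gt_eqF// sqr_ge0.
  by rewrite zz ger_powR// zp z1.
rewrite -ltNge => z1.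
have h : z `^ a <= a * (z `^ a / a + (a - 2) / (2 * a)).
  rewrite mulrDr mulrCA divff ?mulr1 ?gt_eqF// lerDl.
  by rewrite mulr_ge0 ?(ltW a0)// divr_ge0 ?mulr_ge0//; lra.
split=> //; apply: le_trans h; rewrite zz.
by apply: ler_powR => //; exact: ltW.
Qed.

Lemma cost_ge0 (a z : R) : 2 <= a -> 0 <= cost a z.
Proof.
move=> a2; rewrite -cost_abs; have [h _] := cost_ge a2 (normr_ge0 z).
have a0 : 0 < a by lra.
by rewrite -(pmulr_rge0 _ a0); apply: le_trans h; exact: sqr_ge0.
Qed.

Lemma measurable_cost (a : R) : measurable_fun setT (cost a).
Proof.
apply: measurable_fun_ifT.
- by apply: measurable_fun_ler => //; exact: measurableT_comp.
- exact: measurable_funM.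
- apply: measurable_funD => //; apply: measurable_funM => //.
  exact: (measurableT_comp (measurable_powR _)).
Qed.

Lemma measurable_F_tau (tau : R) : measurable_fun setT (F_tau tau).
Proof.
apply: measurable_funB => //; apply: (measurableT_comp (measurable_powR _)).
by apply: (measurableT_comp (@measurable_ln R)); exact: measurable_funD.
Qed.

End cost_bounds.

Section normalization.
Context {R : realType} {n : nat}.
Variable mu : probability 'rV[R]_n R.

Lemma integral_normalized_le (E : normalized mu -> \bar R)
    (X H : normalized mu -> 'rV[R]_n -> R) (kap : R) :
  (forall j, measurable_fun setT (X j)) -> uniformly_bounded mu E H -> 0 <= kap ->
  (forall j x, X j x <= kap * (nsq j x - 1) + H j x) ->
  exists2 c, 0 <= c & forall j (M : R), 0 <= M ->
    (\int[mu]_x (M * X j x)%:E <= (c * M)%:E * E j)%E.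
Proof.
move=> mX [mH H0 [c c0 cH]] kap0 XH; exists c => // j M M0.
apply: (@le_trans _ _ (\int[mu]_x (M * H j x)%:E)%E).
  apply: (@le_integral_centered _ _ _ mu _ (nsq j) _ (M * kap)) => //.
  - exact: measurable_funM.
  - exact: measurable_nsq.
  - exact: measurable_funM.
  - exact: nsq_ge0.
  - by move=> x; rewrite mulr_ge0.
  - by rewrite mulr_ge0.
  - exact: normalized_mass.
  - by move=> x; rewrite -mulrA -mulrDr ler_wpM2l.
by rewrite integralZ_ge0// mulrC EFinM -muleA lee_wpmul2l// lee_fin.
Qed.

(** Dividing by the square root of [M] leaves the logarithmic slope unchanged, while [f^2] and
    [|grad f|^2] both scale by [M]; the inequalities therefore transfer back by homogeneity. *)
Lemma normalize (f : 'rV[R]_n -> R) g (M : R) : has_gradient f g -> 0 < M ->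
  (\int[mu]_x (f x ^+ 2)%:E = M%:E)%E ->
  exists j : normalized mu, [/\ forall x, f x ^+ 2 = M * nsq j x,
    forall x, \sum_i g i x ^+ 2 = M * ngrad_norm j x ^+ 2 &
    forall x, log_slope j x = Num.sqrt (\sum_i g i x ^+ 2) * `|f x|^-1].
Proof.
move=> fg M0 fM.
have s0 : 0 < Num.sqrt M by rewrite sqrtr_gt0.
have s2 : Num.sqrt M ^+ 2 = M by rewrite sqr_sqrtr// ltW.
have hg : has_gradient (fun x => f x / Num.sqrt M) (fun i x => g i x / Num.sqrt M).
  apply: has_gradient_ext (has_gradientM fg (has_gradient_cst (Num.sqrt M)^-1)) => i x.
  by rewrite mulr0 add0r mulrC.
have mass : (\int[mu]_x ((f x / Num.sqrt M) ^+ 2)%:E = 1)%E.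
  have e x : (f x / Num.sqrt M) ^+ 2 = M^-1 * f x ^+ 2.
    by rewrite expr_div_n s2 mulrC.
  under eq_integral do rewrite e.
  rewrite integralZ_ge0//.
  - by rewrite fM -EFinM mulVf// gt_eqF.
  - by apply: measurable_funX; exact: has_gradient_measurable fg.
  - by move=> x; exact: sqr_ge0.
  - by rewrite invr_ge0 ltW.
pose j := Normalized hg mass.
have gE x : \sum_i ngrad j i x ^+ 2 = M^-1 * \sum_i g i x ^+ 2.
  by rewrite mulr_sumr; apply: eq_bigr => i _; rewrite expr_div_n s2 mulrC.
have G0 x : 0 <= \sum_i g i x ^+ 2 by apply: sumr_ge0 => i _; exact: sqr_ge0.
have Mi0 : 0 <= M^-1 by rewrite invr_ge0 ltW.
exists j; split => x.
- by rewrite /nsq/= expr_div_n s2 mulrCA divff ?mulr1// gt_eqF.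
- rewrite sqr_sqrtr ?gE ?mulr_ge0// mulrA divff ?mul1r// gt_eqF//.
- rewrite /log_slope /ngrad_norm gE sqrtrM// sqrtrV ?(ltW M0)//=.
  rewrite powR_inv1// normrM normfV (gtr0_norm s0) invfM invrK.
  by move: `|f x|^-1 => y; field; rewrite gt_eqF.
Qed.

End normalization.

Theorem theorem5p25 (R : realType) (d : nat) (alpha alphas N C delta : R)
    (V V1 : 'rV[R]_d -> R) (mu : probability 'rV[R]_d R)
    (d_gt0 : (0 < d)%N)
    (alpha_gt1 : 1 < alpha) (alpha_le2 : alpha <= 2)
    (alphas_conj : 1 / alpha + 1 / alphas = 1)
    (N_gt0 : 0 < N)
    (V_def : forall x, V x = N * (enorm x `^ alpha / alpha + V1 x))
    (mu_def : forall A, measurable A ->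
      mu A = (\int[@lebesgue_rV R d]_(x in A) (expR (- V x))%:E)%E)
    (V1_C1 : Cn 1 V1)
    (C_gt0 : 0 < C) (delta_lt : delta < alpha / (2 + alpha))
    (V1_grad : forall x,
      enorm (gradient V1 x) <= delta * enorm x `^ (alpha - 1) + C) :
  exists C' : R, 0 < C' /\
    modified_log_sobolev mu (cost alpha) C' /\
    F_sobolev mu (F_tau (2 / alphas)) C'.
Proof.
have alpha0 : 0 < alpha by lra.
rewrite !div1r in alphas_conj.
have ai1 := invf_lt1 alpha0; rewrite alpha_gt1 in ai1.
have ai2 : 1 / 2 <= alpha^-1 by rewrite -(ler_pM2r alpha0) mulVf ?gt_eqF//; lra.
have as0 : 0 < alphas by rewrite -invr_gt0; lra.
have as2 : 2 <= alphas.
  by rewrite -[leLHS]invrK -[leRHS]invrK lef_pV2 ?posrE ?invr_gt0//; lra.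
(* [delta] may be negative; a nonnegative coefficient is needed to multiply inequalities by it. *)
pose dl := Num.max 0 delta.
have dl0 : 0 <= dl by rewrite le_max lexx.
have dl1 : dl < 1.
  rewrite gt_max ltr01/=; apply: (lt_le_trans delta_lt).
  by rewrite ler_pdivrMr; lra.
have V1_grad' x : enorm (gradient V1 x) <= dl * enorm x `^ (alpha - 1) + C.
  by apply: (le_trans (V1_grad x)); rewrite lerD2r ler_wpM2r ?powR_ge0// le_max lexx orbT.
pose W := smoothed_potential alpha N V1.
pose gW := smoothed_gradient alpha N V1.
have hW : has_gradient W gW := has_gradient_smoothed N alpha_gt1 V1_C1.
have [CW CW0 CWP] := smoothed_growth alpha_gt1 alpha_le2 N_gt0 V1_C1 C_gt0 dl0 dl1 V1_grad'.
have [Cg Cg0 CgP] := smoothed_grad_le alpha_gt1 alpha_le2 N_gt0 C_gt0 dl0 dl1 V1_grad'.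
have [a0 [b0 [a00 b00 radial]]] := smoothed_radial alpha_gt1 alpha_le2 N_gt0 C_gt0 dl0 dl1 V1_grad'.
have VW := smoothed_le alpha_gt1 alpha_le2 N_gt0 C_gt0 dl0 dl1 V_def.
have mV : measurable_fun setT (fun x => expR (- V x)).
  have mW := has_gradient_measurable hW.
  have me : measurable_fun setT (@enorm R d).
    apply: (measurableT_comp (@measurable_sqrt R)).
    exact: has_gradient_measurable (@has_gradient_sqnorm R d).
  apply: (measurableT_comp (@measurable_expR R)); apply: measurableT_comp => //.
  rewrite (_ : V = fun x => N * (enorm x `^ alpha / alpha + V1 x)); last exact/funext.
  apply: measurable_funM => //; apply: measurable_funD.
    by apply: measurable_funM => //; exact: (measurableT_comp (measurable_powR _)).
  exact: has_gradient_measurable (has_gradient_Cn V1_C1).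
have muE := ge0_integral_density (mu := @lebesgue_rV R d) (nu := mu) mV
  (fun x => expR_ge0 _) mu_def.
have mew : measurable_fun setT (fun x => expR (- W x)).
  exact: has_gradient_measurable (has_gradient_expRN hW).
have mu_ge (F : 'rV[R]_d -> R) : measurable_fun setT F -> (forall x, 0 <= F x) ->
    (\int[@lebesgue_rV R d]_x (F x * expR (- W x))%:E <= \int[mu]_x (F x)%:E)%E.
  move=> mF F0; rewrite muE//; apply: le_integral_ge0 => //.
  - exact: measurable_funM.
  - exact: measurable_funM.
  - by move=> x _; rewrite mulr_ge0// expR_ge0.
  - by move=> x _; rewrite ler_wpM2l// ler_expR lerN2; have [] := VW x.
have mu_le (F : 'rV[R]_d -> R) : measurable_fun setT F -> (forall x, 0 <= F x) ->
    (\int[mu]_x (F x)%:E <=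
     (expR N)%:E * \int[@lebesgue_rV R d]_x (F x * expR (- W x))%:E)%E.
  move=> mF F0; rewrite muE// -integralZ_ge0 ?expR_ge0//.
  - apply: le_integral_ge0 => //.
    + exact: measurable_funM.
    + by apply: measurable_funM => //; exact: measurable_funM.
    + by move=> x _; rewrite mulr_ge0// expR_ge0.
    + move=> x _; rewrite mulrCA ler_wpM2l// -expRD ler_expR.
      by have [_] := VW x; rewrite -/(W x); lra.
  - exact: measurable_funM.
  - by move=> x; rewrite mulr_ge0// expR_ge0.
(* The order of vanishing of the truncation is taken at least [alphas], as required by the bound on
   the moment of order [alpha]. *)
have [m mP] : exists m : nat, alphas <= (m.*2.+2)%:R.
  exists (Num.bound alphas); apply: ltW; apply: (lt_le_trans (archi_boundP (ltW as0))).
  have le_double2 b : (b <= b.*2.+2)%N.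
    by rewrite -addnn; exact: leq_trans (leq_addr b b) (leqW (leqW (leqnn _))).
  by rewrite ler_nat.
have eN0 := expR_gt0 N.
have [K K0 KP] := poincare_mu hW eN0 mu_ge mu_le alpha_gt1 alpha_le2 a00 b00 radial.
pose A2 (j : normalized mu) x := nsq j x * log_slope j x ^+ 2.
pose A1 (j : normalized mu) x := nsq j x * log_slope j x `^ alphas.
pose S (j : normalized mu) x := (`|nfun j x| - 1) ^+ 2.
have mA2 j : measurable_fun setT (A2 j).
  apply: measurable_funM; first exact: measurable_nsq.
  by apply: measurable_funX; exact: measurable_log_slope.
have mA1 j : measurable_fun setT (A1 j).
  apply: measurable_funM; first exact: measurable_nsq.
  by apply: (measurableT_comp (measurable_powR _)); exact: measurable_log_slope.
have A20 j x : 0 <= A2 j x by apply: mulr_ge0; [exact: nsq_ge0|exact: sqr_ge0].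
have A10 j x : 0 <= A1 j x by apply: mulr_ge0; [exact: nsq_ge0|exact: powR_ge0].
have mS j : measurable_fun setT (S j).
  apply: measurable_funX; apply: measurable_funB => //.
  by apply: measurableT_comp => //; exact: measurable_nfun.
have mnsq := @measurable_nsq R d mu; have nsq0 := @nsq_ge0 R d mu.
have UA20 j : (0 <= \int[mu]_x (A2 j x)%:E)%E by apply: integral_ge0 => x _; rewrite lee_fin.
have UA10 j : (0 <= \int[mu]_x (A1 j x)%:E)%E by apply: integral_ge0 => x _; rewrite lee_fin.
have ub_S E : uniformly_bounded mu E A2 -> uniformly_bounded mu E S.
  have K40 : 0 <= 4 * K by rewrite mulr_ge0// ltW.
  apply: (uniformly_bounded_trans _ _ K40) => // [j x|j]; first exact: sqr_ge0.
  exact: poincare_normalized K0 KP j.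
pose E2 (j : normalized mu) := (\int[mu]_x (A2 j x)%:E)%E.
(* The entropy is allowed both powers of the slope; [cost_ge] later bounds their sum by the dual
   cost. *)
pose E1 (j : normalized mu) := (\int[mu]_x (A2 j x + A1 j x)%:E)%E.
have ub22 : uniformly_bounded mu E2 A2.
  by split=> //; exists 1 => // j; rewrite mul1e.
have ub12 : uniformly_bounded mu E1 A2.
  split=> //; exists 1 => // j; rewrite mul1e /E1 integralD_ge0//.
  by rewrite leeDl.
have ub11 : uniformly_bounded mu E1 A1.
  split=> //; exists 1 => // j; rewrite mul1e /E1 integralD_ge0//.
  by rewrite leeDr.
have [H1 ubH1 H1P] := ub_log_tail hW eN0 mu_ge mu_le alpha_gt1 alpha_le2 alphas_conj
  mP a00 b00 radial CW0 Cg0 CWP CgP ub12 (ub_S _ ub12) ub11.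
have tau0 : 0 < 2 / alphas by rewrite divr_gt0.
have tau1 : 2 / alphas <= 1 by rewrite ler_pdivrMr// mul1r.
have tauE : alpha * (2 / alphas) = 2 * alpha - 2.
  have -> : alphas^-1 = 1 - alpha^-1 by lra.
  by field; rewrite gt_eqF.
have [H2 ubH2 [kap kap0 H2P]] := ub_log_power_tail m hW eN0 mu_ge mu_le alpha_gt1 alpha_le2
  a00 b00 radial CW0 Cg0 CWP CgP ub22 (ub_S _ ub22) tau0 tau1 tauE.
have mX1 (j : normalized mu) : measurable_fun setT (fun x => nsq j x * ln (nsq j x)).
  by apply: measurable_funM => //; exact: (measurableT_comp (@measurable_ln R)).
have mX2 (j : normalized mu) :
    measurable_fun setT (fun x => nsq j x * F_tau (2 / alphas) (nsq j x)).
  by apply: measurable_funM => //; exact: (measurableT_comp (measurable_F_tau _)).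
have H1P' j x : nsq j x * ln (nsq j x) <= 1 * (nsq j x - 1) + H1 j x.
  by rewrite mul1r.
have [c1 c10 c1P] := integral_normalized_le mX1 ubH1 ler01 H1P'.
have [c2 c20 c2P] := integral_normalized_le mX2 ubH2 kap0 H2P.
(* Each of the two powers of the slope costs a factor [alphas] in [cost_ge]; the 1 makes [C']
   positive. *)
pose C' := c1 * alphas * 2 + c2 + 1.
have C'0 : 0 < C' by rewrite /C' ltr_wpDl// addr_ge0// !mulr_ge0// ltW.
have massE f : square_integrable mu f -> (\int[mu]_x (f x ^+ 2)%:E)%E = (\int[mu]_x (f x ^+ 2))%:E.
  by move=> fi; rewrite /Rintegral fineK//; exact: integrable_fin_num.
have mass0 f : 0 <= \int[mu]_x (f x ^+ 2).
  by apply: fine_ge0; apply: integral_ge0 => x _; rewrite lee_fin sqr_ge0.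
have enormE f x : Num.sqrt (\sum_i partial i f x ^+ 2) = enorm (gradient f x).
  by rewrite /enorm; congr Num.sqrt; apply: eq_bigr => i _; rewrite mxE.
exists C'; split=> //; split => f sf fi.
- have fg := has_gradient_Cn (sf 1%N).
  rewrite (convex_conjugate_cost alpha_gt1 alphas_conj) /entropy.
  pose Z x := f x ^+ 2 * cost alphas (enorm (gradient f x) / f x).
  have Z0 x : 0 <= Z x by rewrite mulr_ge0 ?sqr_ge0// cost_ge0.
  have := mass0 f; rewrite le_eqVlt => /orP[/eqP M0|M0].
    (* At zero mass the quotient is 0 by convention and [ln 0 = 0], so the entropy integrand
       vanishes identically. *)
    rewrite integral0_eq; last by move=> x _; rewrite -M0 invr0 mulr0 ln0// mulr0.
    apply: mule_ge0; first by rewrite lee_fin ltW.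
    by apply: integral_ge0 => x _; rewrite lee_fin; exact: Z0.
  have [j [fE gE zE]] := normalize fg M0 (massE f fi).
  set M := \int[mu]_x (f x ^+ 2) in M0 fE gE *.
  have M0' := ltW M0.
  have -> : (\int[mu]_x (f x ^+ 2 * ln (f x ^+ 2 / M))%:E =
      \int[mu]_x (M * (nsq j x * ln (nsq j x)))%:E)%E.
    apply: eq_integral => x _; rewrite fE.
    by rewrite (mulrAC M _ M^-1) divff ?gt_eqF// mul1r -mulrA.
  apply: (le_trans (c1P j M M0')).
  have ZE x : Z x = M * nsq j x * cost alphas (log_slope j x).
    rewrite /Z fE -(cost_abs _ (_ / f x)) normrM normfV zE enormE.
    by rewrite (ger0_norm (enorm_ge0 _)).
  have mZ : measurable_fun setT Z.
    rewrite (_ : Z = fun x => M * nsq j x * cost alphas (log_slope j x)); last exact/funext.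
    apply: measurable_funM; first exact: measurable_funM.
    by apply: (measurableT_comp (measurable_cost _)); exact: measurable_log_slope.
  apply: (@le_trans _ _ ((c1 * alphas * 2)%:E * \int[mu]_x (Z x)%:E)%E); last first.
    apply: lee_wpmul2r; first by apply: integral_ge0 => x _; rewrite lee_fin.
    by rewrite lee_fin /C' -addrA lerDl addr_ge0.
  have a0' : 0 <= alphas * 2 by rewrite mulr_ge0// ltW.
  rewrite -(mulrA c1) (EFinM c1 (alphas * 2)) (EFinM c1 M) -!muleA lee_wpmul2l ?lee_fin//.
  rewrite /E1 -!integralZ_ge0//; last 2 first.
  + exact: measurable_funD.
  + by move=> x; rewrite addr_ge0.
  apply: le_integral_ge0 => //.
  + by apply: measurable_funM => //; exact: measurable_funD.
  + exact: measurable_funM.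
  + by move=> x _; rewrite mulr_ge0// addr_ge0.
  + move=> x _; rewrite ZE /A1 /A2 -mulrDr (mulrA M).
    have [h1 h2] := cost_ge as2 (log_slope_ge0 j x).
    have Mt : 0 <= M * nsq j x by rewrite mulr_ge0.
    rewrite [leRHS](_ : _ = M * nsq j x * (2 * (alphas * cost alphas (log_slope j x))));
  last by ring.
    by rewrite ler_wpM2l//; lra.
- have fg := has_gradient_Cn (sf 1%N).
  have := mass0 f; rewrite le_eqVlt => /orP[/eqP M0|M0].
    (* At zero mass the argument of [F_tau] is 0 by convention, and [F_tau] is nonpositive there. *)
    apply: (@le_trans _ _ (\int[mu]_x (cst 0 x)%:E)%E).
      apply: le_integral_integrable.
      + apply: measurable_funM.
          by apply: measurable_funX; exact: has_gradient_measurable fg.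
        apply: (measurableT_comp (measurable_F_tau _)); apply: measurable_funM => //.
        by apply: measurable_funX; exact: has_gradient_measurable fg.
      + exact: finite_measure_integrable_cst.
      + move=> x; rewrite -M0 invr0 mulr0 /F_tau addr0 ln1 powR0 ?gt_eqF// sub0r.
        by rewrite mulr_ge0_le0 ?sqr_ge0// oppr_le0 powR_ge0.
    rewrite integral0; apply: mule_ge0; first by rewrite lee_fin ltW.
    by apply: integral_ge0 => x _; rewrite lee_fin sqr_ge0.
  have [j [fE gE zE]] := normalize fg M0 (massE f fi).
  set M := \int[mu]_x (f x ^+ 2) in M0 fE gE *.
  have M0' := ltW M0.
  have -> : (\int[mu]_x (f x ^+ 2 * F_tau (2 / alphas) (f x ^+ 2 / M))%:E =
      \int[mu]_x (M * (nsq j x * F_tau (2 / alphas) (nsq j x)))%:E)%E.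
    apply: eq_integral => x _; rewrite fE.
    by rewrite (mulrAC M _ M^-1) divff ?gt_eqF// mul1r -mulrA.
  apply: (le_trans (c2P j M M0')).
  have GE x : enorm (gradient f x) ^+ 2 = M * ngrad_norm j x ^+ 2.
    by rewrite -enormE sqr_sqrtr ?gE// mulr_ge0 ?sqr_ge0.
  have mG : measurable_fun setT (fun x => enorm (gradient f x) ^+ 2).
    under eq_fun do rewrite GE.
    by apply: measurable_funM => //; apply: measurable_funX; exact: measurable_ngrad_norm.
  apply: (@le_trans _ _ (c2%:E * \int[mu]_x (enorm (gradient f x) ^+ 2)%:E)%E); last first.
    apply: lee_wpmul2r; first by apply: integral_ge0 => x _; rewrite lee_fin sqr_ge0.
    rewrite lee_fin /C' (addrC (c1 * _ * _)) -addrA lerDl addr_ge0// !mulr_ge0//.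
    exact: ltW.
  rewrite (EFinM c2 M) -!muleA lee_wpmul2l ?lee_fin// /E2 -integralZ_ge0//.
  apply: le_integral_ge0 => //.
  + exact: measurable_funM.
  + by move=> x _; rewrite mulr_ge0.
  + by move=> x _; rewrite GE ler_wpM2l// nsq_log_slope_le.
Qed.
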